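(* Let $u_0$ be a smooth function on $[0,1]$ satisfying either the periodic boundary conditions $u_0(0)=u_0(1)$, $u_0'(0)=u_0'(1)$ or the Dirichlet boundary conditions $u_0(0)=u_0(1)=0$, and suppose that $u_0'$ attains its greatest value $M_0>0$ at finitely many points $\overline\alpha_1,\dots,\overline\alpha_n\in[0,1]$. If $u_0''(\overline\alpha_i)=0$ for at least one $i$, then the solution $u$ of the problem below (with the corresponding boundary conditions) remains smooth for all $t\ge0$. In particular, if $u_0''$ has a zero of the same order $k\ge1$ at every $\overline\alpha_i$, then the solution remains smooth for all time and, as $t\to+\infty$: if $k=1$, $u_x(\gamma(\alpha,t),t)$ converges to a non-trivial (nonzero) limit (positive at $\alpha=\overline\alpha_i$, negative at $\alpha\neq\overline\alpha_i$), whereas if $k>1$, $u_x(\gamma(\alpha,t),t)\to0$ for every $\alpha\in[0,1]$ (with $M(t)\to0^+$).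
   Context: Consider the initial value problem $u_{xt}+u u_{xx}-u_x^2=-2\int_0^1 u_x^2\,dx$ for $t>0$, $x\in[0,1]$, with $u(x,0)=u_0(x)$, under either periodic boundary conditions $u(0,t)=u(1,t)$, $u_x(0,t)=u_x(1,t)$, or Dirichlet boundary conditions $u(0,t)=u(1,t)=0$. For $\alpha\in[0,1]$ the Lagrangian flow $\gamma(\alpha,t)$ is defined by $\dot\gamma(\alpha,t)=u(\gamma(\alpha,t),t)$, $\gamma(\alpha,0)=\alpha$. Set $M(t)=\sup_{\alpha\in[0,1]}u_x(\gamma(\alpha,t),t)$. A smooth function $f$, not identically zero, has a zero of order $k\in\mathbb Z^+$ at $x_0$ if $f(x_0)=f'(x_0)=\dots=f^{(k-1)}(x_0)=0$ and $f^{(k)}(x_0)\neq0$.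
   Formalization: In the periodic case u_0 is taken smooth and 1-periodic on the line (all derivatives match at 0 and 1), and u likewise 1-periodic in x; with only u_0 and u_0' matching, u_0(0)≠0 and u_0''(0)≠u_0''(1), no smooth solution exists. *)

(* Defs.v *)
From Stdlib Require Import Reals Lra List.
Open Scope R_scope.

Fixpoint nth_deriv (n : nat) (f g : R -> R) : Prop :=
  match n with
  | O => forall x, g x = f x
  | S m => exists h, nth_deriv m f h /\ forall x, derivable_pt_lim h x (g x)
  end.

Definition deriv_n_at (f : R -> R) (n : nat) (x v : R) : Prop :=
  exists g, nth_deriv n f g /\ g x = v.

Definition smooth1 (f : R -> R) : Prop := forall n, exists g, nth_deriv n f g.

Definition deriv_zero_of_order (f : R -> R) (d k : nat) (x0 : R) : Prop :=
  (forall j, (j < k)%nat -> deriv_n_at f (d + j) x0 0) /\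
  (exists v, deriv_n_at f (d + k) x0 v /\ v <> 0).

Definition continuity2 (f : R -> R -> R) : Prop :=
  forall x t eps, 0 < eps -> exists delta, 0 < delta /\
    forall y s, Rabs (y - x) < delta -> Rabs (s - t) < delta ->
      Rabs (f y s - f x t) < eps.

Definition pdx (f g : R -> R -> R) : Prop :=
  forall x t, derivable_pt_lim (fun y => f y t) x (g x t).
Definition pdt (f g : R -> R -> R) : Prop :=
  forall x t, derivable_pt_lim (fun s => f x s) t (g x t).

Fixpoint Ck2 (n : nat) (f : R -> R -> R) : Prop :=
  continuity2 f /\
  match n with
  | O => True
  | S m => exists fx ft, pdx f fx /\ pdt f ft /\ Ck2 m fx /\ Ck2 m ft
  end.

Definition smooth2 (f : R -> R -> R) : Prop := forall n, Ck2 n f.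

Definition integral01 (h : R -> R) (I : R) : Prop :=
  exists pr : Riemann_integrable h 0 1, RiemannInt pr = I.

Inductive BC : Type := Periodic | Dirichlet.

Definition admissible (bc : BC) (u0 : R -> R) : Prop :=
  smooth1 u0 /\
  match bc with
  | Periodic => forall x, u0 (x + 1) = u0 x
  | Dirichlet => u0 0 = 0 /\ u0 1 = 0
  end.

Definition is_global_solution (bc : BC) (u0 : R -> R) (u ux : R -> R -> R) : Prop :=
  smooth2 u /\ pdx u ux /\
  (exists uxx uxt, pdx ux uxx /\ pdt ux uxt /\
     forall t, 0 < t -> exists I, integral01 (fun y => (ux y t) ^ 2) I /\
       forall x, 0 <= x <= 1 ->
         uxt x t + u x t * uxx x t - (ux x t) ^ 2 = - 2 * I) /\
  (forall x, 0 <= x <= 1 -> u x 0 = u0 x) /\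
  match bc with
  | Periodic => forall x t, 0 <= t -> u (x + 1) t = u x t
  | Dirichlet => forall t, 0 <= t -> u 0 t = 0 /\ u 1 t = 0
  end.

Definition is_flow (u : R -> R -> R) (gamma : R -> R -> R) : Prop :=
  forall a, 0 <= a <= 1 ->
    gamma a 0 = a /\
    (forall eps, 0 < eps -> exists delta, 0 < delta /\
       forall s, 0 <= s < delta -> Rabs (gamma a s - a) < eps) /\
    (forall t, 0 < t -> derivable_pt_lim (gamma a) t (u (gamma a t) t)).

Definition lim_infty (f : R -> R) (L : R) : Prop :=
  forall eps, 0 < eps -> exists T, forall t, T <= t -> Rabs (f t - L) < eps.

(* Main.v *)
(* Along the flow the reciprocal Jacobian w = 1/gamma_a satisfies w_tt = S(t) w with
   S = 2 int u_x^2 independent of the label, so w = phi(t) (1 - eta(t) u0'(a)) with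
   eta' = 1/phi^2, and conservation of length, int 1/w = 1, forces phi = P(eta) where
   P(eta) = int_0^1 da / (1 - eta u0'(a)).  Time is thus dt = P(eta)^2 deta, and the solution is
   global as soon as int^{1/M0} P^2 = +oo; one maximum point of u0' with u0'' = 0 gives
   P >= c (1 - eta M0)^(-1/2), which suffices.  With s^2 = 1/eta - M0 -> 0 and g = M0 - u0',
   the gradient along the flow is
     u_x = (1/I1^2) (1/(s^2 + g(a)) - I2/I1),   I_j = int_0^1 (s^2 + g)^(-j),
   so that |u_x| <= 1/(s I1)^2.  A cubic zero of g makes s I1 -> +oo; if all zeros are
   quadratic, then s I1 -> C > 0 and s^2 I2/I1 -> 1/2, and u_x -> +-1/(2 C^2).
   The flow map inverts smoothly, so u = gamma_t o gamma^{-1}; since a solution has to be smooth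
   on the whole (x,t)-plane, w is first extended smoothly and positively off [0,1] x [0,oo). *)

From Coquelicot Require Import Coquelicot.
Require Import Defs.
From Stdlib Require Import Reals List Lra Lia FunctionalExtensionality IndefiniteDescription Classical.
Open Scope R_scope.

(** The asymptotic claims quantify over every solution and every flow, so they cannot be read off
    the constructed solution: the formula for [u_x] is derived anew from an arbitrary one. There the
    flow is differentiable in time but nothing is assumed about its dependence on the label, so the
    Jacobian enters as [exp (int u_x)] along trajectories and is identified with the label
    derivative afterwards. In the construction [P^2] dominates a multiple of [1/(1 - eta M0)], whose
    integral diverges only logarithmically. Hence [eta] is made a function of a parameter [s] with
    [1 - eta M0] comparable to [exp (-s)]; then [dt/ds] is bounded below and every time is reached,
    without improper integrals. Smoothness on the whole plane requires [1 - eta u0'] to stay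
    positive for negative times as well and, under Dirichlet conditions, for labels outside [[0,1]],
    where [u0'] may exceed [M0]. The contributions of the zeros of [g] are added up by a creeping
    argument: the existence of the scaled limits is additive over adjacent intervals and holds near
    each point. *)

(** * Calculus rules in explicit lambda form *)

Lemma continuity_pt_plusR f g x : continuity_pt f x -> continuity_pt g x ->
  continuity_pt (fun y => f y + g y) x.
Proof. exact (continuity_pt_plus f g x). Qed.

Lemma continuity_pt_minusR f g x : continuity_pt f x -> continuity_pt g x ->
  continuity_pt (fun y => f y - g y) x.
Proof. exact (continuity_pt_minus f g x). Qed.

Lemma continuity_pt_multR f g x : continuity_pt f x -> continuity_pt g x ->
  continuity_pt (fun y => f y * g y) x.
Proof. exact (continuity_pt_mult f g x). Qed.

Lemma continuity_plusR f g : continuity f -> continuity g -> continuity (fun y => f y + g y).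
Proof. exact (continuity_plus f g). Qed.

Lemma continuity_minusR f g : continuity f -> continuity g -> continuity (fun y => f y - g y).
Proof. exact (continuity_minus f g). Qed.

Lemma continuity_multR f g : continuity f -> continuity g -> continuity (fun y => f y * g y).
Proof. exact (continuity_mult f g). Qed.

Lemma derivable_pt_lim_plusR f g x l m : derivable_pt_lim f x l -> derivable_pt_lim g x m ->
  derivable_pt_lim (fun y => f y + g y) x (l + m).
Proof. exact (derivable_pt_lim_plus f g x l m). Qed.

Lemma derivable_pt_lim_minusR f g x l m : derivable_pt_lim f x l -> derivable_pt_lim g x m ->
  derivable_pt_lim (fun y => f y - g y) x (l - m).
Proof. exact (derivable_pt_lim_minus f g x l m). Qed.

Lemma derivable_pt_lim_multR f g x l m : derivable_pt_lim f x l -> derivable_pt_lim g x m ->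
  derivable_pt_lim (fun y => f y * g y) x (l * g x + f x * m).
Proof. exact (derivable_pt_lim_mult f g x l m). Qed.

Lemma derivable_pt_lim_oppR f x l : derivable_pt_lim f x l -> derivable_pt_lim (fun y => - f y) x (- l).
Proof. exact (derivable_pt_lim_opp f x l). Qed.

Ltac derive_by_ring := apply is_derive_Reals; auto_derive; [exact I|ring].

(** * Smooth functions of two variables *)

Lemma continuity2_iff (f : R -> R -> R) :
  continuity2 f <-> forall x t, continuity_2d_pt f x t.
Proof.
  split.
  - intros H x t [eps Heps]. destruct (H x t eps Heps) as [d [Hd H1]].
    exists (mkposreal d Hd). intros u v Hu Hv. now apply H1.
  - intros H x t eps Heps. destruct (H x t (mkposreal eps Heps)) as [[d Hd] H1].
    exists d. split; [exact Hd|]. intros y s Hy Hs. now apply (H1 y s).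
Qed.

Lemma Ck2_continuity n f : Ck2 n f -> continuity2 f.
Proof. destruct n; simpl; tauto. Qed.

Lemma Ck2_pred n : forall f, Ck2 (S n) f -> Ck2 n f.
Proof.
  induction n as [|n IH]; intros f [Hc [fx [ft [Hx [Ht [Hfx Hft]]]]]].
  - simpl. auto.
  - split; [exact Hc|]. exists fx, ft. repeat split; auto.
Qed.

Lemma Ck2_ext n f g : (forall x t, f x t = g x t) -> Ck2 n f -> Ck2 n g.
Proof.
  intros H Hf. replace g with f; [exact Hf|].
  extensionality x; extensionality t; apply H.
Qed.

Lemma Ck2_const n c : Ck2 n (fun _ _ => c).
Proof.
  revert c; induction n as [|n IH]; intros c; split.
  - apply continuity2_iff; intros; apply continuity_2d_pt_const.
  - exact I.
  - apply continuity2_iff; intros; apply continuity_2d_pt_const.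
  - exists (fun _ _ => 0), (fun _ _ => 0). repeat split; try apply IH;
    intros x t; apply derivable_pt_lim_const.
Qed.

Lemma Ck2_fst n : Ck2 n (fun x _ => x).
Proof.
  destruct n as [|n]; split; try exact I;
  try (apply continuity2_iff; intros; apply continuity_2d_pt_id1).
  exists (fun _ _ => 1), (fun _ _ => 0). repeat split; try apply Ck2_const; intros x t.
  - apply derivable_pt_lim_id.
  - apply derivable_pt_lim_const.
Qed.

Lemma Ck2_snd n : Ck2 n (fun _ t => t).
Proof.
  destruct n as [|n]; split; try exact I;
  try (apply continuity2_iff; intros; apply continuity_2d_pt_id2).
  exists (fun _ _ => 0), (fun _ _ => 1). repeat split; try apply Ck2_const; intros x t.
  - apply derivable_pt_lim_const.
  - apply derivable_pt_lim_id.
Qed.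

Lemma Ck2_plus n : forall f g, Ck2 n f -> Ck2 n g -> Ck2 n (fun x t => f x t + g x t).
Proof.
  induction n as [|n IH]; intros f g [Hf Hf'] [Hg Hg']; rewrite continuity2_iff in Hf, Hg;
    (split; [apply continuity2_iff; intros; now apply continuity_2d_pt_plus|]).
  - exact I.
  - destruct Hf' as [fx [ft [A [B [C D]]]]], Hg' as [gx [gt [A' [B' [C' D']]]]].
    exists (fun x t => fx x t + gx x t), (fun x t => ft x t + gt x t).
    repeat split; try (now apply IH); intros x t.
    + exact (derivable_pt_lim_plus _ _ _ _ _ (A x t) (A' x t)).
    + exact (derivable_pt_lim_plus _ _ _ _ _ (B x t) (B' x t)).
Qed.

Lemma Ck2_mult n : forall f g, Ck2 n f -> Ck2 n g -> Ck2 n (fun x t => f x t * g x t).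
Proof.
  induction n as [|n IH]; intros f g Cf Cg; assert (Cf1 := Cf); assert (Cg1 := Cg);
    destruct Cf as [Hf Hf'], Cg as [Hg Hg']; rewrite continuity2_iff in Hf, Hg;
    (split; [apply continuity2_iff; intros; now apply continuity_2d_pt_mult|]).
  - exact I.
  - apply Ck2_pred in Cf1; apply Ck2_pred in Cg1.
    destruct Hf' as [fx [ft [A [B [C D]]]]], Hg' as [gx [gt [A' [B' [C' D']]]]].
    exists (fun x t => fx x t * g x t + f x t * gx x t),
           (fun x t => ft x t * g x t + f x t * gt x t).
    repeat split; try (apply Ck2_plus; now apply IH); intros x t.
    + exact (derivable_pt_lim_mult _ _ _ _ _ (A x t) (A' x t)).
    + exact (derivable_pt_lim_mult _ _ _ _ _ (B x t) (B' x t)).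
Qed.

Lemma Ck2_opp n f : Ck2 n f -> Ck2 n (fun x t => - f x t).
Proof.
  intros H. apply (Ck2_ext n (fun x t => (-1) * f x t)); [intros; ring|].
  apply Ck2_mult; [apply Ck2_const|exact H].
Qed.

Lemma Ck2_minus n f g : Ck2 n f -> Ck2 n g -> Ck2 n (fun x t => f x t - g x t).
Proof.
  intros Hf Hg. apply Ck2_plus; [exact Hf|now apply Ck2_opp].
Qed.

(** The derivative is a product of factors [/ f] instead of a quotient by [f ^ 2], so that the
    induction in [Ck2_inv] applies to each factor. *)
Lemma derivable_pt_lim_invR f x l : derivable_pt_lim f x l -> f x <> 0 ->
  derivable_pt_lim (fun y => / f y) x (- l * (/ f x * / f x)).
Proof.
  intros H Hn. apply is_derive_Reals. apply is_derive_Reals in H.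
  replace (- l * (/ f x * / f x)) with (- l / f x ^ 2) by now field.
  now apply (is_derive_inv f).
Qed.

Lemma Ck2_inv n : forall f, (forall x t, f x t <> 0) -> Ck2 n f -> Ck2 n (fun x t => / f x t).
Proof.
  induction n as [|n IH]; intros f Hn Cf; assert (Cf1 := Cf);
    destruct Cf as [Hf Hf']; rewrite continuity2_iff in Hf;
    (split; [apply continuity2_iff; intros; now apply continuity_2d_pt_inv|]).
  - exact I.
  - apply Ck2_pred in Cf1. specialize (IH f Hn Cf1).
    destruct Hf' as [fx [ft [A [B [C D]]]]].
    exists (fun x t => - fx x t * (/ f x t * / f x t)),
           (fun x t => - ft x t * (/ f x t * / f x t)).
    repeat split;
     try (apply Ck2_mult; [now apply Ck2_opp | now apply Ck2_mult]); intros x t.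
    + now apply (derivable_pt_lim_invR (fun y => f y t)).
    + now apply derivable_pt_lim_invR.
Qed.

Lemma Ck2_div n f g : (forall x t, g x t <> 0) -> Ck2 n f -> Ck2 n g ->
  Ck2 n (fun x t => f x t / g x t).
Proof. intros H Hf Hg. apply Ck2_mult; [exact Hf|now apply Ck2_inv]. Qed.

(** Continuity of one partial derivative, here the one in [x], yields differentiability; the
    two-variable chain rule below rests on this. *)
Lemma C1_differentiable f fx ft x t :
  continuity2 fx -> pdx f fx -> pdt f ft ->
  differentiable_pt_lim f x t (fx x t) (ft x t).
Proof.
  intros Hc Hx Ht. apply filterdiff_differentiable_pt_lim.
  apply (is_derive_filterdiff f x t fx (ft x t)).
  - apply filter_forall. intros u. apply is_derive_Reals, Hx.
  - apply is_derive_Reals, Ht.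
  - rewrite continuity2_iff in Hc. apply (continuity_2d_pt_filterlim fx), Hc.
Qed.

Lemma continuity2_comp F a b : continuity2 F -> continuity2 a -> continuity2 b ->
  continuity2 (fun x t => F (a x t) (b x t)).
Proof.
  intros HF Ha Hb x t eps He.
  destruct (HF (a x t) (b x t) eps He) as [d [Hd H]].
  destruct (Ha x t d Hd) as [d1 [Hd1 H1]]. destruct (Hb x t d Hd) as [d2 [Hd2 H2]].
  exists (Rmin d1 d2). split; [now apply Rmin_pos|].
  intros y s Hy Hs. pose proof (Rmin_l d1 d2); pose proof (Rmin_r d1 d2).
  apply H; [apply H1|apply H2]; lra.
Qed.

Lemma pdx_comp F Fx Ft a ax b bx :
  continuity2 Fx -> pdx F Fx -> pdt F Ft -> pdx a ax -> pdx b bx ->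
  pdx (fun x t => F (a x t) (b x t))
      (fun x t => Fx (a x t) (b x t) * ax x t + Ft (a x t) (b x t) * bx x t).
Proof.
  intros Hc HFx HFt Ha Hb x t.
  apply (derivable_pt_lim_comp_2d F (fun y => a y t) (fun y => b y t)); auto.
  now apply C1_differentiable.
Qed.

Lemma pdt_comp F Fx Ft a at_ b bt :
  continuity2 Fx -> pdx F Fx -> pdt F Ft -> pdt a at_ -> pdt b bt ->
  pdt (fun x t => F (a x t) (b x t))
      (fun x t => Fx (a x t) (b x t) * at_ x t + Ft (a x t) (b x t) * bt x t).
Proof.
  intros Hc HFx HFt Ha Hb x t.
  apply (derivable_pt_lim_comp_2d F (fun y => a x y) (fun y => b x y)); auto.
  now apply C1_differentiable.
Qed.

Lemma Ck2_comp n : forall F a b, Ck2 n F -> Ck2 n a -> Ck2 n b ->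
  Ck2 n (fun x t => F (a x t) (b x t)).
Proof.
  induction n as [|n IH]; intros F a b CF Ca Cb;
    (split; [apply continuity2_comp; eapply Ck2_continuity; eassumption|]).
  - exact I.
  - assert (Ca1 := Ck2_pred _ _ Ca); assert (Cb1 := Ck2_pred _ _ Cb).
    destruct CF as [_ [Fx [Ft [A [B [C D]]]]]], Ca as [_ [ax [at_ [A1 [B1 [C1 D1]]]]]],
      Cb as [_ [bx [bt [A2 [B2 [C2 D2]]]]]].
    assert (HC := Ck2_continuity _ _ C).
    eexists; eexists. split; [|split; [|split]].
    + now apply (pdx_comp F Fx Ft a ax b bx).
    + now apply (pdt_comp F Fx Ft a at_ b bt).
    + apply Ck2_plus; apply Ck2_mult; auto.
    + apply Ck2_plus; apply Ck2_mult; auto.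
Qed.

Lemma Ck2_exp n : forall f, Ck2 n f -> Ck2 n (fun x t => exp (f x t)).
Proof.
  induction n as [|n IH]; intros f Cf; assert (Cf0 := Cf); destruct Cf0 as [Hf Hf'];
    (split; [apply continuity2_iff; intros; apply continuity_1d_2d_pt_comp;
      [apply derivable_continuous_pt, derivable_pt_exp|now apply continuity2_iff]|]).
  - exact I.
  - apply Ck2_pred in Cf. specialize (IH f Cf).
    destruct Hf' as [fx [ft [A [B [C D]]]]].
    exists (fun x t => exp (f x t) * fx x t), (fun x t => exp (f x t) * ft x t).
    repeat split; try now apply Ck2_mult.
    + intros x t. apply (derivable_pt_lim_comp (fun y => f y t) exp); [apply A|].
      apply derivable_pt_lim_exp.
    + intros x t. apply (derivable_pt_lim_comp (fun y => f x y) exp); [apply B|].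
      apply derivable_pt_lim_exp.
Qed.

(** * Smooth functions of one variable *)

(** The recursion of [nth_deriv] appends the last derivative, while inductions on smoothness need
    the first one removed. *)
Lemma nth_deriv_peel m : forall g dg h, (forall x, derivable_pt_lim g x (dg x)) ->
  nth_deriv (S m) g h -> nth_deriv m dg h.
Proof.
  induction m as [|m IH]; intros g dg h Hg [k [Hk Hh]].
  - intros x. simpl in Hk.
    replace k with g in Hh by (extensionality y; symmetry; apply Hk).
    exact (uniqueness_limite _ _ _ _ (Hh x) (Hg x)).
  - exists k. split; [now apply (IH g)|exact Hh].
Qed.

Lemma smooth1_deriv g dg : smooth1 g -> (forall x, derivable_pt_lim g x (dg x)) -> smooth1 dg.
Proof.
  intros H Hg n. destruct (H (S n)) as [h Hh]. exists h. now apply nth_deriv_peel with g.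
Qed.

Lemma smooth1_ex_deriv g : smooth1 g ->
  exists dg, (forall x, derivable_pt_lim g x (dg x)) /\ smooth1 dg.
Proof.
  intros H. destruct (H 1%nat) as [dg [k [Hk Hd]]].
  replace k with g in Hd by (extensionality y; symmetry; apply Hk).
  exists dg. split; [exact Hd|]. now apply smooth1_deriv with g.
Qed.

Lemma smooth1_smooth2 n : forall g, smooth1 g -> Ck2 n (fun x _ => g x).
Proof.
  induction n as [|n IH]; intros g Hg; destruct (smooth1_ex_deriv g Hg) as [dg [Hd Hs]];
    (split; [apply continuity2_iff; intros; apply continuity_1d_2d_pt_comp;
       [apply derivable_continuous_pt; exists (dg x); apply Hd|apply continuity_2d_pt_id1]|]).
  - exact I.
  - exists (fun x _ => dg x), (fun _ _ => 0). repeat split.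
    + intros x t; apply Hd.
    + intros x t; apply derivable_pt_lim_const.
    + now apply IH.
    + apply Ck2_const.
Qed.

(** * Slices, bounds on rectangles and integrals with a parameter *)

Lemma continuity2_1 f t : continuity2 f -> continuity (fun x => f x t).
Proof.
  intros H x eps He. destruct (H x t eps He) as [d [Hd H1]].
  exists d. split; [exact Hd|]. intros y [_ Hy]. apply H1; [exact Hy|].
  rewrite Rminus_diag, Rabs_R0; exact Hd.
Qed.

Lemma continuity2_2 f x : continuity2 f -> continuity (fun t => f x t).
Proof.
  intros H t eps He. destruct (H x t eps He) as [d [Hd H1]].
  exists d. split; [exact Hd|]. intros y [_ Hy]. apply H1; [|exact Hy].
  rewrite Rminus_diag, Rabs_R0; exact Hd.
Qed.

Lemma continuity_pt_cst (c x : R) : continuity_pt (fun _ => c) x.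
Proof. apply continuity_pt_const. now intros ? ?. Qed.

Lemma continuity_cst (c : R) : continuity (fun _ => c).
Proof. intros x. apply continuity_pt_cst. Qed.

Lemma continuity_of_deriv f df : (forall x, derivable_pt_lim f x (df x)) -> continuity f.
Proof. intros H x. apply derivable_continuous_pt. exists (df x). apply H. Qed.

Lemma ex_RInt_continuity f a b : continuity f -> ex_RInt f a b.
Proof.
  intros H. apply (ex_RInt_continuous (V := R_CompleteNormedModule)).
  intros z _. apply continuity_pt_filterlim, H.
Qed.

Lemma derivable_pt_lim_RInt f a x : continuity f -> derivable_pt_lim (fun y => RInt f a y) x (f x).
Proof.
  intros H. apply is_derive_Reals, (is_derive_RInt f (fun y => RInt f a y) a x).
  - apply filter_forall. intros y. apply (RInt_correct (V := R_CompleteNormedModule)), ex_RInt_continuity, H.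
  - apply continuity_pt_filterlim, H.
Qed.

(** Uniform continuity with tolerance 1: a number of steps that depends only on the rectangle leads
    from a corner to any point, and each step changes [f] by less than 1. *)
Lemma rectangle_bound f a b c d : continuity2 f ->
  exists K, 0 <= K /\ forall x t, a <= x <= b -> c <= t <= d -> Rabs (f x t) <= K.
Proof.
  intros Hf.
  assert (Hu : forall x y, a <= x <= b -> c <= y <= d -> continuity_2d_pt f x y)
    by (intros; now apply continuity2_iff).
  destruct (uniform_continuity_2d f a b c d Hu (mkposreal 1 Rlt_0_1)) as [[del Hdel] Hunif].
  simpl in Hunif.
  destruct (INR_unbounded ((Rabs (b - a) + Rabs (d - c)) / del)) as [n Hn].
  assert (HN : 0 < INR n).
  { eapply Rle_lt_trans; [|exact Hn]. apply Rdiv_le_0_compat; [|exact Hdel].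
    pose proof (Rabs_pos (b - a)). pose proof (Rabs_pos (d - c)). lra. }
  assert (HNdel : Rabs (b - a) + Rabs (d - c) < INR n * del).
  { apply Rmult_lt_reg_r with (/ del); [now apply Rinv_0_lt_compat|].
    replace (INR n * del * / del) with (INR n) by (field; lra). exact Hn. }
  exists (Rabs (f a c) + INR n). split; [pose proof (Rabs_pos (f a c)); lra|].
  intros x t Hx Ht. pose proof (Rle_abs (b - a)). pose proof (Rle_abs (d - c)).
  pose proof (Rabs_pos (b - a)). pose proof (Rabs_pos (d - c)).
  (* walk from [(a,c)] to [(x,t)] in [n] steps shorter than [del] *)
  assert (Hstep : forall k, (k <= n)%nat ->
    Rabs (f (a + INR k * ((x - a) / INR n)) (c + INR k * ((t - c) / INR n))) <= Rabs (f a c) + INR k).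
  { assert (Hin : forall y z w k, y <= w <= z -> (k <= n)%nat -> z - y < INR n * del ->
      y <= y + INR k * ((w - y) / INR n) <= z /\ 0 <= (w - y) / INR n < del).
    { intros y z w k Hw Hk Hl. apply le_INR in Hk. pose proof (pos_INR k).
      assert (E : INR n * ((w - y) / INR n) = w - y) by (field; lra).
      assert (0 <= (w - y) / INR n) by (apply Rdiv_le_0_compat; lra).
      split; [split; nra|]. split; [assumption|]. apply Rmult_lt_reg_l with (INR n); lra. }
    induction k as [|k IH]; intros Hk.
    - simpl. rewrite !Rmult_0_l, !Rplus_0_r. lra.
    - specialize (IH ltac:(lia)).
      destruct (Hin a b x k Hx ltac:(lia) ltac:(lra)) as [X1 X3].
      destruct (Hin a b x (S k) Hx Hk ltac:(lra)) as [X2 _].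
      destruct (Hin c d t k Ht ltac:(lia) ltac:(lra)) as [T1 T3].
      destruct (Hin c d t (S k) Ht Hk ltac:(lra)) as [T2 _].
      assert (Hlt := Hunif _ _ _ _ X1 T1 X2 T2). rewrite S_INR in *.
      match type of Hlt with ?P -> ?Q -> Rabs (?u - ?v) < 1 =>
        assert (Rabs (u - v) < 1) by (apply Hlt; apply Rabs_def1; lra);
        pose proof (Rabs_triang_inv u v) end.
      lra. }
  specialize (Hstep n (le_n n)).
  replace (a + INR n * ((x - a) / INR n)) with x in Hstep by (field; lra).
  replace (c + INR n * ((t - c) / INR n)) with t in Hstep by (field; lra). exact Hstep.
Qed.

Lemma RInt_abs_bound f a b K : continuity f -> 
  (forall x, Rmin a b <= x <= Rmax a b -> Rabs (f x) <= K) ->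
  Rabs (RInt f a b) <= K * Rabs (b - a).
Proof.
  intros Hf. revert a b.
  assert (H : forall a b, a <= b -> (forall x, a <= x <= b -> Rabs (f x) <= K) ->
    Rabs (RInt f a b) <= K * Rabs (b - a)).
  { intros a b Hab H. rewrite (Rabs_pos_eq (b - a)) by lra.
    rewrite Rmult_comm. apply abs_RInt_le_const; auto. now apply ex_RInt_continuity. }
  intros a b HK. destruct (Rle_lt_dec a b) as [Hab|Hab].
  - apply H; [exact Hab|]. intros x Hx. apply HK. now rewrite Rmin_left, Rmax_right by lra.
  - rewrite <- (opp_RInt_swap f b a) by now apply ex_RInt_continuity.
    change (opp (RInt f b a)) with (- RInt f b a).
    rewrite Rabs_Ropp, Rabs_minus_sym. apply H; [lra|]. intros x Hx.
    apply HK. now rewrite Rmin_right, Rmax_left by lra.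
Qed.

Lemma RInt_ChaslesR (f : R -> R) a b c : ex_RInt f a b -> ex_RInt f b c ->
  RInt f a b + RInt f b c = RInt f a c.
Proof. exact (RInt_Chasles (V := R_CompleteNormedModule) f a b c). Qed.

(** Moving the end point costs at most [K |y - x|], with [K] a local bound of [f]. Moving the
    parameter costs the modulus of uniform continuity times [|x|]. Each is kept within [eps / 2]. *)
Lemma continuity2_RInt f : continuity2 f -> continuity2 (fun x t => RInt (fun y => f y t) 0 x).
Proof.
  intros Hf x t eps He.
  destruct (rectangle_bound f (x-1) (x+1) (t-1) (t+1) Hf) as [K [HK0 HK]].
  assert (Hu : forall u y, - (Rabs x + 1) <= u <= Rabs x + 1 -> t - 1 <= y <= t + 1 -> continuity_2d_pt f u y)
    by (intros; now apply continuity2_iff).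
  set (X := Rabs x + 1). assert (HX : 1 <= X) by (unfold X; pose proof (Rabs_pos x); lra).
  assert (Heps : 0 < eps / (2 * X)) by (apply Rdiv_lt_0_compat; lra).
  destruct (uniform_continuity_2d f _ _ _ _ Hu (mkposreal _ Heps)) as [[d Hd] Hunif].
  simpl in Hunif.
  assert (Hd2 : 0 < eps / (4 * (K + 1))) by (apply Rdiv_lt_0_compat; lra).
  exists (Rmin (Rmin d (eps / (4 * (K+1)))) 1). split.
  { repeat apply Rmin_pos; lra. }
  intros y s Hy Hs.
  pose proof (Rmin_l (Rmin d (eps / (4 * (K+1)))) 1).
  pose proof (Rmin_r (Rmin d (eps / (4 * (K+1)))) 1).
  pose proof (Rmin_l d (eps / (4 * (K+1)))).
  pose proof (Rmin_r d (eps / (4 * (K+1)))).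
  assert (Hc : forall s, continuity (fun y => f y s)) by (intros; now apply continuity2_1).
  assert (Hys : Rabs (y - x) < 1) by lra. assert (Hss : Rabs (s - t) < 1) by lra.
  apply Rabs_def2 in Hys. apply Rabs_def2 in Hss.
  rewrite <- (RInt_ChaslesR (fun y => f y s) 0 x y) by now apply ex_RInt_continuity.
  assert (E1 : Rabs (RInt (fun y0 => f y0 s) x y) <= K * Rabs (y - x)).
  { apply RInt_abs_bound; [apply Hc|]. intros z Hz. apply HK; [|lra].
    unfold Rmin, Rmax in Hz; destruct Rle_dec; lra. }
  assert (E2 : Rabs (RInt (fun y0 => f y0 s) 0 x - RInt (fun y0 => f y0 t) 0 x) <= eps / (2 * X) * Rabs (x - 0)).
  { rewrite <- (RInt_minus (V := R_CompleteNormedModule) (fun y0 => f y0 s) (fun y0 => f y0 t)) by now apply ex_RInt_continuity.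
    apply RInt_abs_bound.
    - apply continuity_minus; apply Hc.
    - intros z Hz.
      assert (HzX : - (Rabs x + 1) <= z <= Rabs x + 1).
      { pose proof (Rle_abs x). pose proof (Rle_abs (- x)). rewrite Rabs_Ropp in *.
        unfold Rmin, Rmax in Hz; destruct Rle_dec; lra. }
      left. apply Hunif; try assumption; try lra.
      + rewrite Rminus_diag, Rabs_R0. exact Hd. }
  rewrite Rminus_0_r in E2.
  assert (E3 : eps / (2 * X) * Rabs x <= eps / 2).
  { replace (eps / 2) with (eps / (2 * X) * X) by (field; lra).
    apply Rmult_le_compat_l; [lra|]. unfold X; lra. }
  assert (E4 : K * Rabs (y - x) < eps / 2).
  { assert (eps / 4 = eps / (4 * (K+1)) * (K+1)) by (field; lra).
    assert (K * Rabs (y - x) <= (K + 1) * (eps / (4 * (K+1)))).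
    { apply Rmult_le_compat; try lra. apply Rabs_pos. }
    lra. }
  replace (RInt (fun y0 => f y0 s) 0 x + RInt (fun y0 => f y0 s) x y - RInt (fun y0 => f y0 t) 0 x)
    with ((RInt (fun y0 => f y0 s) 0 x - RInt (fun y0 => f y0 t) 0 x) + RInt (fun y0 => f y0 s) x y) by ring.
  eapply Rle_lt_trans; [apply Rabs_triang|]. lra.
Qed.

Lemma derivable_pt_lim_RInt_param (f ft : R -> R -> R) a b t :
  continuity2 f -> continuity2 ft -> pdt f ft ->
  derivable_pt_lim (fun s => RInt (fun y => f y s) a b) t (RInt (fun y => ft y t) a b).
Proof.
  intros Hf Hft Hd.
  assert (HD : forall y s, Derive (fun z => f y z) s = ft y s)
    by (intros; apply is_derive_unique, is_derive_Reals, Hd).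
  replace (RInt (fun y => ft y t) a b) with (RInt (fun y => Derive (fun u => f y u) t) a b)
    by (apply RInt_ext; intros; apply HD).
  apply is_derive_Reals, (is_derive_RInt_param (fun s y => f y s)).
  - apply filter_forall. intros s y _. exists (ft y s). apply is_derive_Reals, Hd.
  - intros y _. apply (continuity_2d_pt_ext (fun u v => ft v u)).
    + intros; symmetry; apply HD.
    + intros [e He]. destruct (Hft y t e He) as [d [Hd1 H]]. exists (mkposreal d Hd1).
      intros u v Hu Hv. now apply H.
  - apply filter_forall. intros s. apply ex_RInt_continuity. now apply continuity2_1.
Qed.

Lemma Ck2_RInt n : forall f, Ck2 n f -> Ck2 n (fun x t => RInt (fun y => f y t) 0 x).
Proof.
  induction n as [|n IH]; intros f Cf; assert (Cf0 := Cf); destruct Cf0 as [Hf Hf'];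
    (split; [now apply continuity2_RInt|]).
  - exact I.
  - destruct Hf' as [fx [ft [A [B [C D]]]]].
    exists f, (fun x t => RInt (fun y => ft y t) 0 x). repeat split.
    + intros x t. apply (derivable_pt_lim_RInt (fun y => f y t)). now apply continuity2_1.
    + intros x t. apply (derivable_pt_lim_RInt_param f ft); auto.
      eapply Ck2_continuity; eassumption.
    + now apply Ck2_pred.
    + now apply IH.
Qed.

Lemma RInt_plusR f g a b : ex_RInt f a b -> ex_RInt g a b ->
  RInt (fun x => f x + g x) a b = RInt f a b + RInt g a b.
Proof. intros Hf Hg. exact (RInt_plus (V := R_CompleteNormedModule) f g a b Hf Hg). Qed.

Lemma RInt_minusR f g a b : ex_RInt f a b -> ex_RInt g a b ->
  RInt (fun x => f x - g x) a b = RInt f a b - RInt g a b.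
Proof. intros Hf Hg. exact (RInt_minus (V := R_CompleteNormedModule) f g a b Hf Hg). Qed.

Lemma RInt_ext_01 (f g : R -> R) : (forall x, 0 <= x <= 1 -> f x = g x) -> RInt f 0 1 = RInt g 0 1.
Proof.
  intros H. apply RInt_ext. rewrite Rmin_left, Rmax_right by lra. intros x Hx. apply H. lra.
Qed.

Lemma RInt_pointR (f : R -> R) a : RInt f a a = 0.
Proof. exact (RInt_point (V := R_CompleteNormedModule) a f). Qed.

Lemma RInt_scalR k f a b : ex_RInt f a b -> RInt (fun x => k * f x) a b = k * RInt f a b.
Proof. intros Hf. exact (RInt_scal (V := R_CompleteNormedModule) f a b k Hf). Qed.

Lemma ex_RInt_scalR k f a b : ex_RInt f a b -> ex_RInt (fun x => k * f x) a b.
Proof. intros Hf. exact (ex_RInt_scal (V := R_NormedModule) f a b k Hf). Qed.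

Lemma ex_RInt_constR k a b : ex_RInt (fun _ : R => k : R) a b.
Proof. apply (ex_RInt_const (V := R_NormedModule)). Qed.

Lemma RInt_constR k a b : RInt (fun _ => k) a b = (b - a) * k.
Proof. exact (RInt_const (V := R_CompleteNormedModule) a b k). Qed.

Lemma mvt f df a b : (forall x, derivable_pt_lim f x (df x)) ->
  exists c, Rmin a b <= c <= Rmax a b /\ f b - f a = df c * (b - a).
Proof.
  intros H. apply MVT_gen.
  - intros x _. apply is_derive_Reals, H.
  - intros x _. apply derivable_continuous_pt. exists (df x). apply H.
Qed.

Lemma mvt_near f df a b : (forall x, derivable_pt_lim f x (df x)) ->
  exists c, Rabs (c - a) <= Rabs (b - a) /\ f b - f a = df c * (b - a).
Proof.
  intros H. destruct (mvt f df a b H) as [c [Hc E]]. exists c. split; [|exact E].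
  unfold Rmin, Rmax in Hc; destruct Rle_dec.
  - rewrite !Rabs_pos_eq; lra.
  - rewrite !Rabs_left1; lra.
Qed.

Lemma strictly_increasing_of_deriv f df : (forall x, derivable_pt_lim f x (df x)) ->
  (forall x, 0 < df x) -> forall x y, x < y -> f x < f y.
Proof.
  intros H Hp x y Hxy. destruct (mvt f df x y H) as [c [_ E]]. specialize (Hp c). nra.
Qed.

Lemma surjective_of_unbounded g : continuity g ->
  (forall M, exists x, M <= g x) -> (forall M, exists x, g x <= M) ->
  forall y, exists x, g x = y.
Proof.
  intros Hc Hu Hl y. destruct (Hu y) as [b Hb], (Hl y) as [a Ha].
  destruct (IVT_gen g a b y Hc) as [x [_ Hx]].
  - split; [eapply Rle_trans; [apply Rmin_l|lra]|eapply Rle_trans; [|apply Rmax_r]; lra].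
  - now exists x.
Qed.

(** * Inverse functions depending on a parameter *)

(** Bracketing: [G (A - eps) < x < G (A + eps)] by monotonicity, these strict inequalities persist
    for nearby [(y, s)], and monotonicity then traps [A y s] between the two ends. *)
Lemma inverse_continuity2 G J A : continuity2 G -> pdx G J -> (forall x t, 0 < J x t) ->
  (forall x t, G (A x t) t = x) -> continuity2 A.
Proof.
  intros HG HJ Hp HA x t eps He.
  assert (Hinc : forall s a b, a < b -> G a s < G b s)
    by (intros s; apply (strictly_increasing_of_deriv (fun y => G y s) (fun y => J y s)); intros; auto).
  assert (H1 : G (A x t - eps) t < x) by (rewrite <- (HA x t) at 2; apply Hinc; lra).
  assert (H2 : x < G (A x t + eps) t) by (rewrite <- (HA x t) at 1; apply Hinc; lra).
  destruct (HG (A x t - eps) t ((x - G (A x t - eps) t)/2)) as [d1 [Hd1 K1]]; [lra|].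
  destruct (HG (A x t + eps) t ((G (A x t + eps) t - x)/2)) as [d2 [Hd2 K2]]; [lra|].
  remember ((x - G (A x t - eps) t) / 2) as m1 eqn:Em1.
  remember ((G (A x t + eps) t - x) / 2) as m2 eqn:Em2.
  exists (Rmin (Rmin d1 d2) (Rmin m1 m2)). split; [repeat apply Rmin_pos; lra|].
  intros y s Hy Hs.
  pose proof (Rmin_l (Rmin d1 d2) (Rmin m1 m2)). pose proof (Rmin_r (Rmin d1 d2) (Rmin m1 m2)).
  pose proof (Rmin_l d1 d2). pose proof (Rmin_r d1 d2).
  pose proof (Rmin_l m1 m2). pose proof (Rmin_r m1 m2).
  specialize (K1 (A x t - eps) s). specialize (K2 (A x t + eps) s).
  rewrite Rminus_diag, Rabs_R0 in K1, K2.
  assert (L1 : Rabs (G (A x t - eps) s - G (A x t - eps) t) < m1) by (apply K1; lra).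
  assert (L2 : Rabs (G (A x t + eps) s - G (A x t + eps) t) < m2) by (apply K2; lra).
  assert (Hy1 : Rabs (y - x) < m1) by lra. assert (Hy2 : Rabs (y - x) < m2) by lra.
  apply Rabs_def2 in L1, L2, Hy1, Hy2. subst m1 m2.
  apply Rabs_def1.
  - apply Rnot_le_lt. intros C.
    destruct (Req_dec (A y s) (A x t + eps)) as [E|E].
    + assert (G (A x t + eps) s = y) by (rewrite <- E; apply HA). lra.
    + assert (G (A x t + eps) s < G (A y s) s) by (apply Hinc; lra). rewrite HA in *. lra.
  - apply Rnot_le_lt. intros C.
    destruct (Req_dec (A y s) (A x t - eps)) as [E|E].
    + assert (G (A x t - eps) s = y) by (rewrite <- E; apply HA). lra.
    + assert (G (A y s) s < G (A x t - eps) s) by (apply Hinc; lra). rewrite HA in *. lra.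
Qed.

Lemma continuity2_inv f : continuity2 f -> (forall x t, f x t <> 0) -> continuity2 (fun x t => / f x t).
Proof.
  intros Hf Hn. apply (Ck2_inv 0); [exact Hn|]. split; [exact Hf|exact I].
Qed.

(** By the mean value theorem for [G], the difference quotient of [A] is exactly [/ J] at a point
    between the two values of [A]; continuity of [A] brings that point to [A x t]. *)
Lemma inverse_pdx G J A : continuity2 J -> pdx G J -> (forall x t, 0 < J x t) ->
  (forall x t, G (A x t) t = x) -> continuity2 A -> pdx A (fun x t => / J (A x t) t).
Proof.
  intros HJc HJ Hp HA Ac x t eps He.
  assert (Hi : continuity2 (fun x t => / J x t))
    by (apply continuity2_inv; [exact HJc|intros; apply Rgt_not_eq, Hp]).
  destruct (Hi (A x t) t eps He) as [d [Hd K]].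
  destruct (Ac x t d Hd) as [d2 [Hd2 K2]].
  exists (mkposreal d2 Hd2). simpl. intros h Hh0 Hh.
  assert (Hdist : Rabs (A (x + h) t - A x t) < d).
  { apply K2; [now replace (x + h - x) with h by ring|now rewrite Rminus_diag, Rabs_R0]. }
  destruct (mvt_near (fun y => G y t) (fun y => J y t) (A x t) (A (x + h) t)) as [c [Hc E]].
  { intros; apply HJ. }
  rewrite !HA in E. replace (x + h - x) with h in E by ring.
  assert (HJp := Hp c t).
  replace ((A (x + h) t - A x t) / h) with (/ J c t).
  - apply K; [lra|now rewrite Rminus_diag, Rabs_R0].
  - assert (A (x+h) t - A x t <> 0) by (intros C; rewrite C in E; lra).
    rewrite E at 2. field. split; [assumption|lra].
Qed.

(** Both [G (A x (t + h)) (t + h)] and [G (A x t) t] equal [x]. Hence the increment of [A] times [J]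
    at an intermediate point is minus the time increment of [G] at the fixed label [A x t]. *)
Lemma inverse_pdt G J Gt A : continuity2 J -> pdx G J -> pdt G Gt -> (forall x t, 0 < J x t) ->
  (forall x t, G (A x t) t = x) -> continuity2 A ->
  pdt A (fun x t => - Gt (A x t) t * / J (A x t) t).
Proof.
  intros HJc HJ HGt Hp HA Ac x t eps He.
  assert (Hi : continuity2 (fun x t => / J x t))
    by (apply continuity2_inv; [exact HJc|intros; apply Rgt_not_eq, Hp]).
  assert (Hm : continuity2 (fun p q => - p * q)).
  { apply (Ck2_continuity 0), Ck2_mult; [apply Ck2_opp, Ck2_fst|apply Ck2_snd]. }
  destruct (Hm (Gt (A x t) t) (/ J (A x t) t) eps He) as [e [He1 Km]].
  destruct (HGt (A x t) t e He1) as [[d0 Hd0] K0]. simpl in K0.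
  destruct (Hi (A x t) t e He1) as [d [Hd K]].
  destruct (Ac x t d Hd) as [d2 [Hd2 K2]].
  assert (Hd' : 0 < Rmin d0 (Rmin d d2)) by (repeat apply Rmin_pos; lra).
  exists (mkposreal _ Hd'). simpl. intros h Hh0 Hh.
  pose proof (Rmin_l d0 (Rmin d d2)). pose proof (Rmin_r d0 (Rmin d d2)).
  pose proof (Rmin_l d d2). pose proof (Rmin_r d d2).
  assert (Ht : Rabs (t + h - t) = Rabs h) by (f_equal; ring).
  assert (Hdist : Rabs (A x (t + h) - A x t) < d).
  { apply K2; [now rewrite Rminus_diag, Rabs_R0|rewrite Ht; lra]. }
  destruct (mvt_near (fun y => G y (t + h)) (fun y => J y (t + h)) (A x t) (A x (t + h))) as [c [Hc E]].
  { intros; apply HJ. }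
  assert (HJp := Hp c (t + h)).
  replace ((A x (t + h) - A x t) / h) with (- ((G (A x t) (t + h) - G (A x t) t) / h) * / J c (t + h)).
  - apply Km; [apply K0; [exact Hh0|lra]|]. apply K; [lra|rewrite Ht; lra].
  - simpl in E. rewrite HA in *. rewrite <- (Rdiv_1_r (_ - A x t)).
    field_simplify_eq; [lra|lra].
Qed.

(** Bootstrapping: both partial derivatives of [A] are smooth expressions in [A] itself, so each
    order of smoothness yields the next. *)
Lemma inverse_Ck2 n G J Gt A : (forall m, Ck2 m J) -> (forall m, Ck2 m Gt) ->
  continuity2 G -> pdx G J -> pdt G Gt -> (forall x t, 0 < J x t) ->
  (forall x t, G (A x t) t = x) -> Ck2 n A.
Proof.
  intros CJ CGt Gc HJ HGt Hp HA.
  assert (Ac := inverse_continuity2 G J A Gc HJ Hp HA).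
  assert (HJc := Ck2_continuity 0 _ (CJ 0%nat)).
  assert (Hn : forall x t, J x t <> 0) by (intros; apply Rgt_not_eq, Hp).
  induction n as [|n IH]; (split; [exact Ac|]); [exact I|].
  exists (fun x t => / J (A x t) t), (fun x t => - Gt (A x t) t * / J (A x t) t).
  assert (CJA : Ck2 n (fun x t => J (A x t) t)) by (apply (Ck2_comp n J A (fun _ t => t)); auto; apply Ck2_snd).
  repeat split.
  - now apply (inverse_pdx G).
  - now apply (inverse_pdt G).
  - apply Ck2_inv; auto.
  - apply Ck2_mult; [apply Ck2_opp|apply Ck2_inv; auto].
    apply (Ck2_comp n Gt A (fun _ t => t)); auto; apply Ck2_snd.
Qed.

(** * A flat function *)

(** The powers of [/ z] are carried along because differentiating [exp (- / z)] produces them;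
    linear combinations of this family are closed under differentiation. *)
Definition flat (n : nat) (z : R) : R := if Rlt_dec 0 z then exp (- / z) * (/ z) ^ n else 0.

Lemma exp_le x y : x <= y -> exp x <= exp y.
Proof. intros [H| ->]; [left; now apply exp_increasing|lra]. Qed.

Lemma exp_neg_le_1 s : 0 <= s -> exp (- s) <= 1.
Proof. intros Hs. rewrite <- exp_0. apply exp_le. lra. Qed.

Lemma exp_INR_mult n x : exp (INR n * x) = exp x ^ n.
Proof.
  induction n as [|n IH].
  - simpl. now rewrite Rmult_0_l, exp_0.
  - rewrite S_INR, Rmult_plus_distr_r, Rmult_1_l, exp_plus, IH. simpl. ring.
Qed.

(** From [y / m <= exp (y / m)] with [m = n + 1], raised to the power [m]. *)
Lemma pow_le_exp n y : 0 <= y -> y ^ (S n) <= INR (S n) ^ (S n) * exp y.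
Proof.
  intros Hy. assert (Hn : 0 < INR (S n)) by (apply lt_0_INR; lia).
  replace (exp y) with (exp (y / INR (S n)) ^ (S n))
    by (rewrite <- exp_INR_mult; f_equal; field; lra).
  rewrite <- Rpow_mult_distr. apply pow_incr. split; [exact Hy|].
  pose proof (exp_ineq1_le (y / INR (S n))).
  replace y with (INR (S n) * (y / INR (S n))) at 1 by (field; lra).
  apply Rmult_le_compat_l; lra.
Qed.

Lemma flat_nonneg n z : 0 <= flat n z.
Proof.
  unfold flat. destruct Rlt_dec; [|lra]. apply Rmult_le_pos; [left; apply exp_pos|].
  apply pow_le. left. now apply Rinv_0_lt_compat.
Qed.

Lemma flat_eq0 n z : z <= 0 -> flat n z = 0.
Proof. intros. unfold flat. destruct Rlt_dec; lra. Qed.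

(** The square makes the difference quotient at the origin vanish in the limit. It comes from
    [pow_le_exp] at [/ z] with exponent [n + 2]. *)
Lemma flat_bound n : exists K, 0 < K /\ forall z, flat n z <= K * z ^ 2.
Proof.
  exists (INR (S (S n)) ^ (S (S n))).
  assert (HK : 0 < INR (S (S n)) ^ (S (S n))) by (apply pow_lt, lt_0_INR; lia).
  split; [exact HK|]. intros z. unfold flat. destruct (Rlt_dec 0 z) as [Hz|Hz].
  - assert (Hi : 0 < / z) by now apply Rinv_0_lt_compat.
    pose proof (pow_le_exp (S n) (/ z) (Rlt_le _ _ Hi)) as H.
    assert (He := exp_pos (- / z)).
    assert (E : exp (- / z) * exp (/ z) = 1) by (rewrite <- exp_plus, Rplus_opp_l; apply exp_0).
    assert (Hz2 : 0 < z ^ 2) by nra.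
    apply (Rmult_le_compat_l (exp (- / z) * z ^ 2)) in H; [|nra].
    replace ((/ z) ^ S (S n)) with ((/ z) ^ n * / (z ^ 2)) in H by (simpl; field; lra).
    replace (exp (- / z) * z ^ 2 * ((/ z) ^ n * / z ^ 2)) with (exp (- / z) * (/ z) ^ n) in H
      by (field; lra).
    replace (exp (- / z) * z ^ 2 * (INR (S (S n)) ^ S (S n) * exp (/ z))) with
      (INR (S (S n)) ^ S (S n) * z ^ 2 * (exp (- / z) * exp (/ z))) in H by ring.
    rewrite E in H. lra.
  - apply Rmult_le_pos; [lra|apply pow2_ge_0].
Qed.

Lemma flat_deriv n z : derivable_pt_lim (flat n) z (flat (S (S n)) z - INR n * flat (S n) z).
Proof.
  destruct (Rtotal_order z 0) as [Hz|[Hz|Hz]].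
  - rewrite !flat_eq0, Rmult_0_r, Rminus_0_r by lra. apply is_derive_Reals.
    apply (is_derive_ext_loc (fun _ => 0)); [|apply (is_derive_const (V := R_NormedModule))].
    assert (Hp : 0 < - z) by lra. exists (mkposreal _ Hp). intros y Hy.
    symmetry; apply flat_eq0. change (Rabs (y - z) < - z) in Hy. apply Rabs_def2 in Hy. lra.
  - subst z. rewrite !flat_eq0, Rmult_0_r, Rminus_0_r by lra.
    intros eps He. destruct (flat_bound n) as [K [HK Hb]].
    assert (Hd : 0 < eps / K) by now apply Rdiv_lt_0_compat.
    exists (mkposreal _ Hd). simpl. intros h Hh0 Hh.
    rewrite (flat_eq0 n 0), Rplus_0_l, !Rminus_0_r by lra.
    rewrite Rabs_div by exact Hh0. rewrite (Rabs_pos_eq (flat n h)) by apply flat_nonneg.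
    assert (Ha : 0 < Rabs h) by now apply Rabs_pos_lt.
    apply Rmult_lt_reg_r with (Rabs h); [exact Ha|].
    replace (flat n h / Rabs h * Rabs h) with (flat n h) by (field; lra).
    specialize (Hb h). rewrite <- (pow2_abs h) in Hb.
    assert (K * Rabs h < eps).
    { replace eps with (K * (eps / K)) by (field; lra). now apply Rmult_lt_compat_l. }
    nra.
  - apply is_derive_Reals.
    apply (is_derive_ext_loc (fun y => exp (- / y) * (/ y) ^ n)).
    + exists (mkposreal _ Hz). intros y Hy. change (Rabs (y - z) < z) in Hy. apply Rabs_def2 in Hy.
      unfold flat. destruct Rlt_dec; [reflexivity|lra].
    + unfold flat. destruct (Rlt_dec 0 z); [|lra].
      auto_derive; [lra|]. destruct n as [|n]; simpl; field; lra.
Qed.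

Lemma flat_Ck2 m : forall n, Ck2 m (fun x _ => flat n x).
Proof.
  induction m as [|m IH]; intros n;
    (split; [apply continuity2_iff; intros; apply continuity_1d_2d_pt_comp;
       [apply derivable_continuous_pt; eexists; apply flat_deriv|apply continuity_2d_pt_id1]|]).
  - exact I.
  - exists (fun x _ => flat (S (S n)) x - INR n * flat (S n) x), (fun _ _ => 0). repeat split.
    + intros x t; apply flat_deriv.
    + intros x t; apply derivable_pt_lim_const.
    + apply Ck2_minus; [apply IH|].
      apply Ck2_mult; [apply Ck2_const|apply IH].
    + apply Ck2_const.
Qed.

(** * Partial derivatives of smooth functions and the nonlocal term *)

Lemma smooth2_continuity f : smooth2 f -> continuity2 f.
Proof. intros H. exact (Ck2_continuity 0 f (H 0%nat)). Qed.

Lemma pdx_unique f fx gx : pdx f fx -> pdx f gx -> fx = gx.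
Proof.
  intros H K. extensionality x; extensionality t.
  exact (uniqueness_limite _ _ _ _ (H x t) (K x t)).
Qed.

Lemma pdt_unique f ft gt : pdt f ft -> pdt f gt -> ft = gt.
Proof.
  intros H K. extensionality x; extensionality t.
  exact (uniqueness_limite _ _ _ _ (H x t) (K x t)).
Qed.

Lemma smooth2_pdx f fx : smooth2 f -> pdx f fx -> smooth2 fx.
Proof.
  intros H K n. destruct (H (S n)) as [_ [gx [gt [Hx [Ht [Cx Ct]]]]]].
  now rewrite (pdx_unique f fx gx).
Qed.

Lemma smooth2_pdt f ft : smooth2 f -> pdt f ft -> smooth2 ft.
Proof.
  intros H K n. destruct (H (S n)) as [_ [gx [gt [Hx [Ht [Cx Ct]]]]]].
  now rewrite (pdt_unique f ft gt).
Qed.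

Lemma smooth2_ex_pdx f : smooth2 f -> exists fx, pdx f fx /\ smooth2 fx.
Proof.
  intros H. destruct (H 1%nat) as [_ [fx [ft [Hx [Ht [Cx Ct]]]]]].
  exists fx. split; [exact Hx|]. now apply smooth2_pdx with f.
Qed.

Lemma smooth2_ex_pdt f : smooth2 f -> exists ft, pdt f ft /\ smooth2 ft.
Proof.
  intros H. destruct (H 1%nat) as [_ [fx [ft [Hx [Ht [Cx Ct]]]]]].
  exists ft. split; [exact Ht|]. now apply smooth2_pdt with f.
Qed.

Lemma pdt_snd : pdt (fun _ t => t) (fun _ _ => 1).
Proof. intros x t. apply derivable_pt_lim_id. Qed.

Lemma pdx_snd : pdx (fun _ t => t) (fun _ _ => 0).
Proof. intros x t. apply derivable_pt_lim_const. Qed.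

Lemma RInt_fundamental f df a b : (forall x, derivable_pt_lim f x (df x)) -> continuity df ->
  RInt df a b = f b - f a.
Proof.
  intros H Hc. apply is_RInt_unique.
  apply (is_RInt_derive (V := R_CompleteNormedModule) f df a b).
  - intros x _. apply is_derive_Reals, H.
  - intros x _. apply continuity_pt_filterlim, Hc.
Qed.

Lemma derivable_pt_lim_shift f df c x : derivable_pt_lim f (x + c) df ->
  derivable_pt_lim (fun y => f (y + c)) x df.
Proof.
  intros H. rewrite <- (Rmult_1_r df).
  apply (derivable_pt_lim_comp (fun y => y + c) f); [|exact H].
  derive_by_ring.
Qed.

Lemma deriv_periodic f df : (forall x, derivable_pt_lim f x (df x)) -> (forall x, f (x + 1) = f x) ->
  forall x, df (x + 1) = df x.
Proof.
  intros Hf Hp x. apply (uniqueness_limite f x); [|apply Hf].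
  replace f with (fun y => f (y + 1)) by (extensionality z; apply Hp).
  apply derivable_pt_lim_shift, Hf.
Qed.

Lemma derivable_pt_lim_locally_const f t K l e : 0 < e ->
  (forall s, Rabs (s - t) < e -> f s = K) -> derivable_pt_lim f t l -> l = 0.
Proof.
  intros He H Hd. apply (uniqueness_limite f t); [exact Hd|].
  apply is_derive_Reals. apply (is_derive_ext_loc (fun _ => K)).
  - exists (mkposreal e He). intros s Hs. symmetry. now apply H.
  - apply (is_derive_const (V := R_NormedModule)).
Qed.

(* Integrating the equation over [0,1]: the term [u_xt] contributes nothing because
   [u(1,t) - u(0,t) = 0], and [u u_xx] contributes [- int u_x^2]. *)
Lemma nonlocal_term u ux uxx uxt t K :
  smooth2 u -> pdx u ux -> pdx ux uxx -> pdt ux uxt -> 0 < t ->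
  (forall s, 0 < s -> u 1 s = u 0 s) -> u 1 t * ux 1 t = u 0 t * ux 0 t ->
  (forall x, 0 <= x <= 1 -> uxt x t + u x t * uxx x t - (ux x t) ^ 2 = K) ->
  K = - 2 * RInt (fun y => (ux y t) ^ 2) 0 1.
Proof.
  intros Su Hx Hxx Hxt Ht Hbc Hbc2 HK.
  assert (Sux := smooth2_pdx _ _ Su Hx). assert (Suxx := smooth2_pdx _ _ Sux Hxx).
  assert (Suxt := smooth2_pdt _ _ Sux Hxt).
  assert (Cu := continuity2_1 _ t (smooth2_continuity _ Su)).
  assert (Cux := continuity2_1 _ t (smooth2_continuity _ Sux)).
  assert (Cuxx := continuity2_1 _ t (smooth2_continuity _ Suxx)).
  assert (Cuxt := continuity2_1 _ t (smooth2_continuity _ Suxt)).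
  assert (Csq : continuity (fun y => ux y t ^ 2)).
  { intros y. apply (continuity_pt_ext (fun z => ux z t * ux z t)); [intros; ring|].
    apply continuity_pt_multR; apply Cux. }
  assert (Cp : continuity (fun y => u y t * uxx y t)).
  { intros y. apply continuity_pt_multR; [apply Cu|apply Cuxx]. }
  assert (E1 : RInt (fun y => uxt y t) 0 1 = 0).
  { apply (derivable_pt_lim_locally_const (fun s => RInt (fun y => ux y s) 0 1) t 0 _ t Ht).
    - intros s Hs. apply Rabs_def2 in Hs.
      rewrite (RInt_fundamental (fun y => u y s)); [rewrite Hbc by lra; ring|intros; apply Hx|].
      apply continuity2_1. now apply smooth2_continuity.
    - apply derivable_pt_lim_RInt_param; auto; now apply smooth2_continuity. }
  assert (E2 : RInt (fun y => ux y t ^ 2 + u y t * uxx y t) 0 1 = 0).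
  { rewrite (RInt_fundamental (fun y => u y t * ux y t)).
    - lra.
    - intros y. replace (ux y t ^ 2 + u y t * uxx y t) with (ux y t * ux y t + u y t * uxx y t) by ring.
      apply (derivable_pt_lim_mult (fun y => u y t) (fun y => ux y t)); [apply Hx|apply Hxx].
    - now apply continuity_plusR. }
  assert (E3 : RInt (fun y => uxt y t) 0 1 =
    RInt (fun y => K - (ux y t ^ 2 + u y t * uxx y t) + 2 * ux y t ^ 2) 0 1).
  { apply RInt_ext_01. intros x Hx1.
    rewrite <- (HK x) by lra. simpl. ring. }
  assert (I1 : ex_RInt (fun y => ux y t ^ 2 + u y t * uxx y t) 0 1)
    by (apply ex_RInt_continuity; now apply continuity_plusR).
  assert (I2 : ex_RInt (fun y => ux y t ^ 2) 0 1) by now apply ex_RInt_continuity.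
  assert (CK : continuity (fun y => K - (ux y t ^ 2 + u y t * uxx y t))).
  { apply continuity_minusR.
    - apply continuity_cst.
    - now apply continuity_plusR. }
  rewrite RInt_plusR,
    (RInt_minusR (fun _ => K)), RInt_scalR, RInt_constR, E1, E2 in E3; try assumption.
  - lra.
  - apply ex_RInt_constR.
  - now apply ex_RInt_continuity.
  - apply ex_RInt_scalR; exact I2.
Qed.

(** * From the reciprocal Jacobian to the solution *)

(** The set on which the equation is available: periodicity spreads it from [[0,1]] to the line,
    Dirichlet conditions do not. *)
Definition bc_domain (bc : BC) (x : R) : Prop :=
  match bc with Periodic => True | Dirichlet => 0 <= x <= 1 end.

Lemma integral01_RInt h : continuity h -> integral01 h (RInt h 0 1).
Proof.
  intros H. exists (ex_RInt_Reals_0 h 0 1 (ex_RInt_continuity h 0 1 H)).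
  symmetry. apply RInt_Reals.
Qed.

(* [w] plays the role of the reciprocal of the Jacobian of the flow
   [G(x,t) = int_0^x 1/w + u0(0) t], and the solution is [u = G_t o G^{-1}]. *)
Lemma solution_of_reciprocal_jacobian bc u0 du0 w wt wtt S :
  admissible bc u0 -> (forall x, derivable_pt_lim u0 x (du0 x)) ->
  smooth2 w -> pdt w wt -> pdt wt wtt -> (forall x t, 0 < w x t) ->
  (forall t, exists B, forall x, w x t <= B) ->
  (forall t, RInt (fun y => / w y t) 0 1 = 1) ->
  (bc = Periodic -> forall x t, w (x + 1) t = w x t) ->
  (forall x t, bc_domain bc x -> 0 < t -> wtt x t = S t * w x t) ->
  (forall x, 0 <= x <= 1 -> w x 0 = 1 /\ wt x 0 = - du0 x) ->
  exists u ux, is_global_solution bc u0 u ux.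
Proof.
  intros Hadm Hdu0 Sw Hwt Hwtt wp wB wI wper wS w0.
  assert (Swt := smooth2_pdt _ _ Sw Hwt). assert (Swtt := smooth2_pdt _ _ Swt Hwtt).
  assert (wn : forall x t, w x t <> 0) by (intros; apply Rgt_not_eq, wp).
  set (J := fun x t => / w x t).
  assert (SJ : smooth2 J) by (intros n; now apply Ck2_inv).
  assert (Jp : forall x t, 0 < J x t) by (intros; now apply Rinv_0_lt_compat).
  set (Jt := fun x t => - wt x t * (J x t * J x t)).
  assert (SJt : smooth2 Jt) by (intros n; apply Ck2_mult; [now apply Ck2_opp|now apply Ck2_mult]).
  assert (HJt : pdt J Jt).
  { intros x t. now apply derivable_pt_lim_invR. }
  set (c := u0 0).
  (* The Jacobian fixes the flow up to a translation in time. Letting the label 0 travel at the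
     constant speed [u0 0] matches the initial value, and keeps 0 at rest under Dirichlet
     conditions. *)
  set (G := fun x t => RInt (fun y => J y t) 0 x + c * t).
  set (V := fun x t => RInt (fun y => Jt y t) 0 x + c).
  assert (SG : smooth2 G).
  { intros n. apply Ck2_plus; [now apply Ck2_RInt|]. apply Ck2_mult; [apply Ck2_const|apply Ck2_snd]. }
  assert (SV : smooth2 V).
  { intros n. apply Ck2_plus; [now apply Ck2_RInt|apply Ck2_const]. }
  assert (HG : pdx G J).
  { intros x t. replace (J x t) with (J x t + 0) by ring.
    apply derivable_pt_lim_plusR.
    - apply (derivable_pt_lim_RInt (fun y => J y t)), continuity2_1, smooth2_continuity, SJ.
    - apply derivable_pt_lim_const. }
  assert (HGt : pdt G V).
  { intros x t. apply derivable_pt_lim_plusR.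
    - apply (derivable_pt_lim_RInt_param J Jt); auto; now apply smooth2_continuity.
    - derive_by_ring. }
  assert (HV : pdx V Jt).
  { intros x t. replace (Jt x t) with (Jt x t + 0) by ring.
    apply derivable_pt_lim_plusR.
    - apply (derivable_pt_lim_RInt (fun y => Jt y t)), continuity2_1, smooth2_continuity, SJt.
    - apply derivable_pt_lim_const. }
  assert (HVt : exists Vt, pdt V Vt /\ smooth2 Vt) by now apply smooth2_ex_pdt.
  destruct HVt as [Vt [HVt SVt]].
  (* The upper bound on [w] keeps [J] above [/ B], so [G] is unbounded in both directions. *)
  assert (Hsurj : forall x t, exists a, G a t = x).
  { intros x t. revert x. destruct (wB t) as [B HB].
    assert (HBp : 0 < B) by (eapply Rlt_le_trans; [apply (wp 0 t)|apply HB]).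
    assert (HJB : forall a, / B <= J a t) by (intros a; apply Rinv_le_contravar; auto).
    assert (HiB : 0 < / B) by now apply Rinv_0_lt_compat.
    apply (surjective_of_unbounded (fun a => G a t)).
    - apply continuity2_1. now apply smooth2_continuity.
    - intros M. set (a := Rmax 0 (B * (M - G 0 t))). exists a.
      destruct (mvt (fun a => G a t) (fun a => J a t) 0 a) as [z [_ Ez]]; [intros; apply HG|].
      specialize (HJB z). assert (0 <= a) by apply Rmax_l.
      assert (B * (M - G 0 t) <= a) by apply Rmax_r.
      assert (/ B * (B * (M - G 0 t)) <= / B * a) by (apply Rmult_le_compat_l; lra).
      rewrite <- Rmult_assoc, Rinv_l, Rmult_1_l in H1 by lra.
      assert (/ B * a <= J z t * a) by (apply Rmult_le_compat_r; lra). rewrite Rminus_0_r in Ez. lra.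
    - intros M. set (a := Rmin 0 (B * (M - G 0 t))). exists a.
      destruct (mvt (fun a => G a t) (fun a => J a t) 0 a) as [z [_ Ez]]; [intros; apply HG|].
      specialize (HJB z). assert (a <= 0) by apply Rmin_l.
      assert (a <= B * (M - G 0 t)) by apply Rmin_r.
      assert (/ B * a <= / B * (B * (M - G 0 t))) by (apply Rmult_le_compat_l; lra).
      rewrite <- Rmult_assoc, Rinv_l, Rmult_1_l in H1 by lra.
      assert (J z t * a <= / B * a) by nra. rewrite Rminus_0_r in Ez. lra. }
  set (A := fun x t => proj1_sig (constructive_indefinite_description _ (Hsurj x t))).
  assert (HA : forall x t, G (A x t) t = x)
    by (intros; exact (proj2_sig (constructive_indefinite_description _ (Hsurj x t)))).
  clearbody A.
  assert (Ginc : forall t a b, a < b -> G a t < G b t).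
  { intros t. apply (strictly_increasing_of_deriv (fun a => G a t) (fun a => J a t)); auto. }
  assert (Ginj : forall t a b, G a t = G b t -> a = b).
  { intros t a b E. destruct (Rtotal_order a b) as [L|[L|L]]; auto; apply (Ginc t) in L; lra. }
  assert (AG : forall x t, A (G x t) t = x) by (intros; apply (Ginj t); apply HA).
  assert (SA : smooth2 A).
  { intros n. apply (inverse_Ck2 n G J V A); auto. now apply smooth2_continuity. }
  assert (JC : continuity2 J) by now apply smooth2_continuity.
  assert (HAx : pdx A (fun x t => / J (A x t) t)) by (apply (inverse_pdx G); auto; now apply smooth2_continuity).
  assert (HAt : pdt A (fun x t => - V (A x t) t * / J (A x t) t))
    by (apply (inverse_pdt G); auto; now apply smooth2_continuity).
  (* The gradient [u_x] in Lagrangian coordinates, namely the logarithmic derivative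
     [J_t / J = - w_t / w]. *)
  set (W := fun x t => - wt x t * J x t).
  assert (SW : smooth2 W) by (intros n; apply Ck2_mult; [now apply Ck2_opp|auto]).
  destruct (smooth2_ex_pdx W SW) as [Wx [HWx SWx]].
  set (Wt := fun x t => - wtt x t * J x t + - wt x t * Jt x t).
  assert (HWt : pdt W Wt).
  { intros x t. apply (derivable_pt_lim_mult (fun t => - wt x t) (fun t => J x t)); [|apply HJt].
    apply derivable_pt_lim_oppR, Hwtt. }
  set (u := fun x t => V (A x t) t). set (ux := fun x t => W (A x t) t).
  assert (Su : smooth2 u) by (intros n; apply (Ck2_comp n V A (fun _ t => t)); auto; apply Ck2_snd).
  assert (Jinv : forall x t, / J x t = w x t) by (intros; apply Rinv_inv).
  assert (Hux : pdx u ux).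
  { intros x t. unfold ux, W.
    replace (- wt (A x t) t * J (A x t) t) with
      (Jt (A x t) t * / J (A x t) t + Vt (A x t) t * 0)
      by (rewrite Jinv; unfold Jt, J; field; auto).
    apply (pdx_comp V Jt Vt A (fun x t => / J (A x t) t) (fun _ t => t) (fun _ _ => 0)); auto using pdx_snd.
    now apply smooth2_continuity. }
  set (uxx := fun x t => Wx (A x t) t * / J (A x t) t + Wt (A x t) t * 0).
  set (uxt := fun x t => Wx (A x t) t * (- V (A x t) t * / J (A x t) t) + Wt (A x t) t * 1).
  assert (Huxx : pdx ux uxx).
  { apply (pdx_comp W Wx Wt A (fun x t => / J (A x t) t) (fun _ t => t) (fun _ _ => 0)); auto using pdx_snd.
    now apply smooth2_continuity. }
  assert (Huxt : pdt ux uxt).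
  { apply (pdt_comp W Wx Wt A _ (fun _ t => t) (fun _ _ => 1)); auto using pdt_snd.
    now apply smooth2_continuity. }
  assert (Sux := smooth2_pdx _ _ Su Hux).
  assert (G1 : forall t, G 1 t = 1 + c * t) by (intros t; unfold G; unfold J at 1; now rewrite wI).
  assert (G0 : forall t, G 0 t = c * t) by (intros t; unfold G; rewrite RInt_point; apply Rplus_0_l).
  assert (V0 : forall t, V 0 t = c) by (intros t; unfold V; rewrite RInt_point; apply Rplus_0_l).
  (* The unit integral of [/ w] gives [G 1 t = 1 + c t], so both end labels move with the same
     velocity. *)
  assert (V1 : forall t, V 1 t = c).
  { intros t. apply (uniqueness_limite (fun s => G 1 s) t); [apply HGt|].
    replace (fun s => G 1 s) with (fun s => 1 + c * s) by (extensionality s; now rewrite G1).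
    derive_by_ring. }
  assert (Hbc : match bc with Periodic => forall x t, u (x + 1) t = u x t
                | Dirichlet => forall t, u 0 t = 0 /\ u 1 t = 0 end).
  { destruct bc.
    - specialize (wper eq_refl).
      assert (Gper : forall x t, G (x + 1) t = G x t + 1).
      { intros x t.
        destruct (mvt (fun x => G (x + 1) t - G x t) (fun x => J (x + 1) t - J x t) 0 x) as [z [_ Ez]].
        - intros y. apply derivable_pt_lim_minusR; [|apply HG].
          apply (derivable_pt_lim_shift (fun x => G x t)), HG.
        - unfold J in Ez. rewrite wper in Ez. rewrite Rplus_0_l, G0, G1 in Ez. lra. }
      assert (Vper : forall x t, V (x + 1) t = V x t).
      { intros x t. apply (uniqueness_limite (fun s => G (x + 1) s) t); [apply HGt|].
        replace (fun s => G (x + 1) s) with (fun s => G x s + 1) by (extensionality s; now rewrite Gper).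
        replace (V x t) with (V x t + 0) by ring.
        apply derivable_pt_lim_plusR; [apply HGt|apply derivable_pt_lim_const]. }
      intros x t. unfold u. replace (A (x + 1) t) with (A x t + 1); [apply Vper|].
      apply (Ginj t). now rewrite Gper, !HA.
    - destruct Hadm as [_ [Hc _]]. intros t.
      assert (Hc' : c = 0) by exact Hc. rewrite Hc' in *.
      split.
      + unfold u. replace (A 0 t) with 0; [apply V0|]. apply (Ginj t). rewrite HA, G0. ring.
      + unfold u. replace (A 1 t) with 1; [apply V1|]. apply (Ginj t). rewrite HA, G1. ring. }
  assert (Adom : forall x t, 0 <= x <= 1 -> bc_domain bc (A x t)).
  { intros x t Hx. destruct bc; simpl; [exact I|].
    destruct Hadm as [_ [Hc _]]. assert (Hc' : c = 0) by exact Hc.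
    split; apply Rnot_lt_le; intros C; apply (Ginc t) in C; rewrite HA, ?G0, ?G1, Hc' in C; lra. }
  exists u, ux. split; [exact Su|]. split; [exact Hux|]. split.
  { exists uxx, uxt. split; [exact Huxx|]. split; [exact Huxt|]. intros t Ht.
    exists (RInt (fun y => ux y t ^ 2) 0 1). split.
    - apply integral01_RInt. intros y. apply (continuity_pt_ext (fun z => ux z t * ux z t)); [intros; ring|].
      apply continuity_pt_multR; apply continuity2_1, smooth2_continuity, Sux.
    (* The terms with [Wx] cancel, leaving [W_t - W^2 = - w_tt / w] at the label [A x t]. This value
       is independent of [x], so [nonlocal_term] identifies it with the integral term. *)
    - assert (Hloc : forall x, 0 <= x <= 1 -> uxt x t + u x t * uxx x t - (ux x t) ^ 2 = - S t).
      { intros x Hx. assert (E := wS (A x t) t (Adom x t Hx) Ht).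
        unfold uxt, uxx, u, ux, W, Wt. rewrite E. unfold Jt, J. field. auto. }
      intros x Hx. rewrite (Hloc x Hx).
      apply (nonlocal_term u ux uxx uxt); auto.
      + intros s Hs. destruct bc; [|destruct (Hbc s); lra].
        rewrite <- (Hbc 0 s). f_equal; ring.
      + destruct bc; [|destruct (Hbc t) as [B0 B1]; rewrite B0, B1; ring].
        assert (E1 : u 1 t = u 0 t) by (rewrite <- (Hbc 0 t); f_equal; ring). rewrite E1. f_equal.
        replace 1 with (0 + 1) by ring.
        apply (deriv_periodic (fun x => u x t) (fun x => ux x t)); [intros; apply Hux|auto]. }
  split.
  { intros x Hx.
    assert (Gx : G x 0 = x).
    { unfold G. rewrite (RInt_ext _ (fun _ => 1)).
      - rewrite RInt_constR. ring.
      - rewrite Rmin_left, Rmax_right by lra. intros y Hy. unfold J.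
        destruct (w0 y) as [E _]; [lra|]. rewrite E. apply Rinv_1. }
    unfold u. replace (A x 0) with x by (apply (Ginj 0); now rewrite HA, Gx).
    unfold V. rewrite (RInt_ext _ du0).
    - rewrite (RInt_fundamental u0 du0); [unfold c; ring|exact Hdu0|].
      assert (Sd : smooth1 du0) by (apply (smooth1_deriv u0); [apply Hadm|exact Hdu0]).
      apply (continuity2_1 (fun x _ => du0 x) 0), (Ck2_continuity 0). now apply smooth1_smooth2.
    - rewrite Rmin_left, Rmax_right by lra. intros y Hy. unfold Jt, J.
      destruct (w0 y) as [E E']; [lra|]. rewrite E, E'. simpl. field. }
  destruct bc; intros; apply Hbc.
Qed.

Lemma smooth_in_t_ex_deriv g : smooth2 (fun _ t => g t) ->
  exists dg, (forall t, derivable_pt_lim g t (dg t)) /\ smooth2 (fun _ t => dg t).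
Proof.
  intros H. destruct (smooth2_ex_pdt _ H) as [gt [Hd Hs]].
  exists (gt 0). split; [intros t; apply Hd|].
  intros n. apply Ck2_comp; [apply Hs|apply Ck2_const|apply Ck2_snd].
Qed.

Lemma admissible_endpoints bc u0 : admissible bc u0 -> u0 1 = u0 0.
Proof. intros [_ H]. destruct bc; [rewrite <- (H 0); f_equal; ring|lra]. Qed.

(** * Lower bounds for integrals of reciprocals and growth near a zero *)

Lemma ex_RInt_continuity_on f a b : a <= b -> (forall x, a <= x <= b -> continuity_pt f x) ->
  ex_RInt f a b.
Proof.
  intros Hab H. apply (ex_RInt_continuous (V := R_CompleteNormedModule)).
  rewrite Rmin_left, Rmax_right by exact Hab. intros z Hz. now apply continuity_pt_filterlim, H.
Qed.

Lemma RInt_lower_bound h a b c d m : a <= c -> c <= d -> d <= b ->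
  (forall x, a <= x <= b -> continuity_pt h x) -> (forall x, a <= x <= b -> 0 <= h x) ->
  (forall x, c <= x <= d -> m <= h x) -> (d - c) * m <= RInt h a b.
Proof.
  intros Hac Hcd Hdb Hh Hp Hm.
  assert (E : forall y z, a <= y -> y <= z -> z <= b -> ex_RInt h y z).
  { intros y z Hy Hyz Hz. apply ex_RInt_continuity_on; [exact Hyz|]. intros; apply Hh; lra. }
  rewrite <- (RInt_ChaslesR h a c b), <- (RInt_ChaslesR h c d b) by (apply E; lra).
  assert (0 <= RInt h a c) by (apply RInt_ge_0; [lra|apply E; lra|intros; apply Hp; lra]).
  assert (0 <= RInt h d b) by (apply RInt_ge_0; [lra|apply E; lra|intros; apply Hp; lra]).
  assert ((d - c) * m <= RInt h c d).
  { rewrite <- RInt_constR. apply RInt_le; [lra|apply ex_RInt_constR|apply E; lra|].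
    intros; apply Hm; lra. }
  lra.
Qed.

Lemma continuity_pt_Rinv f x : continuity_pt f x -> f x <> 0 -> continuity_pt (fun y => / f y) x.
Proof. intros H1 H2. exact (continuity_pt_inv f x H1 H2). Qed.

(* The contribution of a one-sided neighbourhood of width [r] of the degenerate point [a]. *)
Lemma RInt_inv_lower_bound D a K p e r : 0 <= a <= 1 -> 0 <= K -> 0 < r <= 1 / 2 ->
  K * r ^ p <= e -> 0 < e ->
  (forall x, 0 <= x <= 1 -> continuity_pt D x) -> (forall x, 0 <= x <= 1 -> 0 < D x) ->
  (forall x, 0 <= x <= 1 -> D x <= e + K * Rabs (x - a) ^ p) ->
  r / (2 * e) <= RInt (fun x => / D x) 0 1.
Proof.
  intros Ha HK Hr Hre He Dc Dp HD.
  assert (Hc : forall x, 0 <= x <= 1 -> continuity_pt (fun x => / D x) x).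
  { intros x Hx. apply continuity_pt_Rinv; [now apply Dc|]. apply Rgt_not_eq, Dp, Hx. }
  assert (Hp : forall x, 0 <= x <= 1 -> 0 <= / D x) by (intros; left; apply Rinv_0_lt_compat, Dp; lra).
  assert (Hm : forall x, 0 <= x <= 1 -> Rabs (x - a) <= r -> / (2 * e) <= / D x).
  { intros x Hx Hxa. apply Rinv_le_contravar; [now apply Dp|].
    eapply Rle_trans; [now apply HD|].
    assert (K * Rabs (x - a) ^ p <= K * r ^ p).
    { apply Rmult_le_compat_l; [exact HK|]. apply pow_incr. split; [apply Rabs_pos|exact Hxa]. }
    lra. }
  destruct (Rle_lt_dec a (1/2)) as [L|L].
  - replace (r / (2 * e)) with ((a + r - a) * / (2 * e)) by (field; lra).
    apply RInt_lower_bound; auto; try lra.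
    intros x Hx. apply Hm; [lra|]. rewrite Rabs_pos_eq; lra.
  - replace (r / (2 * e)) with ((a - (a - r)) * / (2 * e)) by (field; lra).
    apply RInt_lower_bound; auto; try lra.
    intros x Hx. apply Hm; [lra|]. rewrite Rabs_left1; lra.
Qed.

(** One integration of a power bound by the mean value theorem. Iterated from a bound on the highest
    derivative, it stands in for Taylor's formula, with a constant that is not sharp. *)
Lemma pow_growth h dh a n K rho : (forall x, derivable_pt_lim h x (dh x)) -> h a = 0 -> 0 <= K ->
  (forall x, Rabs (x - a) <= rho -> Rabs (dh x) <= K * Rabs (x - a) ^ n) ->
  forall x, Rabs (x - a) <= rho -> Rabs (h x) <= K * Rabs (x - a) ^ (S n).
Proof.
  intros Hd Ha HK Hb x Hx. destruct (mvt_near h dh a x Hd) as [c [Hc E]].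
  rewrite Ha, Rminus_0_r in E. rewrite E, Rabs_mult.
  replace (K * Rabs (x - a) ^ S n) with ((K * Rabs (x - a) ^ n) * Rabs (x - a)) by (simpl; ring).
  apply Rmult_le_compat_r; [apply Rabs_pos|].
  eapply Rle_trans; [apply Hb; lra|]. apply Rmult_le_compat_l; [exact HK|].
  apply pow_incr. split; [apply Rabs_pos|exact Hc].
Qed.

Lemma smooth1_continuity g : smooth1 g -> continuity g.
Proof.
  intros H. apply (continuity2_1 (fun x _ => g x) 0), (Ck2_continuity 0). now apply smooth1_smooth2.
Qed.

Lemma smooth1_bounded g a b : smooth1 g -> exists K, 0 <= K /\ forall x, a <= x <= b -> Rabs (g x) <= K.
Proof.
  intros H. destruct (rectangle_bound (fun x _ => g x) a b 0 0) as [K [HK HB]].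
  - apply (Ck2_continuity 0). now apply smooth1_smooth2.
  - exists K. split; [exact HK|]. intros x Hx. apply (HB x 0); lra.
Qed.

(** Induction on an integer bound for [|x|] plays the part of the fractional part; the
    representative is chosen before the periodic function. *)
Lemma periodic_reduction x : exists y, 0 <= y <= 1 /\
  forall h : R -> R, (forall z, h (z + 1) = h z) -> h y = h x.
Proof.
  assert (H : forall n x, - INR n <= x <= INR n + 1 -> exists y, 0 <= y <= 1 /\
    forall h : R -> R, (forall z, h (z + 1) = h z) -> h y = h x).
  { induction n as [|n IH]; intros z Hz.
    - simpl in Hz. exists z. split; [lra|auto].
    - rewrite S_INR in Hz. destruct (Rlt_le_dec z 0) as [L|L].
      + destruct (IH (z + 1)) as [y [Hy Hh]]; [pose proof (pos_INR n); lra|].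
        exists y. split; [exact Hy|]. intros h Hp. rewrite (Hh h Hp). apply Hp.
      + destruct (Rle_lt_dec z 1) as [L1|L1].
        * exists z. split; [lra|auto].
        * destruct (IH (z - 1)) as [y [Hy Hh]]; [pose proof (pos_INR n); lra|].
          exists y. split; [exact Hy|]. intros h Hp. rewrite (Hh h Hp).
          rewrite <- (Hp (z - 1)). f_equal; ring. }
  destruct (INR_unbounded (Rabs x)) as [n Hn]. apply (H n).
  pose proof (Rle_abs x). pose proof (Rle_abs (- x)). rewrite Rabs_Ropp in *. lra.
Qed.

(** * Existence of global solutions *)

(* [tau] is a global time scale along which the blow-up parameter [e tau] runs
   through [0, 1/M0); the physical time is [t = int P^2 de], and the flat term only
   serves to make the map [tau -> t] onto the whole line. *)
Lemma global_solution_of_parametrization bc u0 du0 q e de c0 :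
  admissible bc u0 -> (forall x, derivable_pt_lim u0 x (du0 x)) ->
  smooth2 q -> (forall x s, 0 < q x s) -> (forall s, exists B, forall x, q x s <= B) ->
  (bc = Periodic -> forall x s, q (x + 1) s = q x s) ->
  smooth2 (fun x _ => e x) -> (forall s, derivable_pt_lim e s (de s)) -> e 0 = 0 ->
  (forall s, 0 < de s) ->
  (forall x s, bc_domain bc x -> q x s = 1 - e s * du0 x) ->
  0 < c0 -> (forall s, 0 <= s -> c0 <= (RInt (fun y => / q y s) 0 1) ^ 2 * de s) ->
  exists u ux, is_global_solution bc u0 u ux.
Proof.
  intros Hadm Hdu0 Sq qp qB qper Se Hde e0 dep qe Hc0 HP.
  assert (Sde : smooth2 (fun x _ => de x)).
  { apply (smooth2_pdx (fun x _ => e x)); [exact Se|]. intros x t; apply Hde. }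
  assert (dom01 : forall x, 0 <= x <= 1 -> bc_domain bc x) by (intros; destruct bc; simpl; auto).
  assert (Siq : smooth2 (fun x s => / q x s)) by (intros n; apply Ck2_inv; auto; intros; apply Rgt_not_eq, qp).
  assert (Ciq : forall s, continuity (fun y => / q y s)) by (intros s; apply (continuity2_1 (fun y s => / q y s)); now apply smooth2_continuity).
  set (P := fun s : R => RInt (fun y => / q y s)  0 1 : R).
  assert (SP : smooth2 (fun x _ => P x)).
  { intros n. apply (Ck2_comp n (fun x t => RInt (fun y => / q y t) 0 x) (fun _ _ => 1) (fun x _ => x));
    [now apply Ck2_RInt|apply Ck2_const|apply Ck2_fst]. }
  assert (Pp : forall s, 0 < P s).
  { intros s. apply RInt_gt_0; [lra| |].
    - intros; apply Rinv_0_lt_compat, qp.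
    - intros x _. apply continuity_pt_filterlim, Ciq. }
  set (D := fun s => P s ^ 2 * de s + flat 0 (- s)).
  assert (SD : smooth2 (fun x _ => D x)).
  { intros n. apply Ck2_plus.
    - apply Ck2_mult; [|apply Sde].
      apply (Ck2_ext n (fun x _ => P x * P x)); [intros; ring|]. now apply Ck2_mult.
    - apply (Ck2_comp n (fun x _ => flat 0 x) (fun x _ => - x) (fun x t => t)); [apply flat_Ck2| |apply Ck2_snd].
      apply Ck2_opp, Ck2_fst. }
  assert (Dp : forall s, 0 < D s).
  { intros s. unfold D. pose proof (flat_nonneg 0 (- s)). specialize (Pp s). specialize (dep s).
    assert (0 < P s ^ 2 * de s) by (apply Rmult_lt_0_compat; [apply pow_lt|]; lra). lra. }
  assert (D0 : forall s, 0 <= s -> D s = P s ^ 2 * de s)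
    by (intros s Hs; unfold D; rewrite flat_eq0 by lra; ring).
  assert (Dc : continuity D) by exact (continuity2_1 (fun x _ => D x) 0 (smooth2_continuity _ SD)).
  set (T := fun s : R => RInt D 0 s : R).
  assert (HT : forall s, derivable_pt_lim T s (D s)) by (intros s; now apply derivable_pt_lim_RInt).
  assert (T0 : T 0 = 0) by apply RInt_pointR.
  assert (Hsurj : forall t, exists s, T s = t).
  { apply surjective_of_unbounded.
    - exact (continuity_of_deriv T D HT).
    - intros M. set (s := Rmax 0 (M / c0)). exists s.
      destruct (mvt T D 0 s HT) as [z [Hz Ez]]. assert (Hs : 0 <= s) by apply Rmax_l.
      rewrite Rmin_left in Hz by exact Hs. assert (HM : M / c0 <= s) by apply Rmax_r.
      assert (c0 <= D z) by (rewrite D0 by lra; apply HP; lra).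
      assert (M <= c0 * s).
      { replace M with (c0 * (M / c0)) by (field; lra). apply Rmult_le_compat_l; lra. }
      rewrite T0 in Ez. nra.
    (* For parameters at most [-1] the flat term is at least [exp (-1)], so [T] tends to minus
       infinity at least linearly there. *)
    - intros M. set (k := exp (-1)). assert (Hk : 0 < k) by apply exp_pos.
      set (s := Rmin 0 ((M - T (-1)) / k)). exists (-1 + s).
      destruct (mvt T D (-1) (-1 + s) HT) as [z [Hz Ez]]. assert (Hs : s <= 0) by apply Rmin_l.
      rewrite Rmax_left in Hz by lra. assert (HM : s <= (M - T (-1)) / k) by apply Rmin_r.
      assert (k <= D z).
      { unfold D. assert (0 <= P z ^ 2 * de z) by (apply Rmult_le_pos; [apply pow2_ge_0|left; apply dep]).
        assert (k <= flat 0 (- z)); [|lra].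
        unfold flat, k. destruct Rlt_dec; [|lra]. simpl. rewrite Rmult_1_r.
        assert (/ - z <= 1) by (rewrite <- Rinv_1; apply Rinv_le_contravar; lra).
        apply exp_le. lra. }
      assert (k * s <= M - T (-1)).
      { replace (M - T (-1)) with (k * ((M - T (-1)) / k)) by (field; lra). apply Rmult_le_compat_l; lra. }
      nra. }
  set (tau := fun t => proj1_sig (constructive_indefinite_description _ (Hsurj t))).
  assert (Htau : forall t, T (tau t) = t)
    by (intros; exact (proj2_sig (constructive_indefinite_description _ (Hsurj t)))).
  clearbody tau.
  assert (Tinc := strictly_increasing_of_deriv T D HT Dp).
  assert (HTx : pdx (fun x _ => T x) (fun x _ => D x)) by (intros x t; apply HT).
  assert (HTt : pdt (fun x _ => T x) (fun _ _ => 0)) by (intros x t; apply derivable_pt_lim_const).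
  assert (CT : continuity2 (fun x _ => T x)).
  { apply continuity2_iff; intros x t. apply continuity_1d_2d_pt_comp; [|apply continuity_2d_pt_id1].
    apply derivable_continuous_pt. exists (D x). apply HT. }
  assert (Stau0 : smooth2 (fun x _ => tau x)).
  { intros n. apply (inverse_Ck2 n (fun x _ => T x) (fun x _ => D x) (fun _ _ => 0) (fun x _ => tau x)); auto.
    intros; apply Ck2_const. }
  assert (Hdtau : forall t, derivable_pt_lim tau t (/ D (tau t))).
  { assert (K : pdx (fun x _ => tau x) (fun x _ => / D (tau x))).
    { apply (inverse_pdx (fun x _ => T x) (fun x _ => D x) (fun x _ => tau x)); auto; now apply smooth2_continuity. }
    intros t. exact (K t 0). }
  assert (tau0 : tau 0 = 0).
  { destruct (Rtotal_order (tau 0) 0) as [L|[L|L]]; auto; apply Tinc in L; rewrite Htau, T0 in L; lra. }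
  assert (taup : forall t, 0 <= t -> 0 <= tau t).
  { intros t Ht. apply Rnot_lt_le. intros L. apply Tinc in L. rewrite Htau, T0 in L. lra. }
  assert (Stau : smooth2 (fun _ t => tau t)).
  { intros n. apply (Ck2_comp n (fun x _ => tau x) (fun _ t => t) (fun _ t => t)); [apply Stau0|apply Ck2_snd|apply Ck2_snd]. }
  set (phi := fun t => P (tau t)). set (h := fun t => e (tau t)).
  assert (Sphi : smooth2 (fun _ t => phi t)).
  { intros n. apply (Ck2_comp n (fun x _ => P x) (fun _ t => tau t) (fun _ t => t)); auto. apply Ck2_snd. }
  assert (phip : forall t, 0 < phi t) by (intros; apply Pp).
  destruct (smooth_in_t_ex_deriv phi Sphi) as [phi1 [Hphi1 Sphi1]].
  destruct (smooth_in_t_ex_deriv phi1 Sphi1) as [phi2 [Hphi2 Sphi2]].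
  assert (Sh : smooth2 (fun _ t => h t)).
  { intros n. apply (Ck2_comp n (fun x _ => e x) (fun _ t => tau t) (fun _ t => t)); auto. apply Ck2_snd. }
  destruct (smooth_in_t_ex_deriv h Sh) as [h1 [Hh1 Sh1]].
  destruct (smooth_in_t_ex_deriv h1 Sh1) as [h2 [Hh2 Sh2]].
  assert (Eh1 : forall t, 0 <= t -> h1 t * (phi t * phi t) = 1).
  { intros t Ht.
    replace (h1 t) with (de (tau t) * / D (tau t)).
    - rewrite D0 by auto. unfold phi. specialize (dep (tau t)). specialize (Pp (tau t)). field. lra.
    - apply (uniqueness_limite h t); [|apply Hh1]. apply (derivable_pt_lim_comp tau e); auto. }
  (* The derivative of [h1 phi^2 = 1]. It makes [phi] and [phi h] solve the same linear equation,
     with coefficient [phi2 / phi]. *)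
  assert (Eh2 : forall t, 0 < t -> phi t * h2 t + 2 * phi1 t * h1 t = 0).
  { intros t Ht.
    assert (E : h2 t * (phi t * phi t) + h1 t * (phi1 t * phi t + phi t * phi1 t) = 0).
    { apply (derivable_pt_lim_locally_const (fun t => h1 t * (phi t * phi t)) t 1 _ t Ht).
      - intros s Hs. apply Rabs_def2 in Hs. apply Eh1; lra.
      - apply (derivable_pt_lim_mult h1 (fun t => phi t * phi t)); auto.
        now apply derivable_pt_lim_multR. }
    specialize (phip t). apply Rmult_eq_reg_r with (phi t); [|lra]. rewrite Rmult_0_l, <- E. ring. }
  set (w := fun x t => phi t * q x (tau t)).
  assert (Sw : smooth2 w).
  { intros n. apply Ck2_mult; auto.
    apply Ck2_comp; auto. apply Ck2_fst. }
  destruct (smooth2_ex_pdt w Sw) as [wt [Hwt Swt]].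
  destruct (smooth2_ex_pdt wt Swt) as [wtt [Hwtt Swtt]].
  assert (wp : forall x t, 0 < w x t) by (intros; now apply Rmult_lt_0_compat).
  assert (Ew : forall x t, bc_domain bc x -> w x t = phi t * (1 - h t * du0 x))
    by (intros; unfold w; now rewrite qe).
  assert (Ewt : forall x t, bc_domain bc x ->
     wt x t = phi1 t * (1 - h t * du0 x) + phi t * (0 - h1 t * du0 x)).
  { intros x t Hx. apply (uniqueness_limite (w x) t); [apply Hwt|].
    replace (w x) with (fun t => phi t * (1 - h t * du0 x)) by (extensionality s; now rewrite Ew).
    apply (derivable_pt_lim_mult phi (fun t => 1 - h t * du0 x)); auto.
    apply derivable_pt_lim_minusR; [apply derivable_pt_lim_const|].
    apply is_derive_Reals. specialize (Hh1 t). apply is_derive_Reals in Hh1.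
    apply (is_derive_scal_l (V := R_NormedModule) h t (h1 t) (du0 x) Hh1). }
  assert (Ewtt : forall x t, bc_domain bc x ->
     wtt x t = (phi2 t * (1 - h t * du0 x) + phi1 t * (0 - h1 t * du0 x)) +
               (phi1 t * (0 - h1 t * du0 x) + phi t * (0 - h2 t * du0 x))).
  { intros x t Hx. apply (uniqueness_limite (wt x) t); [apply Hwtt|].
    replace (wt x) with (fun t => phi1 t * (1 - h t * du0 x) + phi t * (0 - h1 t * du0 x))
      by (extensionality s; now rewrite Ewt).
    assert (Hs : forall g dg, derivable_pt_lim g t dg ->
      forall k, derivable_pt_lim (fun t => k - g t * du0 x) t (0 - dg * du0 x)).
    { intros g dg Hg k.
      apply derivable_pt_lim_minusR; [apply derivable_pt_lim_const|].
      apply is_derive_Reals in Hg. apply is_derive_Reals.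
      apply (is_derive_scal_l (V := R_NormedModule) g t dg (du0 x) Hg). }
    apply derivable_pt_lim_plusR.
    - apply (derivable_pt_lim_mult phi1 (fun t => 1 - h t * du0 x)); auto.
    - apply (derivable_pt_lim_mult phi (fun t => 0 - h1 t * du0 x)); auto. }
  assert (wI : forall t, RInt (fun y => / w y t) 0 1 = 1).
  { intros t. rewrite (RInt_ext _ (fun y => / phi t * / q y (tau t))).
    - rewrite RInt_scalR by now apply ex_RInt_continuity.
      change (/ phi t * phi t = 1). specialize (phip t). field. lra.
    - intros x _. unfold w. rewrite Rinv_mult. reflexivity. }
  assert (phi0 : phi 0 = 1).
  { unfold phi, P. rewrite tau0, (RInt_ext_01 _ (fun _ => 1)).
    - rewrite RInt_constR. ring.
    - intros x Hx. rewrite qe by (apply dom01; lra).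
      rewrite e0. simpl. field. }
  assert (h0 : h 0 = 0) by (unfold h; now rewrite tau0).
  assert (h10 : h1 0 = 1) by (rewrite <- (Eh1 0), phi0 by lra; ring).
  assert (Sdu0 : smooth1 du0) by (apply (smooth1_deriv u0); [apply Hadm|exact Hdu0]).
  assert (u01 := admissible_endpoints bc u0 Hadm).
  (* Differentiating the unit integral of [/ w] at time 0 gives [int u0' - phi1 0 = 0], and [u0']
     has mean zero because [u0 1 = u0 0]. *)
  assert (phi10 : phi1 0 = 0).
  { assert (wn : forall x t, w x t <> 0) by (intros; apply Rgt_not_eq, wp).
    set (g := fun x t => - wt x t * (/ w x t * / w x t)).
    assert (Sg : smooth2 g).
    { intros n. apply Ck2_mult; [now apply Ck2_opp|]. apply Ck2_mult; now apply Ck2_inv. }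
    assert (E : RInt (fun y => g y 0) 0 1 = 0).
    { apply (derivable_pt_lim_locally_const (fun t => RInt (fun y => / w y t) 0 1) 0 1 _ 1 Rlt_0_1).
      - intros; apply wI.
      - apply derivable_pt_lim_RInt_param.
        + apply smooth2_continuity. intros n. now apply Ck2_inv.
        + now apply smooth2_continuity.
        + intros x t. now apply derivable_pt_lim_invR. }
    rewrite (RInt_ext_01 _ (fun y => du0 y - phi1 0)) in E.
    - rewrite RInt_minusR, RInt_constR in E.
      + rewrite (RInt_fundamental u0 du0) in E; [lra|exact Hdu0|now apply smooth1_continuity].
      + now apply ex_RInt_continuity, smooth1_continuity.
      + apply ex_RInt_constR.
    - intros x Hx. assert (Hd := dom01 x ltac:(lra)).
      unfold g. rewrite Ew, Ewt, phi0, h0, h10 by exact Hd. simpl. field. }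
  apply (solution_of_reciprocal_jacobian bc u0 du0 w wt wtt (fun t => phi2 t / phi t)); auto.
  - intros t. destruct (qB (tau t)) as [B HB]. exists (phi t * B). intros x.
    apply Rmult_le_compat_l; [left; apply phip|apply HB].
  - intros Hb x t. unfold w. now rewrite qper.
  - intros x t Hx Ht. rewrite Ew, Ewtt by exact Hx. specialize (Eh2 t Ht). specialize (phip t).
    transitivity (phi2 t * (1 - h t * du0 x) - du0 x * (phi t * h2 t + 2 * phi1 t * h1 t)); [ring|].
    rewrite Eh2. field. lra.
  - intros x Hx. assert (Hd := dom01 x Hx). rewrite Ew, Ewt, phi0, h0, h10, phi10 by exact Hd. split; ring.
Qed.

(* [squeeze d] is a smooth map of the line into [-d, 1+d] that is the identity on [0,1]:
   [z - bend z] is [z] for [z <= 0] and stays in [0,1] for [z >= 0]. *)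
Definition bend (z : R) : R := z * z * flat 0 z / (1 + z * flat 0 z).

Definition squeeze (d x : R) : R := x - d * bend ((x - 1) / d) + d * bend (- x / d).

Lemma bend_denominator z : 0 < 1 + z * flat 0 z.
Proof.
  destruct (Rle_lt_dec z 0) as [H|H].
  - rewrite flat_eq0 by exact H. lra.
  - pose proof (flat_nonneg 0 z). nra.
Qed.

Lemma bend_nonpos z : z <= 0 -> bend z = 0.
Proof. intros H. unfold bend. rewrite flat_eq0 by exact H. field. Qed.

(** Since [exp (- / z) >= 1 - / z], the denominator of [z - bend z = z / (1 + z exp (- / z))] is at
    least [z]. *)
Lemma bend_bounds z : 0 <= z -> 0 <= z - bend z <= 1.
Proof.
  intros Hz. assert (Hd := bend_denominator z).
  assert (E : z - bend z = z / (1 + z * flat 0 z)) by (unfold bend; field; lra).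
  rewrite E. split; [apply Rdiv_le_0_compat; lra|].
  apply Rmult_le_reg_r with (1 + z * flat 0 z); [exact Hd|].
  replace (z / (1 + z * flat 0 z) * (1 + z * flat 0 z)) with z by (field; lra).
  rewrite Rmult_1_l. destruct (Req_dec z 0) as [->|Hz0]; [lra|].
  assert (1 - / z <= flat 0 z).
  { unfold flat. destruct Rlt_dec; [|lra]. simpl. pose proof (exp_ineq1_le (- / z)). lra. }
  assert (z * (1 - / z) <= z * flat 0 z) by (apply Rmult_le_compat_l; lra).
  replace (z * (1 - / z)) with (z - 1) in H0 by (field; lra). lra.
Qed.

Lemma bend_Ck2 n f : Ck2 n f -> Ck2 n (fun x t => bend (f x t)).
Proof.
  intros Hf.
  assert (Hb : Ck2 n (fun x _ => bend x)).
  { assert (H : Ck2 n (fun x _ => x * flat 0 x))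
      by (apply Ck2_mult; [apply Ck2_fst|apply flat_Ck2]).
    apply Ck2_div.
    - intros x _. apply Rgt_not_eq, bend_denominator.
    - apply (Ck2_ext n (fun x _ => x * (x * flat 0 x))); [intros; ring|].
      apply Ck2_mult; [apply Ck2_fst|exact H].
    - apply Ck2_plus; [apply Ck2_const|exact H]. }
  apply (Ck2_comp n (fun x _ => bend x) f (fun _ t => t)); [exact Hb|exact Hf|apply Ck2_snd].
Qed.

Lemma squeeze_id d x : 0 < d -> 0 <= x <= 1 -> squeeze d x = x.
Proof.
  intros Hd Hx. unfold squeeze. assert (Hi : 0 < / d) by now apply Rinv_0_lt_compat.
  rewrite !bend_nonpos; [ring| |]; unfold Rdiv; nra.
Qed.

Lemma squeeze_range d x : 0 < d -> - d <= squeeze d x <= 1 + d.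
Proof.
  intros Hd. assert (Hi : 0 < / d) by now apply Rinv_0_lt_compat.
  destruct (Rlt_le_dec x 0) as [H0|H0]; [|destruct (Rle_lt_dec x 1) as [H1|H1]].
  - assert (Hz : 0 <= - x / d) by (apply Rdiv_le_0_compat; lra).
    assert (E : squeeze d x = - d * (- x / d - bend (- x / d))).
    { unfold squeeze. rewrite (bend_nonpos ((x - 1) / d)); [field; lra|unfold Rdiv; nra]. }
    rewrite E. pose proof (bend_bounds _ Hz). nra.
  - rewrite squeeze_id by lra. lra.
  - assert (Hz : 0 <= (x - 1) / d) by (apply Rdiv_le_0_compat; lra).
    assert (E : squeeze d x = 1 + d * ((x - 1) / d - bend ((x - 1) / d))).
    { unfold squeeze. rewrite (bend_nonpos (- x / d)); [field; lra|unfold Rdiv; nra]. }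
    rewrite E. pose proof (bend_bounds _ Hz). nra.
Qed.

Lemma squeeze_Ck2 n d : (forall x t, d x t <> 0) -> Ck2 n d -> Ck2 n (fun x t => squeeze (d x t) x).
Proof.
  intros Hn Hd. unfold squeeze.
  apply Ck2_plus.
  - apply Ck2_minus; [apply Ck2_fst|]. apply Ck2_mult; [exact Hd|]. apply bend_Ck2.
    apply Ck2_div; auto. apply Ck2_minus; [apply Ck2_fst|apply Ck2_const].
  - apply Ck2_mult; [exact Hd|]. apply bend_Ck2.
    apply Ck2_div; auto. apply Ck2_opp, Ck2_fst.
Qed.

(* A diffeomorphism of the line onto [(-1/(c M), 1/M)] fixing [0]. *)
Definition time_scale (M c s : R) : R := (1 - exp (- s)) / (M * (1 + c * exp (- s))).

Lemma one_minus_time_scale M c s : 0 < M -> 0 < c ->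
  1 - M * time_scale M c s = (1 + c) * exp (- s) / (1 + c * exp (- s)).
Proof.
  intros HM Hc. unfold time_scale. pose proof (exp_pos (- s)). field. split; nra.
Qed.

Lemma one_plus_time_scale M c s : 0 < M -> 0 < c ->
  1 + c * M * time_scale M c s = (1 + c) / (1 + c * exp (- s)).
Proof.
  intros HM Hc. unfold time_scale. pose proof (exp_pos (- s)). field. split; nra.
Qed.

Lemma time_scale_lt M c s : 0 < M -> 0 < c -> 0 < 1 - M * time_scale M c s.
Proof.
  intros HM Hc. rewrite one_minus_time_scale by assumption. pose proof (exp_pos (- s)).
  apply Rdiv_lt_0_compat; nra.
Qed.

Lemma time_scale_gt M c s : 0 < M -> 0 < c -> 0 < 1 + c * M * time_scale M c s.
Proof.
  intros HM Hc. rewrite one_plus_time_scale by assumption. pose proof (exp_pos (- s)).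
  apply Rdiv_lt_0_compat; nra.
Qed.

Lemma time_scale_deriv M c s : 0 < M -> 0 < c -> derivable_pt_lim (time_scale M c) s
  ((1 - M * time_scale M c s) / (M * (1 + c * exp (- s)))).
Proof.
  intros HM Hc. rewrite one_minus_time_scale by assumption. apply is_derive_Reals. unfold time_scale.
  pose proof (exp_pos (- s)). assert (1 + c * exp (- s) <> 0) by nra.
  auto_derive; [|field; split; [assumption|lra]].
  apply Rmult_integral_contrapositive_currified; [lra|assumption].
Qed.

Lemma time_scale_Ck2 n M c : 0 < M -> 0 < c -> Ck2 n (fun s _ => time_scale M c s).
Proof.
  intros HM Hc.
  assert (HE : Ck2 n (fun s _ => exp (- s))) by (apply (Ck2_exp n (fun s _ => - s)), Ck2_opp, Ck2_fst).
  apply Ck2_div.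
  - intros s _. pose proof (exp_pos (- s)).
    apply Rgt_not_eq, Rmult_lt_0_compat; nra.
  - apply Ck2_minus; [apply Ck2_const|exact HE].
  - apply Ck2_mult; [apply Ck2_const|]. apply Ck2_plus; [apply Ck2_const|].
    apply Ck2_mult; [apply Ck2_const|exact HE].
Qed.

Lemma time_scale_0 M c : time_scale M c 0 = 0.
Proof. unfold time_scale. rewrite Ropp_0, exp_0. unfold Rdiv. ring. Qed.

Lemma time_scale_nonneg M c s : 0 < M -> 0 < c -> 0 <= s -> 0 <= time_scale M c s.
Proof.
  intros HM Hc Hs. unfold time_scale. pose proof (exp_pos (- s)).
  assert (exp (- s) <= 1) by now apply exp_neg_le_1.
  apply Rmult_le_pos; [lra|left; apply Rinv_0_lt_compat, Rmult_lt_0_compat; nra].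
Qed.

(** Put [eps = 1 - M e]. The degenerate maximum gives [q <= eps + K' |x - a|^2], so [q <= 2 eps] on
    a width [r = sqrt (eps / K')] and the integral is at least [r / (2 eps)]. Its square is
    [/ (4 K' eps)], and the factor [eps] in the derivative of the time scale cancels exactly. *)
Lemma time_scale_integral_bound du0 ddu0 M c a K s (q : R -> R) : 0 < M -> 0 < c -> 0 <= a <= 1 ->
  (forall x, derivable_pt_lim du0 x (ddu0 x)) -> du0 a = M -> 0 <= K ->
  (forall x, Rabs (x - a) <= 1 -> Rabs (ddu0 x) <= K * Rabs (x - a) ^ 1) ->
  (forall x, 0 <= x <= 1 -> continuity_pt q x) -> (forall x, 0 <= x <= 1 -> 0 < q x) ->
  (forall x, 0 <= x <= 1 -> q x = 1 - time_scale M c s * du0 x) -> 0 <= s ->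
  / (4 * (K / M + 4) * M * (1 + c)) <=
    RInt (fun y => / q y) 0 1 ^ 2 * ((1 - M * time_scale M c s) / (M * (1 + c * exp (- s)))).
Proof.
  intros HM Hc Ha Hd Ea HK Hdd qc qp qe Hs.
  assert (He := time_scale_nonneg M c s HM Hc Hs). assert (Hlt := time_scale_lt M c s HM Hc).
  remember (time_scale M c s) as e eqn:Ee.
  assert (Heq : exists eps, eps = 1 - M * e) by now eexists. destruct Heq as [eps Eeps].
  rewrite <- Eeps in *.
  assert (Heps1 : eps <= 1) by nra.
  assert (HKM : 0 <= K / M) by now apply Rdiv_le_0_compat.
  (* The summand 4 ensures [r <= 1 / 2], because [K' r^2 = eps <= 1]; the quotient [K / M] comes
     from [e <= / M]. *)
  remember (K / M + 4) as K' eqn:EK'. assert (HK' : 4 <= K') by lra.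
  assert (Hr : exists r, 0 < r /\ r * r = eps / K').
  { assert (0 < eps / K') by (apply Rdiv_lt_0_compat; lra).
    exists (sqrt (eps / K')). split; [now apply sqrt_lt_R0|apply sqrt_sqrt; lra]. }
  destruct Hr as [r [Hr0 Hr]].
  assert (Hr2 : K' * (r * r) = eps) by (rewrite Hr; field; lra).
  assert (Hquad : forall x, 0 <= x <= 1 -> M - du0 x <= K * Rabs (x - a) ^ 2).
  { intros x Hx.
    assert (Hg : Rabs (du0 x - M) <= K * Rabs (x - a) ^ 2).
    { apply (pow_growth (fun x => du0 x - M) ddu0 a 1 K 1); auto; try lra.
      - intros y. replace (ddu0 y) with (ddu0 y - 0) by ring.
        apply derivable_pt_lim_minusR; [apply Hd|apply derivable_pt_lim_const].
      - apply Rabs_le. lra. }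
    pose proof (Rle_abs (- (du0 x - M))). rewrite Rabs_Ropp in *. lra. }
  assert (HP : r / (2 * eps) <= RInt (fun y => / q y) 0 1).
  { apply (RInt_inv_lower_bound q a K' 2 eps r); auto; try lra.
    - split; [exact Hr0|]. apply Rnot_lt_le. intros C. nra.
    - intros x Hx. rewrite qe by exact Hx. specialize (Hquad x Hx).
      assert (0 <= Rabs (x - a) ^ 2) by (apply pow_le, Rabs_pos).
      assert (HeM : e <= / M).
      { apply Rmult_le_reg_l with M; [exact HM|]. rewrite Rinv_r by lra. lra. }
      assert (e * (M - du0 x) <= K / M * Rabs (x - a) ^ 2).
      { apply Rle_trans with (e * (K * Rabs (x - a) ^ 2)); [now apply Rmult_le_compat_l|].
        unfold Rdiv. rewrite (Rmult_comm K (/ M)), Rmult_assoc.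
        apply Rmult_le_compat_r; [|exact HeM]. nra. }
      rewrite EK'. nra. }
  assert (HE : exp (- s) <= 1) by now apply exp_neg_le_1.
  assert (HE0 := exp_pos (- s)).
  assert (Hr3 : 0 < r / (2 * eps)) by (apply Rdiv_lt_0_compat; lra).
  apply Rle_trans with ((r / (2 * eps)) ^ 2 * (eps / (M * (1 + c * exp (- s))))).
  - replace ((r / (2 * eps)) ^ 2 * (eps / (M * (1 + c * exp (- s))))) with
      (r * r / (4 * eps * (M * (1 + c * exp (- s))))) by (field; repeat split; nra).
    rewrite Hr.
    replace (eps / K' / (4 * eps * (M * (1 + c * exp (- s))))) with
      (/ (4 * K' * M * (1 + c * exp (- s)))) by (field; repeat split; nra).
    apply Rinv_le_contravar.
    + repeat apply Rmult_lt_0_compat; nra.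
    + apply Rmult_le_compat_l; [|nra]. repeat apply Rmult_le_pos; lra.
  - apply Rmult_le_compat_r.
    + apply Rdiv_le_0_compat; [lra|]. apply Rmult_lt_0_compat; nra.
    + apply pow_incr. split; [lra|exact HP].
Qed.

(** What remains is a positive bounded smooth [q] that equals [1 - e u0'] where the equation is
    required. Under periodicity this expression serves as it stands; under Dirichlet conditions the
    label is first squeezed into a neighbourhood of [[0,1]] that shrinks as [e] approaches
    [/ M0]. *)
Theorem global_existence bc u0 du0 M0 a :
  admissible bc u0 -> (forall x, derivable_pt_lim u0 x (du0 x)) -> 0 < M0 ->
  (forall x, 0 <= x <= 1 -> du0 x <= M0) -> 0 <= a <= 1 -> du0 a = M0 ->
  derivable_pt_lim du0 a 0 ->
  exists u ux, is_global_solution bc u0 u ux.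
Proof.
  intros Hadm Hdu0 HM Hmax Ha Ea Hda.
  assert (Sf : smooth1 du0) by (apply (smooth1_deriv u0); [apply Hadm|exact Hdu0]).
  destruct (smooth1_ex_deriv du0 Sf) as [ddu0 [Hdd Sdd]].
  destruct (smooth1_ex_deriv ddu0 Sdd) as [d3 [Hd3 Sd3]].
  assert (Hdda : ddu0 a = 0) by exact (uniqueness_limite _ _ _ _ (Hdd a) Hda).
  destruct (smooth1_bounded d3 (-1) 2 Sd3) as [K [HK HK3]].
  assert (Hlin : forall x, Rabs (x - a) <= 1 -> Rabs (ddu0 x) <= K * Rabs (x - a) ^ 1).
  { apply (pow_growth ddu0 d3 a 0 K 1); auto. intros x Hx. rewrite pow_O, Rmult_1_r.
    apply HK3. apply Rabs_le_between in Hx. lra. }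
  (* Squeezed labels stay in [[-2,3]], since the overshoot [d] is at most 2. *)
  destruct (smooth1_bounded du0 (-2) 3 Sf) as [B [HB HBf]].
  destruct (smooth1_bounded ddu0 (-2) 3 Sdd) as [L [HL HLf]].
  (* Then [c M0 = B + M0] exceeds every [|u0'|] on [[-2,3]], and [e > - / (c M0)] keeps [1 - e u0']
     positive when [e] is negative. *)
  set (c := B / M0 + 1).
  assert (Hc : 1 <= c) by (assert (0 <= B / M0) by (now apply Rdiv_le_0_compat); unfold c; lra).
  assert (HcB : forall x, -2 <= x <= 3 -> - (c * M0) <= du0 x).
  { intros x Hx. specialize (HBf x Hx). apply Rabs_le_between in HBf.
    replace (c * M0) with (B + M0) by (unfold c; field; lra). lra. }
  set (e := time_scale M0 c).
  assert (Hc0 : 0 < c) by lra.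
  assert (Hlt := fun s => time_scale_lt M0 c s HM Hc0). assert (Hgt := fun s => time_scale_gt M0 c s HM Hc0).
  fold e in Hlt, Hgt.
  assert (Hpos : forall s v, - (c * M0) <= v <= M0 -> 0 < 1 - e s * v).
  { intros s v Hv. specialize (Hlt s). specialize (Hgt s).
    destruct (Rle_lt_dec 0 (e s)); nra. }
  assert (Main : forall q, smooth2 q -> (forall x s, 0 < q x s) -> (forall s, exists B, forall x, q x s <= B) ->
    (bc = Periodic -> forall x s, q (x + 1) s = q x s) ->
    (forall x s, bc_domain bc x -> q x s = 1 - e s * du0 x) ->
    exists u ux, is_global_solution bc u0 u ux).
  { intros q Sq qp qB qper qe.
    apply (global_solution_of_parametrization bc u0 du0 q e
      (fun s => (1 - M0 * e s) / (M0 * (1 + c * exp (- s)))) (/ (4 * (K / M0 + 4) * M0 * (1 + c)))); auto.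
    - intros n. now apply time_scale_Ck2.
    - intros s. now apply time_scale_deriv.
    - apply time_scale_0.
    - intros s. pose proof (exp_pos (- s)). apply Rdiv_lt_0_compat; [apply Hlt|].
      apply Rmult_lt_0_compat; nra.
    - apply Rinv_0_lt_compat. assert (0 <= K / M0) by now apply Rdiv_le_0_compat.
      repeat apply Rmult_lt_0_compat; lra.
    - intros s Hs. apply (time_scale_integral_bound du0 ddu0 M0 c a K s (fun y => q y s)); auto.
      + intros x _. apply continuity2_1. now apply smooth2_continuity.
      + intros x Hx. apply qe. destruct bc; simpl; auto. }
  assert (Sfe : forall r, smooth2 r -> smooth2 (fun x s => 1 - e s * du0 (r x s))).
  { intros r Sr n. apply Ck2_minus; [apply Ck2_const|]. apply Ck2_mult.
    - apply (Ck2_comp n (fun s _ => e s) (fun _ s => s) (fun _ s => s)); try apply Ck2_snd. now apply time_scale_Ck2.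
    - apply (Ck2_comp n (fun x _ => du0 x) r (fun _ s => s)); [now apply smooth1_smooth2|apply Sr|apply Ck2_snd]. }
  assert (Hbd : forall s v, Rabs v <= B -> 1 - e s * v <= 1 + Rabs (e s) * B).
  { intros s v Hv. pose proof (Rle_abs (- (e s * v))) as H1. rewrite Rabs_Ropp, Rabs_mult in H1.
    assert (Rabs (e s) * Rabs v <= Rabs (e s) * B) by (apply Rmult_le_compat_l; [apply Rabs_pos|exact Hv]). lra. }
  destruct bc.
  - assert (fper : forall x, du0 (x + 1) = du0 x).
    { apply (deriv_periodic u0); [exact Hdu0|apply Hadm]. }
    assert (fred : forall x, exists y, 0 <= y <= 1 /\ du0 y = du0 x).
    { intros x. destruct (periodic_reduction x) as [y [Hy Hh]]. exists y. split; [exact Hy|]. now apply Hh. }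
    apply (Main (fun x s => 1 - e s * du0 x)); auto.
    + apply (Sfe (fun x _ => x)). intros n. apply Ck2_fst.
    + intros x s. apply Hpos. destruct (fred x) as [y [Hy <-]]. split; [apply HcB; lra|now apply Hmax].
    + intros s. exists (1 + Rabs (e s) * B). intros x. apply Hbd.
      destruct (fred x) as [y [Hy <-]]. apply HBf; lra.
    + intros _ x s. now rewrite fper.
  (* At overshoot [d] the slope exceeds [M0] by at most [L d]. This constant makes
     [L d < M0 (1 - M0 e)], and with [e < / M0] the excess [e L d] stays below the available gap
     [1 - M0 e]. *)
  - set (c1 := M0 / (L + M0)).
    assert (Hc1 : 0 < c1) by (apply Rdiv_lt_0_compat; lra).
    assert (Hc1' : c1 <= 1).
    { unfold c1. apply Rmult_le_reg_r with (L + M0); [lra|]. field_simplify; lra. }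
    set (d := fun s => c1 * (1 - M0 * e s)).
    assert (Hd : forall s, 0 < d s) by (intros; apply Rmult_lt_0_compat; auto).
    assert (Hd2 : forall s, d s <= 2).
    { intros s. assert (1 - M0 * e s <= 2).
      { unfold e. rewrite one_minus_time_scale by assumption. pose proof (exp_pos (- s)).
        apply Rmult_le_reg_r with (1 + c * exp (- s)); [nra|]. field_simplify; nra. }
      unfold d. specialize (Hlt s). nra. }
    set (r := fun x s => squeeze (d s) x).
    assert (Hr : forall x s, -2 <= r x s <= 3).
    { intros x s. pose proof (squeeze_range (d s) x (Hd s)). specialize (Hd2 s). unfold r. lra. }
    assert (Hrid : forall x s, 0 <= x <= 1 -> r x s = x) by (intros; now apply squeeze_id).
    assert (Hfr : forall x s, du0 (r x s) <= M0 + L * d s).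
    { intros x s. pose proof (squeeze_range (d s) x (Hd s)) as Hs. fold (r x s) in Hs.
      assert (Hlip : forall y z, -2 <= y <= 3 -> -2 <= z <= 3 -> du0 z <= du0 y + L * Rabs (z - y)).
      { intros y z Hy Hz. destruct (mvt du0 ddu0 y z Hdd) as [w [Hw E]].
        assert (Hw' : -2 <= w <= 3) by (unfold Rmin, Rmax in Hw; destruct Rle_dec; lra).
        specialize (HLf w Hw'). pose proof (Rle_abs (ddu0 w * (z - y))) as H1. rewrite Rabs_mult in H1.
        assert (Rabs (ddu0 w) * Rabs (z - y) <= L * Rabs (z - y)) by (apply Rmult_le_compat_r; [apply Rabs_pos|exact HLf]).
        lra. }
      specialize (Hd s). specialize (Hr x s).
      destruct (Rlt_le_dec (r x s) 0) as [L0|L0]; [|destruct (Rle_lt_dec (r x s) 1) as [L1|L1]].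
      - assert (H1 := Hlip 0 (r x s) ltac:(lra) Hr). assert (H2 := Hmax 0 ltac:(lra)).
        rewrite Rabs_left1 in H1 by lra. nra.
      - assert (H2 := Hmax (r x s) ltac:(lra)). nra.
      - assert (H1 := Hlip 1 (r x s) ltac:(lra) Hr). assert (H2 := Hmax 1 ltac:(lra)).
        rewrite Rabs_pos_eq in H1 by lra. nra. }
    apply (Main (fun x s => 1 - e s * du0 (r x s))).
    + apply Sfe. intros n. apply (squeeze_Ck2 n (fun _ s => d s)).
      * intros _ s. apply Rgt_not_eq, Hd.
      * apply Ck2_mult; [apply Ck2_const|]. apply Ck2_minus; [apply Ck2_const|].
        apply Ck2_mult; [apply Ck2_const|].
        apply (Ck2_comp n (fun s _ => e s) (fun _ s => s) (fun _ s => s)); try apply Ck2_snd. now apply time_scale_Ck2.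
    + intros x s. destruct (Rle_lt_dec (du0 (r x s)) M0) as [H1|H1].
      * apply Hpos. split; [apply HcB, Hr|exact H1].
      * specialize (Hfr x s). specialize (Hlt s). specialize (Hgt s).
        destruct (Rle_lt_dec 0 (e s)) as [H2|H2]; [|nra].
        assert (E1 : (L + M0) * d s = M0 * (1 - M0 * e s)) by (unfold d, c1; field; lra).
        assert (E2 : L * d s < M0 * (1 - M0 * e s)) by (specialize (Hd s); nra).
        assert (E3 : e s * du0 (r x s) <= e s * (M0 + L * d s)) by (apply Rmult_le_compat_l; lra).
        assert (E4 : e s * (L * d s) <= e s * (M0 * (1 - M0 * e s))) by (apply Rmult_le_compat_l; lra).
        assert (E5 : e s * (M0 * (1 - M0 * e s)) < 1 * (1 - M0 * e s)) by (rewrite <- Rmult_assoc; apply Rmult_lt_compat_r; lra).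
        lra.
    + intros s. exists (1 + Rabs (e s) * B). intros x. apply Hbd, HBf, Hr.
    + discriminate.
    + intros x s Hx. now rewrite Hrid.
Qed.

(** * Solutions along the flow *)

Lemma mvt_open f df a b : a < b -> (forall x, a < x < b -> derivable_pt_lim f x (df x)) ->
  (forall x, a <= x <= b -> continuity_pt f x) ->
  exists c, a < c < b /\ f b - f a = df c * (b - a).
Proof.
  intros Hab Hd Hc.
  set (pr1 := fun c (P : a < c < b) => exist (derivable_pt_abs f c) (df c) (Hd c P) : derivable_pt f c).
  set (pr2 := fun c (_ : a < c < b) => derivable_pt_id c).
  destruct (MVT f id a b pr1 pr2 Hab Hc) as [c [P E]].
  - intros c _. apply derivable_continuous_pt, derivable_pt_id.
  - exists c. split; [exact P|].
    rewrite (pr_nu id c (pr2 c P) (derivable_pt_id c)), derive_pt_id in E.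
    unfold id in E. simpl in E. lra.
Qed.

Lemma increment_bound g dg t k : continuity g -> 0 <= t ->
  (forall s, 0 < s < t -> derivable_pt_lim g s (dg s)) -> (forall s, 0 < s < t -> Rabs (dg s) <= k) ->
  Rabs (g t - g 0) <= k * t.
Proof.
  intros Hc Ht Hd Hk. destruct (Req_dec t 0) as [->|Hn].
  - rewrite Rminus_diag, Rabs_R0. lra.
  - destruct (mvt_open g dg 0 t) as [c [Hcc E]]; auto; [lra|].
    rewrite E, Rminus_0_r, Rabs_mult, (Rabs_pos_eq t) by lra.
    apply Rmult_le_compat_r; auto.
Qed.

Lemma constant_of_deriv0 g : continuity g -> (forall t, 0 < t -> derivable_pt_lim g t 0) ->
  forall t, 0 <= t -> g t = g 0.
Proof.
  intros Hc Hd t Ht.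
  assert (H : Rabs (g t - g 0) <= 0 * t).
  { apply (increment_bound g (fun _ => 0)); auto; intros s Hs; [apply Hd; lra|rewrite Rabs_R0; lra]. }
  rewrite Rmult_0_l in H. pose proof (Rabs_pos (g t - g 0)).
  assert (E : Rabs (g t - g 0) = 0) by lra. apply Rminus_diag_uniq.
  destruct (Req_dec (g t - g 0) 0) as [|N]; [assumption|]. now apply Rabs_no_R0 in N.
Qed.

Lemma nondecreasing_of_deriv g dg t : continuity g -> 0 <= t ->
  (forall s, 0 < s < t -> derivable_pt_lim g s (dg s)) -> (forall s, 0 < s < t -> 0 <= dg s) ->
  g 0 <= g t.
Proof.
  intros Hc Ht Hd Hp. destruct (Req_dec t 0) as [->|Hn]; [lra|].
  destruct (mvt_open g dg 0 t) as [c [Hcc E]]; auto; [lra|]. specialize (Hp c Hcc). nra.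
Qed.

Lemma nonincreasing_of_deriv g dg t : continuity g -> 0 <= t ->
  (forall s, 0 < s < t -> derivable_pt_lim g s (dg s)) -> (forall s, 0 < s < t -> dg s <= 0) ->
  g t <= g 0.
Proof.
  intros Hc Ht Hd Hp. assert (- g 0 <= - g t); [|lra].
  apply (nondecreasing_of_deriv (fun s => - g s) (fun s => - dg s)); [now apply (continuity_opp g)|exact Ht| |].
  - intros s Hs. now apply derivable_pt_lim_oppR, Hd.
  - intros s Hs. specialize (Hp s Hs). lra.
Qed.

(** Continuity is asked on the whole line but the equation only for positive times; a trajectory of
    [is_flow] fits once it is frozen for negative times. *)
Definition path (u : R -> R -> R) (y : R -> R) : Prop :=
  continuity y /\ forall t, 0 < t -> derivable_pt_lim y t (u (y t) t).

Lemma continuity_bounded y a b : continuity y -> exists B, 0 <= B /\ forall t, a <= t <= b -> - B <= y t <= B.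
Proof.
  intros Hc. destruct (rectangle_bound (fun t _ => y t) a b 0 0) as [B [HB H]].
  - apply continuity2_iff. intros. apply continuity_1d_2d_pt_comp; [apply Hc|apply continuity_2d_pt_id1].
  - exists B. split; [exact HB|]. intros t Ht. apply Rabs_le_between. apply (H t 0); lra.
Qed.

(* Two-sided Gronwall estimate, written with squares so that it needs no case distinction on signs. *)
Lemma path_gap u ux y z T B1 B2 C : pdx u ux -> path u y -> path u z ->
  (forall t, 0 <= t <= T -> B1 <= y t <= B2 /\ B1 <= z t <= B2) -> 0 <= C ->
  (forall x t, B1 <= x <= B2 -> 0 <= t <= T -> Rabs (ux x t) <= C) ->
  forall t, 0 <= t <= T ->
  (y t - z t) ^ 2 <= (y 0 - z 0) ^ 2 * exp (2 * C * t) /\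
  (y 0 - z 0) ^ 2 * exp (- (2 * C * t)) <= (y t - z t) ^ 2.
Proof.
  intros Hux [Hy Hdy] [Hz Hdz] Hbox HC Hb t Ht.
  set (D := fun s => y s - z s).
  assert (Dc : continuity D) by now apply continuity_minusR.
  assert (HD : forall s, 0 < s -> derivable_pt_lim D s (u (y s) s - u (z s) s)).
  { intros s Hs. apply derivable_pt_lim_minusR; auto. }
  assert (HDC : forall s, 0 < s < t -> Rabs (D s * (u (y s) s - u (z s) s)) <= C * D s ^ 2).
  { intros s Hs. destruct (mvt (fun x => u x s) (fun x => ux x s) (z s) (y s)) as [c [Hc E]]; [intros; apply Hux|].
    destruct (Hbox s) as [H1 H2]; [lra|]. rewrite E.
    replace (D s * (ux c s * (y s - z s))) with (ux c s * D s ^ 2) by (unfold D; ring).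
    rewrite Rabs_mult, (Rabs_pos_eq (D s ^ 2)) by apply pow2_ge_0.
    apply Rmult_le_compat_r; [apply pow2_ge_0|]. apply Hb; [|lra].
    unfold Rmin, Rmax in Hc; destruct Rle_dec; lra. }
  (* With [k = - 2 C] this product is nonincreasing, with [k = 2 C] nondecreasing: these are the two
     Gronwall estimates. *)
  assert (Hder : forall k s, 0 < s -> derivable_pt_lim (fun s => D s * D s * exp (k * s)) s
     ((2 * (D s * (u (y s) s - u (z s) s)) + k * D s ^ 2) * exp (k * s))).
  { intros k s Hs. replace ((2 * (D s * (u (y s) s - u (z s) s)) + k * D s ^ 2) * exp (k * s)) with
      (((u (y s) s - u (z s) s) * D s + D s * (u (y s) s - u (z s) s)) * exp (k * s) + (D s * D s) * (k * exp (k * s))) by ring.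
    apply (derivable_pt_lim_mult (fun s => D s * D s) (fun s => exp (k * s))).
    - apply derivable_pt_lim_multR; auto.
    - derive_by_ring. }
  assert (Hcont : forall k, continuity (fun s => D s * D s * exp (k * s))).
  { intros k. apply continuity_multR.
    - now apply continuity_multR.
    - intros s. apply derivable_continuous_pt. exists (k * exp (k * s)).
      derive_by_ring. }
  assert (Hup := nonincreasing_of_deriv _ _ t (Hcont (- (2 * C))) (proj1 Ht)
    (fun s Hs => Hder (- (2 * C)) s (proj1 Hs))).
  assert (Hlo := nondecreasing_of_deriv _ _ t (Hcont (2 * C)) (proj1 Ht)
    (fun s Hs => Hder (2 * C) s (proj1 Hs))).
  simpl in Hup, Hlo. rewrite !Rmult_0_r, exp_0, !Rmult_1_r in Hup, Hlo.
  assert (Ee : exp (2 * C * t) * exp (- (2 * C * t)) = 1) by (rewrite <- exp_plus, Rplus_opp_r; apply exp_0).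
  pose proof (exp_pos (2 * C * t)). pose proof (exp_pos (- (2 * C * t))).
  replace (- (2 * C) * t) with (- (2 * C * t)) in Hup by ring.
  fold (D t) (D 0). split.
  - assert (D t * D t * exp (- (2 * C * t)) <= D 0 * D 0).
    { apply Hup. intros s Hs. specialize (HDC s Hs). apply Rabs_le_between in HDC.
      pose proof (exp_pos (- (2 * C) * s)). simpl in HDC. nra. }
    replace (D t ^ 2) with ((D t * D t * exp (- (2 * C * t))) * exp (2 * C * t)).
    + simpl. rewrite Rmult_1_r. apply Rmult_le_compat_r; lra.
    + rewrite Rmult_assoc, (Rmult_comm (exp _)), Ee. ring.
  - assert (D 0 * D 0 <= D t * D t * exp (2 * C * t)).
    { apply Hlo. intros s Hs. specialize (HDC s Hs). apply Rabs_le_between in HDC.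
      pose proof (exp_pos (2 * C * s)). simpl in HDC. nra. }
    replace (D t ^ 2) with ((D t * D t * exp (2 * C * t)) * exp (- (2 * C * t))).
    + simpl. rewrite Rmult_1_r. apply Rmult_le_compat_r; lra.
    + rewrite Rmult_assoc, Ee. ring.
Qed.

Lemma path_gap_ex u ux y z T : smooth2 u -> pdx u ux -> path u y -> path u z ->
  exists C, forall t, 0 <= t <= T ->
  (y t - z t) ^ 2 <= (y 0 - z 0) ^ 2 * exp (2 * C * t) /\
  (y 0 - z 0) ^ 2 * exp (- (2 * C * t)) <= (y t - z t) ^ 2.
Proof.
  intros Su Hux Hy Hz.
  destruct (continuity_bounded y 0 T (proj1 Hy)) as [A1 [HA1 H1]].
  destruct (continuity_bounded z 0 T (proj1 Hz)) as [A2 [HA2 H2]].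
  destruct (rectangle_bound ux (- (A1 + A2)) (A1 + A2) 0 T) as [C [HC0 HC]].
  { apply smooth2_continuity. now apply smooth2_pdx with u. }
  exists C. intros t Ht. apply (path_gap u ux y z T (- (A1 + A2)) (A1 + A2) C); auto.
  intros s Hs. specialize (H1 s Hs). specialize (H2 s Hs). lra.
Qed.

Lemma path_unique u ux y z : smooth2 u -> pdx u ux -> path u y -> path u z -> y 0 = z 0 ->
  forall t, 0 <= t -> y t = z t.
Proof.
  intros Su Hux Hy Hz E t Ht. destruct (path_gap_ex u ux y z t Su Hux Hy Hz) as [C HC].
  destruct (HC t) as [H _]; [lra|]. rewrite E, Rminus_diag, pow_i, Rmult_0_l in H by lia.
  pose proof (pow2_ge_0 (y t - z t)). assert (E2 : (y t - z t) ^ 2 = 0) by lra.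
  simpl in E2. rewrite Rmult_1_r in E2. destruct (Rmult_integral _ _ E2); lra.
Qed.

(** The lower Gronwall bound excludes a crossing: where [y = z] the gap would vanish although it
    started positive. *)
Lemma path_order u ux y z : smooth2 u -> pdx u ux -> path u y -> path u z -> y 0 <= z 0 ->
  forall t, 0 <= t -> y t <= z t.
Proof.
  intros Su Hux Hy Hz [L|E] t Ht; [|right; now apply (path_unique u ux)].
  apply Rnot_lt_le. intros Hlt.
  destruct (path_gap_ex u ux y z t Su Hux Hy Hz) as [C HC].
  assert (Dc : continuity (fun s => y s - z s)) by (apply continuity_minusR; [apply Hy|apply Hz]).
  destruct (IVT_gen (fun s => y s - z s) 0 t 0 Dc) as [s [Hs E]].
  - rewrite Rmin_left, Rmax_right by lra. lra.
  - rewrite Rmin_left, Rmax_right in Hs by exact Ht. destruct (HC s Hs) as [_ H]. rewrite E in H.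
    pose proof (exp_pos (- (2 * C * s))).
    assert (0 < (y 0 - z 0) ^ 2 * exp (- (2 * C * s))) by (apply Rmult_lt_0_compat; [nra|lra]). lra.
Qed.

Lemma taylor2 g dg ddg a b K : (forall x, derivable_pt_lim g x (dg x)) ->
  (forall x, derivable_pt_lim dg x (ddg x)) ->
  (forall x, Rmin a b <= x <= Rmax a b -> Rabs (ddg x) <= K) ->
  Rabs (g b - g a - dg a * (b - a)) <= K * (b - a) ^ 2.
Proof.
  intros H1 H2 HK. destruct (mvt g dg a b H1) as [c [Hc E]].
  destruct (mvt dg ddg a c H2) as [c2 [Hc2 E2]]. rewrite E.
  replace (dg c * (b - a) - dg a * (b - a)) with ((dg c - dg a) * (b - a)) by ring. rewrite E2.
  assert (Hc2' : Rmin a b <= c2 <= Rmax a b).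
  { unfold Rmin, Rmax in *. repeat destruct Rle_dec; lra. }
  assert (Hca : Rabs (c - a) <= Rabs (b - a)).
  { unfold Rmin, Rmax in Hc. destruct Rle_dec; [rewrite !Rabs_pos_eq; lra|rewrite !Rabs_left1; lra]. }
  rewrite !Rabs_mult, <- (pow2_abs (b - a)). specialize (HK c2 Hc2').
  replace (K * Rabs (b - a) ^ 2) with (K * Rabs (b - a) * Rabs (b - a)) by ring.
  apply Rmult_le_compat_r; [apply Rabs_pos|].
  apply Rmult_le_compat; auto using Rabs_pos.
Qed.

(** * Calculus on the unit interval and along trajectories *)

(** Functions of the label are controlled only on [[0,1]]; composition with this retraction makes
    them continuous on the line. *)
Definition clamp (x : R) : R := Rmax 0 (Rmin x 1).

Lemma clamp_range x : 0 <= clamp x <= 1.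
Proof. unfold clamp, Rmax, Rmin. repeat destruct Rle_dec; lra. Qed.

Lemma clamp_id x : 0 <= x <= 1 -> clamp x = x.
Proof. intros. unfold clamp, Rmax, Rmin. repeat destruct Rle_dec; lra. Qed.

Lemma clamp_contraction x y : Rabs (clamp x - clamp y) <= Rabs (x - y).
Proof.
  unfold clamp, Rmax, Rmin. repeat destruct Rle_dec; unfold Rabs; repeat destruct Rcase_abs; lra.
Qed.

Lemma continuity_of_lipschitz f L : (forall x y, Rabs (f x - f y) <= L * Rabs (x - y)) -> continuity f.
Proof.
  intros H x eps He. assert (HL : 0 < Rabs L + 1) by (pose proof (Rabs_pos L); lra).
  exists (eps / (Rabs L + 1)). split; [apply Rdiv_lt_0_compat; lra|].
  intros y [_ Hy]. simpl in *. unfold Rdist in *.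
  eapply Rle_lt_trans; [apply H|].
  apply Rle_lt_trans with ((Rabs L + 1) * Rabs (y - x)).
  - apply Rmult_le_compat_r; [apply Rabs_pos|]. pose proof (Rle_abs L). lra.
  - replace eps with ((Rabs L + 1) * (eps / (Rabs L + 1))) by (field; lra). now apply Rmult_lt_compat_l.
Qed.

Lemma continuity_clamp f : (forall x, 0 <= x <= 1 -> continuity_pt f x) -> continuity (fun x => f (clamp x)).
Proof.
  intros H x. apply (continuity_pt_comp clamp f).
  - apply (continuity_of_lipschitz clamp 1). intros. rewrite Rmult_1_l. apply clamp_contraction.
  - apply H, clamp_range.
Qed.

(** The flow is shown to be differentiable in the label only at interior labels, so the fundamental
    theorem is needed with continuity alone at the ends. The clamped function minus a primitive of
    the clamped derivative has zero derivative inside. *)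
Lemma increment_of_interior_deriv F df : continuity (fun x => F (clamp x)) ->
  (forall x, 0 < x < 1 -> derivable_pt_lim F x (df x)) ->
  (forall x, 0 <= x <= 1 -> continuity_pt df x) -> F 1 - F 0 = RInt df 0 1.
Proof.
  intros HF Hd Hc. assert (Hdc := continuity_clamp df Hc).
  rewrite (RInt_ext_01 df (fun x => df (clamp x))).
  2:{ intros x Hx. rewrite clamp_id by lra. reflexivity. }
  destruct (mvt_open (fun x => F (clamp x) - RInt (fun y => df (clamp y)) 0 x) (fun _ => 0) 0 1) as [c [Hcc E]].
  - lra.
  - intros x Hx. assert (E0 : df x - df (clamp x) = 0) by (rewrite clamp_id by lra; ring).
    refine (eq_rect _ (fun l => derivable_pt_lim _ x l) _ _ E0).
    apply derivable_pt_lim_minusR.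
    + apply is_derive_Reals. apply (is_derive_ext_loc F).
      * assert (Hp : 0 < Rmin x (1 - x)) by (apply Rmin_pos; lra). exists (mkposreal _ Hp). intros y Hy.
        change (Rabs (y - x) < Rmin x (1 - x)) in Hy.
        pose proof (Rmin_l x (1 - x)). pose proof (Rmin_r x (1 - x)).
        apply Rabs_def2 in Hy. rewrite clamp_id by lra. reflexivity.
      * apply is_derive_Reals. now apply Hd.
    + now apply (derivable_pt_lim_RInt (fun y => df (clamp y))).
  - intros x _. apply continuity_pt_minusR; [apply HF|].
    apply derivable_continuous_pt. exists (df (clamp x)).
    now apply (derivable_pt_lim_RInt (fun y => df (clamp y))).
  - rewrite !clamp_id in E by lra.
    rewrite RInt_pointR in E. lra.
Qed.

(** Even at an end point, increments directed into the interval determine the two-sided derivative.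
    This transfers the initial condition from [u] to [u_x]. *)
Lemma deriv_eq_on_01 f g df dg x : 0 <= x <= 1 -> (forall y, 0 <= y <= 1 -> f y = g y) ->
  derivable_pt_lim f x df -> derivable_pt_lim g x dg -> df = dg.
Proof.
  intros Hx Hfg Hf Hg. assert (H := derivable_pt_lim_minus f g x df dg Hf Hg).
  apply Rminus_diag_uniq. destruct (Req_dec (df - dg) 0) as [E|N]; [exact E|exfalso].
  destruct (H (Rabs (df - dg)) (Rabs_pos_lt _ N)) as [[d Hd] Hlim]. simpl in Hlim.
  assert (Hmin : 0 < Rmin (d / 2) (1 / 2)) by (apply Rmin_pos; lra).
  pose proof (Rmin_l (d / 2) (1 / 2)). pose proof (Rmin_r (d / 2) (1 / 2)).
  assert (Hh : exists h, h <> 0 /\ Rabs h < d /\ 0 <= x + h <= 1).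
  { destruct (Rle_lt_dec x (1/2)).
    - exists (Rmin (d / 2) (1 / 2)). rewrite Rabs_pos_eq; lra.
    - exists (- Rmin (d / 2) (1 / 2)). rewrite Rabs_left; lra. }
  destruct Hh as [h [Hh0 [Hhd Hh]]]. specialize (Hlim h Hh0 Hhd).
  unfold minus_fct in Hlim. rewrite !Hfg in Hlim by lra.
  replace ((g (x + h) - g (x + h) - (g x - g x)) / h - (df - dg)) with (- (df - dg)) in Hlim by (field; exact Hh0).
  rewrite Rabs_Ropp in Hlim. lra.
Qed.

Lemma continuity_extend_left y a : y 0 = a ->
  (forall eps, 0 < eps -> exists delta, 0 < delta /\ forall s, 0 <= s < delta -> Rabs (y s - a) < eps) ->
  (forall t, 0 < t -> continuity_pt y t) -> continuity (fun t => y (Rmax 0 t)).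
Proof.
  intros H0 Hr Hc t eps He. destruct (Rlt_le_dec 0 t) as [Ht|Ht].
  - destruct (Hc t Ht eps He) as [d [Hd H]]. exists (Rmin d t). split; [apply Rmin_pos; lra|].
    intros s [_ Hs]. simpl in *. unfold Rdist in *.
    pose proof (Rmin_l d t). pose proof (Rmin_r d t).
    assert (Hs' := Hs). apply Rabs_def2 in Hs'.
    rewrite !Rmax_right by lra. destruct (Req_dec s t) as [->|N].
    + rewrite Rminus_diag, Rabs_R0. exact He.
    + apply H. split; [split; [exact I|auto]|lra].
  - destruct (Hr eps He) as [d [Hd H]]. exists d. split; [exact Hd|].
    intros s [_ Hs]. simpl in *. unfold Rdist in *.
    rewrite (Rmax_left 0 t), H0 by lra. apply H. split; [apply Rmax_l|].
    apply Rabs_def2 in Hs. unfold Rmax. destruct Rle_dec; lra.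
Qed.

(** Under periodicity trajectories may leave [[0,1]]. The periodicity of [u] passes to [u_x], [u_xx]
    and, on an open set of times, to [u_xt], so the equation extends to the line with the same
    constant. *)
Lemma equation_on_domain bc u0 u ux : is_global_solution bc u0 u ux ->
  exists uxx uxt, pdx ux uxx /\ pdt ux uxt /\ forall t, 0 < t -> exists K, forall x, bc_domain bc x ->
    uxt x t + u x t * uxx x t - (ux x t) ^ 2 = K.
Proof.
  intros [Su [Hux [[uxx [uxt [Hxx [Hxt Heq]]]] [_ Hbc]]]].
  exists uxx, uxt. split; [exact Hxx|]. split; [exact Hxt|]. intros t Ht.
  destruct (Heq t Ht) as [K [_ HK]]. exists (-2 * K). destruct bc; [|exact HK].
  intros x _.
  assert (P1 : forall s, 0 < s -> forall y, ux (y + 1) s = ux y s).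
  { intros s Hs. apply (deriv_periodic (fun y => u y s) (fun y => ux y s)); [intros; apply Hux|]. intros; apply Hbc; lra. }
  assert (P2 : forall y, uxx (y + 1) t = uxx y t).
  { apply (deriv_periodic (fun y => ux y t) (fun y => uxx y t)); [intros; apply Hxx|]. intros; now apply P1. }
  assert (P3 : forall y, uxt (y + 1) t = uxt y t).
  { intros y. apply Rminus_diag_uniq.
    apply (derivable_pt_lim_locally_const (fun s => ux (y + 1) s - ux y s) t 0 _ t Ht).
    - intros s Hs. apply Rabs_def2 in Hs. rewrite P1 by lra. ring.
    - apply derivable_pt_lim_minusR; apply Hxt. }
  destruct (periodic_reduction x) as [y [Hy Hper]].
  rewrite <- (HK y Hy). symmetry.
  apply (Hper (fun x => uxt x t + u x t * uxx x t - ux x t ^ 2)).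
  intros z. now rewrite P1, P2, P3, Hbc by lra.
Qed.

Lemma continuity_along f y : continuity2 f -> continuity y -> continuity (fun t => f (y t) t).
Proof.
  intros Hf Hy. apply (continuity2_2 (fun _ t => f (y t) t) 0).
  apply continuity2_comp; [exact Hf| |].
  - apply continuity2_iff. intros. apply continuity_1d_2d_pt_comp; [apply Hy|apply continuity_2d_pt_id2].
  - apply continuity2_iff. intros. apply continuity_2d_pt_id2.
Qed.

Lemma deriv_along f fx ft y dy t : continuity2 fx -> pdx f fx -> pdt f ft ->
  derivable_pt_lim y t dy -> derivable_pt_lim (fun t => f (y t) t) t (fx (y t) t * dy + ft (y t) t).
Proof.
  intros Hc Hx Ht Hy. rewrite <- (Rmult_1_r (ft (y t) t)).
  apply (derivable_pt_lim_comp_2d f y (fun t => t)); [now apply C1_differentiable|exact Hy|apply derivable_pt_lim_id].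
Qed.

Lemma Rabs_le_of_sq x l : 0 <= l -> x ^ 2 <= l ^ 2 -> Rabs x <= l.
Proof. intros Hl H. rewrite <- pow2_abs in H. pose proof (Rabs_pos x). nra. Qed.

(* [Gamma_a = 1/w] in integrated form: [(Gamma b - Gamma a) w_a] has derivative
   [O((Gamma b - Gamma a)^2)], and Gronwall bounds the gap by a multiple of [b - a]. *)
Lemma flow_increment u ux (Gam : R -> R -> R) w t :
  smooth2 u -> pdx u ux -> 0 <= t -> (forall a, 0 <= a <= 1 -> path u (Gam a)) ->
  (forall a, 0 <= a <= 1 -> Gam a 0 = a) ->
  (forall a, 0 <= a <= 1 -> forall s, derivable_pt_lim (w a) s (- ux (Gam a s) s * w a s)) ->
  (forall a, 0 <= a <= 1 -> w a 0 = 1) -> (forall a s, 0 <= a <= 1 -> 0 < w a s) ->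
  exists K L, 0 <= K /\ 0 <= L /\ forall a b, 0 <= a <= 1 -> 0 <= b <= 1 ->
    Rabs (Gam b t - Gam a t) <= L * Rabs (b - a) /\
    Rabs ((Gam b t - Gam a t) * w a t - (b - a)) <= K * (b - a) ^ 2.
Proof.
  intros Su Hux Ht Hpath G0 Hw w0 wp.
  assert (Sux := smooth2_pdx _ _ Su Hux). destruct (smooth2_ex_pdx ux Sux) as [uxx [Hxx Sxx]].
  assert (I0 : 0 <= 0 <= 1) by lra. assert (I1 : 0 <= 1 <= 1) by lra.
  destruct (continuity_bounded (Gam 0) 0 t (proj1 (Hpath 0 I0))) as [A1 [HA1 H1]].
  destruct (continuity_bounded (Gam 1) 0 t (proj1 (Hpath 1 I1))) as [A2 [HA2 H2]].
  set (B := A1 + A2).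
  (* The trajectories of the end labels enclose all the others, which makes the bounds on [ux] and
     [uxx] uniform in the label. *)
  assert (Hbox : forall a s, 0 <= a <= 1 -> 0 <= s <= t -> - B <= Gam a s <= B).
  { intros a s Ha Hs. specialize (H1 s Hs). specialize (H2 s Hs).
    assert (Gam 0 s <= Gam a s) by (apply (path_order u ux); auto; rewrite ?G0 by auto; lra).
    assert (Gam a s <= Gam 1 s) by (apply (path_order u ux); auto; rewrite ?G0 by auto; lra).
    unfold B; lra. }
  destruct (rectangle_bound ux (- B) B 0 t) as [C [HC0 HC]]; [now apply smooth2_continuity|].
  destruct (rectangle_bound uxx (- B) B 0 t) as [K2 [HK20 HK2]]; [now apply smooth2_continuity|].
  set (E := exp (C * t)). assert (HE : 0 < E) by apply exp_pos.
  assert (Hgap : forall a b s, 0 <= a <= 1 -> 0 <= b <= 1 -> 0 <= s <= t ->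
    (Gam b s - Gam a s) ^ 2 <= (E * (b - a)) ^ 2).
  { intros a b s Ha Hb Hs.
    destruct (path_gap u ux (Gam b) (Gam a) t (- B) B C Hux (Hpath b Hb) (Hpath a Ha)) with (t := s) as [H _]; auto.
    eapply Rle_trans; [exact H|]. rewrite !G0 by assumption.
    rewrite Rpow_mult_distr, Rmult_comm. apply Rmult_le_compat_r; [apply pow2_ge_0|].
    unfold E. replace (exp (C * t) ^ 2) with (exp (2 * C * t)).
    - apply exp_le. nra.
    - replace (2 * C * t) with (INR 2 * (C * t)) by (simpl; ring). apply exp_INR_mult. }
  assert (Hwc : forall a, 0 <= a <= 1 -> continuity (w a)).
  { intros a Ha. exact (continuity_of_deriv _ _ (Hw a Ha)). }
  assert (HwE : forall a s, 0 <= a <= 1 -> 0 <= s <= t -> w a s <= E).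
  { intros a s Ha Hs.
    assert (H : w a s * exp (- (C * s)) <= w a 0 * exp (- (C * 0))).
    { apply (nonincreasing_of_deriv (fun s => w a s * exp (- (C * s)))
        (fun s => (- ux (Gam a s) s * w a s) * exp (- (C * s)) + w a s * (- C * exp (- (C * s))))); [|lra| |].
      - apply continuity_multR; [now apply Hwc|].
        intros r. apply derivable_continuous_pt. exists (- C * exp (- (C * r))).
        derive_by_ring.
      - intros r Hr. apply (derivable_pt_lim_mult (w a) (fun s => exp (- (C * s)))); [now apply Hw|].
        derive_by_ring.
      - intros r Hr. assert (Hb := HC (Gam a r) r (Hbox a r Ha ltac:(lra)) ltac:(lra)).
        apply Rabs_le_between in Hb. specialize (wp a r Ha). pose proof (exp_pos (- (C * r))).
        replace (- ux (Gam a r) r * w a r * exp (- (C * r)) + w a r * (- C * exp (- (C * r)))) with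
          (- ((ux (Gam a r) r + C) * (w a r * exp (- (C * r))))) by ring.
        assert (0 <= (ux (Gam a r) r + C) * (w a r * exp (- (C * r)))); [|lra].
        apply Rmult_le_pos; [lra|]. left. now apply Rmult_lt_0_compat. }
    rewrite w0, Rmult_0_r, Ropp_0, exp_0, Rmult_1_r in H by exact Ha.
    replace (w a s) with ((w a s * exp (- (C * s))) * exp (C * s)).
    - apply Rle_trans with (1 * exp (C * s)).
      + apply Rmult_le_compat_r; [left; apply exp_pos|exact H].
      + rewrite Rmult_1_l. apply exp_le. nra.
    - rewrite Rmult_assoc, <- exp_plus, Rplus_opp_l, exp_0. ring. }
  exists (E * K2 * E ^ 2 * t), E.
  split; [repeat apply Rmult_le_pos; try lra; apply pow2_ge_0|]. split; [lra|].
  intros a b Ha Hb. split.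
  { rewrite <- (Rabs_pos_eq E), <- Rabs_mult by lra. apply Rabs_le_of_sq; [apply Rabs_pos|].
    rewrite pow2_abs. apply Hgap; auto; lra. }
  set (F := fun s => (Gam b s - Gam a s) * w a s).
  assert (HF : Rabs (F t - F 0) <= (E * (K2 * (E * (b - a)) ^ 2)) * t).
  { apply (increment_bound F (fun s => (u (Gam b s) s - u (Gam a s) s) * w a s +
        (Gam b s - Gam a s) * (- ux (Gam a s) s * w a s))); [|exact Ht| |].
    - apply continuity_multR; [|now apply Hwc].
      apply continuity_minusR; now apply Hpath.
    - intros s Hs. apply (derivable_pt_lim_mult (fun s => Gam b s - Gam a s) (w a)); [|now apply Hw].
      apply derivable_pt_lim_minusR; apply Hpath; auto; lra.
    - intros s Hs. assert (Hs' : 0 <= s <= t) by lra.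
      replace ((u (Gam b s) s - u (Gam a s) s) * w a s + (Gam b s - Gam a s) * (- ux (Gam a s) s * w a s))
        with (w a s * (u (Gam b s) s - u (Gam a s) s - ux (Gam a s) s * (Gam b s - Gam a s))) by ring.
      rewrite Rabs_mult, (Rabs_pos_eq (w a s)) by (left; now apply wp).
      apply Rmult_le_compat; [left; now apply wp|apply Rabs_pos|now apply HwE|].
      apply Rle_trans with (K2 * (Gam b s - Gam a s) ^ 2).
      + apply (taylor2 (fun x => u x s) (fun x => ux x s) (fun x => uxx x s)); [intros; apply Hux|intros; apply Hxx|].
        intros x Hx. apply HK2; [|exact Hs'].
        pose proof (Hbox a s Ha Hs'). pose proof (Hbox b s Hb Hs').
        unfold Rmin, Rmax in Hx; destruct Rle_dec; lra.
      + apply Rmult_le_compat_l; [exact HK20|]. now apply Hgap. }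
  unfold F in HF at 2. rewrite w0, !G0, Rmult_1_r in HF by assumption.
  replace (E * K2 * E ^ 2 * t * (b - a) ^ 2) with ((E * (K2 * (E * (b - a)) ^ 2)) * t) by ring.
  exact HF.
Qed.

Lemma deriv_of_quadratic_bound (g : R -> R) a w K : 0 < a < 1 -> 0 < w -> 0 <= K ->
  (forall b, 0 <= b <= 1 -> Rabs ((g b - g a) * w - (b - a)) <= K * (b - a) ^ 2) ->
  derivable_pt_lim g a (/ w).
Proof.
  intros Ha Hw HK H eps He.
  assert (Hd : 0 < Rmin (Rmin a (1 - a)) (eps * w / (K + 1))).
  { repeat apply Rmin_pos; try lra. apply Rdiv_lt_0_compat; [now apply Rmult_lt_0_compat|lra]. }
  exists (mkposreal _ Hd). simpl. intros h Hh0 Hh.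
  pose proof (Rmin_l (Rmin a (1 - a)) (eps * w / (K + 1))).
  pose proof (Rmin_r (Rmin a (1 - a)) (eps * w / (K + 1))).
  pose proof (Rmin_l a (1 - a)). pose proof (Rmin_r a (1 - a)).
  assert (Hab : 0 <= a + h <= 1) by (assert (Hh1 := Hh); apply Rabs_def2 in Hh1; lra).
  specialize (H (a + h) Hab). replace (a + h - a) with h in H by ring.
  replace ((g (a + h) - g a) / h - / w) with (((g (a + h) - g a) * w - h) * / (h * w)) by (field; lra).
  rewrite Rabs_mult, Rabs_inv, Rabs_mult, (Rabs_pos_eq w) by lra.
  assert (Hhp : 0 < Rabs h) by now apply Rabs_pos_lt.
  apply Rle_lt_trans with (K * h ^ 2 * / (Rabs h * w)).
  - apply Rmult_le_compat_r; [left; apply Rinv_0_lt_compat; now apply Rmult_lt_0_compat|exact H].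
  - rewrite <- (pow2_abs h). replace (K * Rabs h ^ 2 * / (Rabs h * w)) with (K * Rabs h / w) by (field; lra).
    apply Rmult_lt_reg_r with w; [exact Hw|]. replace (K * Rabs h / w * w) with (K * Rabs h) by (field; lra).
    apply Rle_lt_trans with ((K + 1) * Rabs h); [nra|].
    replace (eps * w) with ((K + 1) * (eps * w / (K + 1))) by (field; lra).
    apply Rmult_lt_compat_l; lra.
Qed.

(** Rolle's theorem. The point serves twice: its reciprocal Jacobian is the reference solution
    [phi], and there [g = M0 > 0], which gives strict inequalities between the integrals. *)
Lemma zero_slope_point bc u0 du0 : admissible bc u0 -> (forall x, derivable_pt_lim u0 x (du0 x)) ->
  exists a, 0 <= a <= 1 /\ du0 a = 0.
Proof.
  intros Hadm Hd. destruct (mvt u0 du0 0 1 Hd) as [a [Ha E]].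
  rewrite Rmin_left, Rmax_right in Ha by lra. exists a. split; [exact Ha|].
  assert (H := admissible_endpoints bc u0 Hadm). lra.
Qed.

Lemma flow_path u gamma a : is_flow u gamma -> 0 <= a <= 1 -> path u (fun t => gamma a (Rmax 0 t)).
Proof.
  intros Hfl Ha. destruct (Hfl a Ha) as [H0 [Hr Hd]]. split.
  - apply (continuity_extend_left (gamma a) a); auto.
    intros t Ht. apply derivable_continuous_pt. exists (u (gamma a t) t). now apply Hd.
  - intros t Ht. rewrite Rmax_right by lra. apply is_derive_Reals.
    apply (is_derive_ext_loc (gamma a)).
    + exists (mkposreal t Ht). intros s Hs. change (Rabs (s - t) < t) in Hs. apply Rabs_def2 in Hs.
      rewrite Rmax_right by lra. reflexivity.
    + apply is_derive_Reals. now apply Hd.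
Qed.

(* With [omega_a = u_x o gamma_a], the equation reads [omega_a' = omega_a^2 + K(t)] with [K]
   independent of [a]; hence [w_a = exp (- int omega_a)] solve one linear equation
   [w'' = - K w], whose Wronskians are constant.  Here [phi = w_{a0}] with [u0'(a0) = 0]. *)
Lemma flow_formula bc u0 du0 u ux gamma :
  admissible bc u0 -> (forall x, derivable_pt_lim u0 x (du0 x)) ->
  is_global_solution bc u0 u ux -> is_flow u gamma ->
  exists phi eta om : R -> R, eta 0 = 0 /\ continuity eta /\
    (forall t, 0 < t -> derivable_pt_lim eta t (/ phi t ^ 2)) /\
    forall t, 0 <= t -> 0 < phi t /\ (forall a, 0 <= a <= 1 -> 0 < 1 - du0 a * eta t) /\
      phi t = RInt (fun a => / (1 - du0 a * eta t)) 0 1 /\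
      (forall a, 0 <= a <= 1 -> ux (gamma a t) t = om t + du0 a / (phi t ^ 2 * (1 - du0 a * eta t))) /\
      om t = - RInt (fun a => du0 a / (phi t ^ 3 * (1 - du0 a * eta t) ^ 2)) 0 1.
Proof.
  intros Hadm Hdu0 Hsol Hfl.
  destruct (equation_on_domain bc u0 u ux Hsol) as [uxx [uxt [Hxx [Hxt Heq]]]].
  destruct Hsol as [Su [Hux [_ [Hinit Hbc]]]].
  destruct (zero_slope_point bc u0 du0 Hadm Hdu0) as [a0 [Ha0 Ea0]].
  assert (Sux := smooth2_pdx _ _ Su Hux). assert (Sxx := smooth2_pdx _ _ Sux Hxx).
  assert (Cdu0 : continuity du0) by (apply smooth1_continuity, (smooth1_deriv u0); [apply Hadm|exact Hdu0]).
  set (Gam := fun a t => gamma a (Rmax 0 t)).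
  assert (Hpath : forall a, 0 <= a <= 1 -> path u (Gam a)) by (intros a Ha; now apply flow_path).
  assert (EG : forall a t, 0 <= t -> Gam a t = gamma a t) by (intros; unfold Gam; now rewrite Rmax_right).
  assert (G0 : forall a, 0 <= a <= 1 -> Gam a 0 = a) by (intros; rewrite EG by lra; now apply Hfl).
  assert (I0 : 0 <= 0 <= 1) by lra. assert (I1 : 0 <= 1 <= 1) by lra.
  (* By uniqueness of trajectories: under periodicity [Gam 0 + 1] is one that starts at 1, and under
     Dirichlet conditions the end points are stationary. *)
  assert (Hends : forall t, 0 <= t -> Gam 1 t - Gam 0 t = 1 /\ u (Gam 1 t) t = u (Gam 0 t) t /\
     forall a, 0 <= a <= 1 -> bc_domain bc (Gam a t)).
  { intros t Ht. destruct bc.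
    - assert (E : Gam 1 t = Gam 0 t + 1).
      { apply (path_unique u ux (Gam 1) (fun t => Gam 0 t + 1)); auto.
        - split.
          + apply continuity_plusR; [now apply Hpath|].
            apply continuity_cst.
          + intros s Hs. rewrite Hbc by lra. rewrite <- (Rplus_0_r (u _ _)).
            apply derivable_pt_lim_plusR; [now apply Hpath|apply derivable_pt_lim_const].
        - rewrite !G0 by lra. ring. }
      rewrite E. split; [ring|]. split; [now apply Hbc|]. intros; exact I.
    - assert (Hc : forall c, 0 <= c <= 1 -> (forall s, 0 <= s -> u c s = 0) -> Gam c t = c).
      { intros c Hc Hz. apply (path_unique u ux (Gam c) (fun _ => c)); auto. split.
        - apply continuity_cst.
        - intros s Hs. rewrite Hz by lra. apply derivable_pt_lim_const. }
      assert (E0 : Gam 0 t = 0) by (apply Hc; auto; intros s Hs; destruct (Hbc s Hs); assumption).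
      assert (E1 : Gam 1 t = 1) by (apply Hc; auto; intros s Hs; destruct (Hbc s Hs); assumption).
      destruct (Hbc t Ht) as [U0 U1].
      split; [rewrite E0, E1; ring|]. split; [rewrite E0, E1, U0, U1; reflexivity|].
      intros a Ha. simpl. rewrite <- E0, <- E1 at 1.
      split; apply (path_order u ux); auto; rewrite !G0 by lra; lra. }
  set (omg := fun a t => ux (Gam a t) t).
  assert (Comg : forall a, 0 <= a <= 1 -> continuity (omg a)).
  { intros a Ha. apply (continuity_along ux (Gam a)); [now apply smooth2_continuity|now apply Hpath]. }
  assert (Dom : forall t, 0 < t -> exists K, forall a, 0 <= a <= 1 ->
     derivable_pt_lim (omg a) t (omg a t * omg a t + K)).
  { intros t Ht. destruct (Heq t Ht) as [K HK]. exists K. intros a Ha.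
    specialize (HK (Gam a t)). destruct (Hends t) as [_ [_ Hdom]]; [lra|]. specialize (HK (Hdom a Ha)).
    replace (omg a t * omg a t + K) with (uxx (Gam a t) t * u (Gam a t) t + uxt (Gam a t) t)
      by (unfold omg; lra).
    apply (deriv_along ux uxx uxt (Gam a)); auto; [now apply smooth2_continuity|]. apply Hpath; auto. }
  set (w := fun a t => exp (- RInt (omg a) 0 t)).
  assert (wp : forall a t, 0 < w a t) by (intros; apply exp_pos).
  assert (w0 : forall a, w a 0 = 1).
  { intros a. unfold w. rewrite RInt_pointR. now rewrite Ropp_0, exp_0. }
  assert (Dw : forall a, 0 <= a <= 1 -> forall t, derivable_pt_lim (w a) t (- omg a t * w a t)).
  { intros a Ha t. rewrite Rmult_comm.
    apply (derivable_pt_lim_comp (fun t => - RInt (omg a) 0 t) exp); [|apply derivable_pt_lim_exp].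
    apply derivable_pt_lim_oppR.
    apply derivable_pt_lim_RInt. now apply Comg. }
  assert (Cw : forall a, 0 <= a <= 1 -> continuity (w a)).
  { intros a Ha. exact (continuity_of_deriv _ _ (Dw a Ha)). }
  set (phi := w a0).
  assert (phin : forall t, phi t <> 0) by (intros; apply Rgt_not_eq, wp).
  assert (Omg0 : forall a, 0 <= a <= 1 -> omg a 0 = du0 a).
  { intros a Ha. unfold omg. rewrite G0 by exact Ha.
    apply (deriv_eq_on_01 (fun x => u x 0) u0 _ _ a Ha Hinit); [apply Hux|apply Hdu0]. }
  (* The left side is the Wronskian [w_a' phi - w_a phi']; its value at time 0 is [- du0 a] because
     [du0 a0 = 0]. *)
  assert (Wr : forall a, 0 <= a <= 1 -> forall t, 0 <= t ->
     (w a t * phi t) * (omg a0 t - omg a t) = - du0 a).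
  { intros a Ha t Ht.
    rewrite (constant_of_deriv0 (fun t => (w a t * phi t) * (omg a0 t - omg a t))) with (t := t); [| | |exact Ht].
    - unfold phi. rewrite !w0, !Omg0, Ea0 by assumption. ring.
    - apply continuity_multR.
      + apply continuity_multR; now apply Cw.
      + apply continuity_minusR; now apply Comg.
    - intros s Hs. destruct (Dom s Hs) as [K HK].
      replace 0 with
        (((- omg a s * w a s) * phi s + w a s * (- omg a0 s * phi s)) * (omg a0 s - omg a s) +
         (w a s * phi s) * ((omg a0 s * omg a0 s + K) - (omg a s * omg a s + K))) by ring.
      apply (derivable_pt_lim_mult (fun t => w a t * phi t) (fun t => omg a0 t - omg a t)).
      + apply derivable_pt_lim_multR; now apply Dw.
      + apply derivable_pt_lim_minusR; now apply HK. }
  set (ip := fun t => / phi t ^ 2).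
  assert (Cip : continuity ip).
  { intros t. apply continuity_pt_Rinv; [|now apply pow_nonzero].
    apply (continuity_pt_ext (fun t => phi t * phi t)); [intros; ring|].
    apply continuity_pt_multR; now apply Cw. }
  set (eta := fun t : R => RInt ip 0 t : R).
  assert (eta0 : eta 0 = 0) by apply RInt_pointR.
  assert (Deta : forall t, derivable_pt_lim eta t (ip t))
    by (intros; now apply derivable_pt_lim_RInt).
  assert (Ceta : continuity eta) by exact (continuity_of_deriv _ _ Deta).
  assert (Ew : forall a, 0 <= a <= 1 -> forall t, 0 <= t -> w a t = phi t * (1 - du0 a * eta t)).
  { intros a Ha t Ht.
    (* The derivative of [w_a / phi] is the Wronskian over [phi^2], which is [- du0 a] times the
       derivative of [eta]. *)
    assert (H : w a t * / phi t + du0 a * eta t = w a 0 * / phi 0 + du0 a * eta 0).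
    { apply (constant_of_deriv0 (fun t => w a t * / phi t + du0 a * eta t)); [| |exact Ht].
      - apply continuity_plusR.
        + apply continuity_multR; [now apply Cw|].
          intros s. apply continuity_pt_Rinv; [now apply Cw|auto].
        + apply continuity_multR; [|exact Ceta]. apply continuity_cst.
      - intros s Hs.
        replace 0 with (((- omg a s * w a s) * / phi s + w a s * (- (- omg a0 s * phi s) / phi s ^ 2)) +
           (0 * eta s + du0 a * ip s)).
        + apply derivable_pt_lim_plusR.
          * apply (derivable_pt_lim_mult (w a) (fun t => / phi t)); [now apply Dw|].
            apply is_derive_Reals. apply (is_derive_inv phi); auto. apply is_derive_Reals. now apply Dw.
          * apply (derivable_pt_lim_mult (fun _ => du0 a) eta); [apply derivable_pt_lim_const|apply Deta].
        + unfold ip. assert (HW := Wr a Ha s ltac:(lra)).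
          replace (du0 a) with (- (w a s * phi s * (omg a0 s - omg a s))) by lra. field. auto. }
    unfold phi in H at 2. rewrite !w0, eta0 in H.
    assert (w a t * / phi t = 1 - du0 a * eta t) by lra. rewrite <- H0. field. auto. }
  exists phi, eta, (omg a0). split; [exact eta0|]. split; [exact Ceta|]. split; [intros; apply Deta|].
  intros t Ht. assert (phip : 0 < phi t) by apply wp. split; [exact phip|].
  assert (Hpos : forall a, 0 <= a <= 1 -> 0 < 1 - du0 a * eta t).
  { intros a Ha. specialize (Ew a Ha t Ht). specialize (wp a t). rewrite Ew in wp.
    apply Rmult_lt_reg_l with (phi t); [exact phip|]. lra. }
  split; [exact Hpos|].
  assert (Hom : forall a, 0 <= a <= 1 -> omg a t = omg a0 t + du0 a / (phi t ^ 2 * (1 - du0 a * eta t))).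
  { intros a Ha. assert (HW := Wr a Ha t Ht). rewrite (Ew a Ha t Ht) in HW. specialize (Hpos a Ha).
    replace (du0 a) with (- (phi t * (1 - du0 a * eta t) * phi t * (omg a0 t - omg a t))) at 1 by lra.
    field. lra. }
  destruct (flow_increment u ux Gam w t Su Hux Ht Hpath G0) as [K [L [HK [HL Hinc]]]].
  { intros a Ha s. now apply Dw. }
  { auto. }
  { auto. }
  assert (CG : continuity (fun a => Gam (clamp a) t)).
  { apply (continuity_of_lipschitz _ L). intros x y.
    destruct (Hinc (clamp y) (clamp x)) as [H _]; try apply clamp_range.
    eapply Rle_trans; [exact H|]. apply Rmult_le_compat_l; [exact HL|apply clamp_contraction]. }
  assert (DG : forall a, 0 < a < 1 -> derivable_pt_lim (fun a => Gam a t) a (/ (phi t * (1 - du0 a * eta t)))).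
  { intros a Ha. rewrite <- (Ew a) by lra.
    apply (deriv_of_quadratic_bound (fun a => Gam a t) a (w a t) K); auto.
    intros b Hb. apply Hinc; lra. }
  assert (Cd : forall a, continuity_pt (fun a => 1 - du0 a * eta t) a).
  { intros a. apply continuity_pt_minusR.
    - apply continuity_pt_cst.
    - apply continuity_pt_multR; [apply Cdu0|]. apply continuity_pt_cst. }
  assert (Ci : forall a, 0 <= a <= 1 -> continuity_pt (fun a => / (1 - du0 a * eta t)) a).
  { intros a Ha. apply continuity_pt_Rinv; [apply Cd|]. specialize (Hpos a Ha). lra. }
  assert (Cc : forall k a, continuity_pt (fun _ => k) a) by (intros; apply continuity_pt_cst).
  assert (Ck : forall k a, 0 <= a <= 1 -> continuity_pt (fun a => k * / (1 - du0 a * eta t)) a).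
  { intros k a Ha. apply continuity_pt_multR; auto. }
  assert (Cj : forall a, 0 <= a <= 1 -> continuity_pt (fun a => / (phi t * (1 - du0 a * eta t))) a).
  { intros a Ha. apply (continuity_pt_ext (fun a => / phi t * / (1 - du0 a * eta t))); [|now apply Ck].
    intros x. now rewrite Rinv_mult. }
  destruct (Hends t Ht) as [HG01 [HU01 _]].
  assert (E1 : RInt (fun a => / (phi t * (1 - du0 a * eta t))) 0 1 = 1).
  { transitivity (Gam 1 t - Gam 0 t); [|exact HG01]. symmetry. now apply (increment_of_interior_deriv (fun a => Gam a t)). }
  split.
  { rewrite (RInt_ext _ (fun a => / phi t * / (1 - du0 a * eta t))) in E1 by (intros; apply Rinv_mult).
    rewrite RInt_scalR in E1 by (apply ex_RInt_continuity_on; auto; lra).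
    apply Rmult_eq_reg_l with (/ phi t); [|now apply Rinv_neq_0_compat]. rewrite E1. field. auto. }
  split.
  { intros a Ha. rewrite <- (EG a t Ht). now apply Hom. }
  set (J := fun a => / (phi t * (1 - du0 a * eta t))) in *.
  assert (Cf : forall a, 0 <= a <= 1 -> continuity_pt (fun a => du0 a / (phi t ^ 3 * (1 - du0 a * eta t) ^ 2)) a).
  { intros a Ha.
    apply (continuity_pt_ext (fun a => du0 a * ((/ phi t ^ 3 * / (1 - du0 a * eta t)) * / (1 - du0 a * eta t)))).
    - intros x. unfold Rdiv. rewrite Rinv_mult. simpl. rewrite !Rinv_mult, Rinv_1. ring.
    - apply continuity_pt_multR; [apply Cdu0|].
      apply continuity_pt_multR; auto. }
  (* The integrand is the label derivative [u_x J] of [u] along the flow. Its total increment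
     vanishes by the boundary conditions, and since [J] has integral 1 this determines [om t]. *)
  assert (E2 : RInt (fun a => omg a0 t * J a + du0 a / (phi t ^ 3 * (1 - du0 a * eta t) ^ 2)) 0 1 = 0).
  { transitivity (u (Gam 1 t) t - u (Gam 0 t) t); [|rewrite HU01; exact (Rminus_diag _)]. symmetry.
    apply (increment_of_interior_deriv (fun a => u (Gam a t) t)).
    - intros x. apply (continuity_pt_comp (fun a => Gam (clamp a) t) (fun x => u x t)); [apply CG|].
      apply continuity2_1. now apply smooth2_continuity.
    - intros a Ha. assert (Ha' : 0 <= a <= 1) by lra.
      replace (omg a0 t * J a + du0 a / (phi t ^ 3 * (1 - du0 a * eta t) ^ 2)) with (ux (Gam a t) t * J a).
      + apply (derivable_pt_lim_comp (fun a => Gam a t) (fun x => u x t)); [now apply DG|apply Hux].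
      + change (ux (Gam a t) t) with (omg a t). rewrite (Hom a Ha'). unfold J. specialize (Hpos a Ha'). field. lra.
    - intros a Ha. apply continuity_pt_plusR; auto.
      apply continuity_pt_multR; auto. }
  rewrite RInt_plusR, RInt_scalR, E1 in E2.
  - lra.
  - apply ex_RInt_continuity_on; auto; lra.
  - apply (ex_RInt_scalR _ J). apply ex_RInt_continuity_on; auto; lra.
  - apply ex_RInt_continuity_on; auto; lra.
Qed.

(** * Asymptotics of the singular integrals *)

Definition lim0 (F : R -> R) (l : R) : Prop :=
  forall nu, 0 < nu -> exists d, 0 < d /\ forall s, 0 < s < d -> Rabs (F s - l) < nu.

Lemma lim0_filterlim F l : lim0 F l <-> filterlim F (at_right 0) (locally l).
Proof.
  split.
  - intros H P [[eps He] HP]. destruct (H eps He) as [d [Hd Hs]].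
    exists (mkposreal d Hd). intros s Hb Hs0. apply HP. apply Hs.
    change (Rabs (s - 0) < d) in Hb. apply Rabs_def2 in Hb. lra.
  - intros H nu Hnu. destruct (H (fun y => Rabs (y - l) < nu)) as [[d Hd] Hs].
    + exists (mkposreal nu Hnu). intros y Hy. exact Hy.
    + exists d. split; [exact Hd|]. intros s Hs0. apply (Hs s); [|lra].
      change (Rabs (s - 0) < d). rewrite Rabs_pos_eq; lra.
Qed.

Lemma lim0_ext F G l d : 0 < d -> (forall s, 0 < s < d -> F s = G s) -> lim0 F l -> lim0 G l.
Proof.
  intros Hd HFG H nu Hnu. destruct (H nu Hnu) as [d' [Hd' Hs]].
  exists (Rmin d d'). split; [now apply Rmin_pos|]. intros s Hs0.
  pose proof (Rmin_l d d'). pose proof (Rmin_r d d'). rewrite <- HFG by lra. apply Hs; lra.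
Qed.

Lemma lim0_const c : lim0 (fun _ => c) c.
Proof. intros nu Hnu. exists 1. split; [lra|]. intros. rewrite Rminus_diag, Rabs_R0. exact Hnu. Qed.

Lemma lim0_continuity F l g : lim0 F l -> continuity_pt g l -> lim0 (fun s => g (F s)) (g l).
Proof.
  intros HF Hg. apply lim0_filterlim. apply lim0_filterlim in HF.
  apply (filterlim_comp _ _ _ F g _ (locally l)); [exact HF|]. now apply continuity_pt_filterlim.
Qed.

Lemma lim0_plus F G l m : lim0 F l -> lim0 G m -> lim0 (fun s => F s + G s) (l + m).
Proof.
  intros HF HG. apply lim0_filterlim in HF, HG. apply lim0_filterlim.
  apply (filterlim_comp_2 F G Rplus HF HG). apply (filterlim_plus (V := R_NormedModule)).
Qed.

Lemma lim0_mult F G l m : lim0 F l -> lim0 G m -> lim0 (fun s => F s * G s) (l * m).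
Proof.
  intros HF HG. apply lim0_filterlim in HF, HG. apply lim0_filterlim.
  apply (filterlim_comp_2 F G Rmult HF HG). apply (filterlim_mult (K := R_AbsRing)).
Qed.

Lemma lim0_opp F l : lim0 F l -> lim0 (fun s => - F s) (- l).
Proof.
  intros H. apply (lim0_continuity F l Ropp H). apply continuity_pt_opp, derivable_continuous_pt, derivable_pt_id.
Qed.

Lemma lim0_inv F l : l <> 0 -> lim0 F l -> lim0 (fun s => / F s) (/ l).
Proof.
  intros Hl H. apply (lim0_continuity F l Rinv H).
  apply continuity_pt_Rinv; [apply derivable_continuous_pt, derivable_pt_id|exact Hl].
Qed.

Lemma lim0_id : lim0 (fun s => s) 0.
Proof.
  intros nu Hnu. exists nu. split; [exact Hnu|]. intros s Hs. rewrite Rminus_0_r, Rabs_pos_eq; lra.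
Qed.

(* Squeezing by [A * lam + B(lam) * s], where [lam] may be chosen first. *)
Lemma lim0_of_bound F A (B : R -> R) d : 0 < d -> 0 <= A ->
  (forall s lam, 0 < s < d -> 0 < lam -> Rabs (F s) <= A * lam + B lam * s) -> lim0 F 0.
Proof.
  intros Hd HA H nu Hnu. set (lam := nu / (4 * (A + 1))).
  assert (Hlam : 0 < lam) by (apply Rdiv_lt_0_compat; lra).
  set (b := Rabs (B lam) + 1). assert (Hb : 0 < b) by (unfold b; pose proof (Rabs_pos (B lam)); lra).
  exists (Rmin d (nu / (4 * b))). split; [apply Rmin_pos; [exact Hd|apply Rdiv_lt_0_compat; lra]|].
  intros s Hs. pose proof (Rmin_l d (nu / (4 * b))). pose proof (Rmin_r d (nu / (4 * b))).
  rewrite Rminus_0_r. eapply Rle_lt_trans; [apply (H s lam); lra|].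
  assert (A * lam <= nu / 4).
  { replace (nu / 4) with ((A + 1) * lam) by (unfold lam; field; lra). nra. }
  assert (B lam * s <= nu / 4).
  { apply Rle_trans with (b * (nu / (4 * b))); [|right; field; lra].
    apply Rle_trans with (b * s); [|apply Rmult_le_compat_l; lra].
    apply Rmult_le_compat_r; [lra|]. unfold b. pose proof (Rle_abs (B lam)). lra. }
  lra.
Qed.

(** A supremum argument in place of a finite subcover: the set of points reached from 0 contains its
    supremum by the left half of the local property, and would pass beyond it by the right half if
    it were below 1. *)
Lemma creeping_lemma (P : R -> R -> Prop) :
  (forall a b c, P a b -> P b c -> P a c) ->
  (forall x, 0 <= x <= 1 -> exists d, 0 < d /\ forall y, 0 <= y <= 1 ->
     (x <= y < x + d -> P x y) /\ (x - d < y <= x -> P y x)) -> P 0 1.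
Proof.
  intros Htr Hloc.
  assert (P00 : P 0 0).
  { destruct (Hloc 0) as [d [Hd H]]; [lra|]. destruct (H 0) as [H1 _]; [lra|]. apply H1; lra. }
  destruct (completeness (fun z => 0 <= z <= 1 /\ P 0 z)) as [s [Hub Hlub]].
  - exists 1. intros z [Hz _]. lra.
  - exists 0. split; [lra|exact P00].
  - assert (Hs0 : 0 <= s) by (apply Hub; split; [lra|exact P00]).
    assert (Hs1 : s <= 1) by (apply Hlub; intros z [Hz _]; lra).
    destruct (Hloc s) as [d [Hd H]]; [lra|].
    assert (Hz : exists z, (0 <= z <= 1 /\ P 0 z) /\ s - d < z).
    { apply NNPP. intros N. assert (s <= s - d); [|lra]. apply Hlub. intros z Hz.
      apply Rnot_lt_le. intros L. apply N. exists z. split; assumption. }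
    destruct Hz as [z [[Hz1 Hz2] Hz3]].
    assert (Hzs : z <= s) by (apply Hub; split; assumption).
    assert (P0s : P 0 s) by (apply (Htr 0 z s); [exact Hz2|apply H; lra]).
    destruct (Req_dec s 1) as [->|N]; [exact P0s|exfalso].
    set (y := Rmin (s + d / 2) 1).
    assert (Hy : s < y <= 1 /\ y < s + d).
    { unfold y. pose proof (Rmin_l (s + d/2) 1). pose proof (Rmin_r (s + d/2) 1).
      split; [split; [apply Rmin_glb_lt; lra|lra]|lra]. }
    assert (y <= s); [|lra]. apply Hub. split; [lra|].
    apply (Htr 0 s y); [exact P0s|]. apply H; lra.
Qed.

(** * The model integral and quadratic zeros *)

Lemma RInt_inv_quadratic s b z : 0 < s -> 0 < b ->
  RInt (fun h => / (s ^ 2 + b * h ^ 2)) 0 z = atan (sqrt b * z / s) / (s * sqrt b).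
Proof.
  intros Hs Hb. assert (Hq : 0 < sqrt b) by now apply sqrt_lt_R0.
  assert (Eb : sqrt b * sqrt b = b) by (apply sqrt_sqrt; lra).
  assert (Hp : forall h, 0 < s ^ 2 + b * h ^ 2) by (intros; nra).
  generalize dependent (sqrt b). intros r Hq Eb. subst b.
  rewrite (RInt_fundamental (fun h => atan (r * h / s) / (s * r))).
  - rewrite Rmult_0_r, Rdiv_0_l, atan_0. rewrite Rdiv_0_l. apply Rminus_0_r.
  - intros h. apply is_derive_Reals. auto_derive; [lra|].
    specialize (Hp h). field. repeat split; nra.
  - intros h. apply continuity_pt_Rinv; [|apply Rgt_not_eq, Hp].
    apply derivable_continuous_pt. eexists. apply is_derive_Reals. auto_derive; [exact I|reflexivity].
Qed.

Lemma RInt_inv_quadratic_le s b z : 0 < s -> 0 < b -> 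
  RInt (fun h => / (s ^ 2 + b * h ^ 2)) 0 z <= PI / 2 / (s * sqrt b).
Proof.
  intros Hs Hb. rewrite RInt_inv_quadratic by assumption.
  assert (Hq : 0 < sqrt b) by now apply sqrt_lt_R0.
  apply Rmult_le_compat_r; [left; apply Rinv_0_lt_compat; now apply Rmult_lt_0_compat|].
  left. apply atan_bound.
Qed.

(* [g = b h^2 + O(h^3)] in the [C^1] sense.  The errors are controlled by
   [int h/(s^2 + c h^2)], which is [o(1/s)] since [2 h <= lam + h^2/lam]; for the second limit,
   [(e - g)/(e + g)^2] is the derivative of [h/(e + g)] up to such an error. *)
Lemma quadratic_singularity g dg b K z : 0 < b -> 0 <= K -> 0 < z -> 
  (forall h, derivable_pt_lim g h (dg h)) -> continuity dg ->
  (forall h, 0 <= h <= z -> Rabs (g h - b * h ^ 2) <= K * h ^ 3) ->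
  (forall h, 0 <= h <= z -> Rabs (h * dg h - 2 * g h) <= K * h ^ 3) ->
  (forall h, 0 <= h <= z -> b / 2 * h ^ 2 <= g h) ->
  lim0 (fun s => s * RInt (fun h => / (s ^ 2 + g h)) 0 z) (PI / 2 / sqrt b) /\
  lim0 (fun s => s * RInt (fun h => (s ^ 2 - g h) / (s ^ 2 + g h) ^ 2) 0 z) 0.
Proof.
  intros Hb HK Hz Hg Hdg H1 H2 H3. set (c := b / 2). assert (Hc : 0 < c) by (unfold c; lra).
  assert (Cg : continuity g) by exact (continuity_of_deriv _ _ Hg).
  assert (Hp : forall s h, 0 < s -> 0 <= h <= z -> 0 < s ^ 2 + c * h ^ 2 /\ s ^ 2 + c * h ^ 2 <= s ^ 2 + g h).
  { intros s h Hs Hh. specialize (H3 h Hh). unfold c. split; [nra|lra]. }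
  assert (Cc : forall k x, continuity_pt (fun _ => k) x) by (intros; apply continuity_pt_cst).
  assert (Csg : forall s h, continuity_pt (fun h => s ^ 2 + g h) h).
  { intros s h. apply continuity_pt_plusR; auto. }
  assert (Cq : forall s b h, continuity_pt (fun h => s ^ 2 + b * h ^ 2) h).
  { intros s b' h. apply derivable_continuous_pt. eexists. apply is_derive_Reals. auto_derive; [exact I|reflexivity]. }
  assert (Ci : forall s, 0 < s -> forall h, 0 <= h <= z -> continuity_pt (fun h => / (s ^ 2 + g h)) h).
  { intros s Hs h Hh. apply continuity_pt_Rinv; [apply Csg|]. destruct (Hp s h Hs Hh). lra. }
  assert (Ciq : forall b' s, 0 < b' -> 0 < s -> forall h, continuity_pt (fun h => / (s ^ 2 + b' * h ^ 2)) h).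
  { intros b' s Hb' Hs h. apply continuity_pt_Rinv; [apply Cq|]. apply Rgt_not_eq. nra. }
  assert (Err : forall F, (forall s, 0 < s -> forall h, 0 <= h <= z -> continuity_pt (F s) h) ->
    (forall s h, 0 < s -> 0 <= h <= z -> Rabs (F s h) <= K * h ^ 3 / (s ^ 2 + c * h ^ 2) ^ 2) ->
    lim0 (fun s => s * RInt (F s) 0 z) 0).
  { intros F CF HF.
    apply (lim0_of_bound _ (K / c * (PI / 4 / sqrt c)) (fun lam => K / c * (z / (2 * lam * c))) 1); [lra| |].
    { assert (0 < sqrt c) by now apply sqrt_lt_R0.
      pose proof PI_RGT_0. apply Rmult_le_pos; apply Rmult_le_pos; try lra; left; apply Rinv_0_lt_compat; lra. }
    intros s lam Hs Hlam.
    assert (HB : Rabs (RInt (F s) 0 z) <= RInt (fun h => K / c * (lam / 2) * / (s ^ 2 + c * h ^ 2) + K / c * / (2 * lam * c)) 0 z).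
    { apply Rle_trans with (RInt (fun h => Rabs (F s h)) 0 z).
      { apply abs_RInt_le; [lra|]. apply ex_RInt_continuity_on; [lra|]. apply CF; lra. }
      apply RInt_le; [lra| | |].
      - apply ex_RInt_continuity_on; [lra|]. intros h Hh.
        apply (continuity_pt_comp (F s) Rabs); [apply CF; lra|apply Rcontinuity_abs].
      - apply ex_RInt_continuity_on; [lra|]. intros h Hh.
        apply continuity_pt_plusR; auto.
        apply continuity_pt_multR; auto. apply Ciq; lra.
      - intros h Hh. eapply Rle_trans; [apply HF; lra|].
        destruct (Hp s h) as [Hq _]; [lra|lra|]. remember (s ^ 2 + c * h ^ 2) as q eqn:Eq.
        assert (Hq2 : c * h ^ 2 <= q) by (rewrite Eq; nra).
        assert (Hh2 : 2 * h * lam <= lam ^ 2 + h ^ 2) by (pose proof (pow2_ge_0 (lam - h)); lra).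
        assert (Hh3 : h * / q <= (lam / 2) * / q + / (2 * lam * c)).
        { apply Rmult_le_reg_r with (2 * lam * c * q); [repeat apply Rmult_lt_0_compat; lra|].
          replace (h * / q * (2 * lam * c * q)) with (c * (2 * h * lam)) by (field; lra).
          replace ((lam / 2 * / q + / (2 * lam * c)) * (2 * lam * c * q)) with (c * lam ^ 2 + q) by (field; lra).
          nra. }
        apply Rle_trans with (K / c * (h * / q)).
        + apply Rmult_le_reg_r with (c * q ^ 2); [apply Rmult_lt_0_compat; [lra|nra]|].
          replace (K * h ^ 3 / q ^ 2 * (c * q ^ 2)) with ((K * h) * (c * h ^ 2)) by (field; lra).
          replace (K / c * (h * / q) * (c * q ^ 2)) with ((K * h) * q) by (field; lra).
          apply Rmult_le_compat_l; [nra|exact Hq2].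
        + replace (K / c * (lam / 2) * / q + K / c * / (2 * lam * c)) with
            (K / c * (lam / 2 * / q + / (2 * lam * c))) by ring.
          apply Rmult_le_compat_l; [now apply Rdiv_le_0_compat|exact Hh3]. }
    rewrite RInt_plusR, RInt_constR,
      (RInt_scalR _ (fun h => / (s ^ 2 + c * h ^ 2))) in HB.
    - pose proof (RInt_inv_quadratic_le s c z ltac:(lra) Hc) as Hat.
      rewrite Rabs_mult, (Rabs_pos_eq s) by lra.
      assert (HKc : 0 <= K / c * (lam / 2)).
      { apply Rmult_le_pos; [now apply Rdiv_le_0_compat|lra]. }
      apply (Rmult_le_compat_l _ _ _ HKc) in Hat.
      assert (Hq : 0 < sqrt c) by now apply sqrt_lt_R0.
      apply Rle_trans with (s * (K / c * (lam / 2) * (PI / 2 / (s * sqrt c)) + (z - 0) * (K / c * / (2 * lam * c)))).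
      + apply Rmult_le_compat_l; lra.
      + right. field. repeat split; lra.
    - apply ex_RInt_continuity_on; [lra|]. intros; apply Ciq; lra.
    - apply ex_RInt_scalR.
      apply ex_RInt_continuity_on; [lra|]. intros; apply Ciq; lra.
    - apply ex_RInt_constR. }
  assert (Hq : 0 < sqrt b) by now apply sqrt_lt_R0.
  split.
  - assert (L1 : lim0 (fun s => s * RInt (fun h => / (s ^ 2 + g h) - / (s ^ 2 + b * h ^ 2)) 0 z) 0).
    { apply (Err (fun s h => / (s ^ 2 + g h) - / (s ^ 2 + b * h ^ 2))).
      - intros s Hs h Hh.
        apply continuity_pt_minusR; auto.
      - intros s h Hs Hh. destruct (Hp s h Hs Hh) as [P1 P2]. specialize (H1 h Hh).
        assert (P3 : s ^ 2 + c * h ^ 2 <= s ^ 2 + b * h ^ 2) by (unfold c; nra).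
        replace (/ (s ^ 2 + g h) - / (s ^ 2 + b * h ^ 2)) with
          (- (g h - b * h ^ 2) * (/ ((s ^ 2 + g h) * (s ^ 2 + b * h ^ 2)))) by (field; lra).
        rewrite Rabs_mult, Rabs_Ropp, Rabs_inv, (Rabs_pos_eq (_ * _)) by (apply Rmult_le_pos; lra).
        apply Rmult_le_compat; [apply Rabs_pos|left; apply Rinv_0_lt_compat, Rmult_lt_0_compat; lra|exact H1|].
        apply Rinv_le_contravar; [nra|]. simpl. rewrite Rmult_1_r. apply Rmult_le_compat; simpl in *; lra. }
    (* The reflection [atan y = PI/2 - atan (/ y)] for positive [y] turns the limit at infinity into
       continuity at 0. *)
    assert (L2 : lim0 (fun s => / sqrt b * atan (sqrt b * z / s)) (PI / 2 / sqrt b)).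
    { replace (PI / 2 / sqrt b) with (/ sqrt b * (PI / 2 + - atan (0 * / (sqrt b * z)))).
      - apply lim0_mult; [apply lim0_const|].
        apply (lim0_ext (fun s => PI / 2 + - atan (s * / (sqrt b * z))) _ _ 1); [lra| |].
        + intros s Hs. replace (s * / (sqrt b * z)) with (/ (sqrt b * z / s)) by (field; lra).
          rewrite atan_inv; [ring|]. apply Rdiv_lt_0_compat; [now apply Rmult_lt_0_compat|lra].
        + apply lim0_plus; [apply lim0_const|]. apply lim0_opp.
          apply lim0_continuity.
          * apply lim0_mult; [apply lim0_id|apply lim0_const].
          * apply derivable_continuous_pt, derivable_pt_atan.
      - rewrite Rmult_0_l, atan_0. field. lra. }
    replace (PI / 2 / sqrt b) with (0 + PI / 2 / sqrt b) by ring.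
    apply (lim0_ext (fun s => s * RInt (fun h => / (s ^ 2 + g h) - / (s ^ 2 + b * h ^ 2)) 0 z + / sqrt b * atan (sqrt b * z / s)) _ _ 1); [lra| |now apply lim0_plus].
    intros s Hs. rewrite RInt_minusR, RInt_inv_quadratic by
      first [lra|apply ex_RInt_continuity_on; [lra|intros; first [apply Ci|apply Ciq]; lra]].
    field. lra.
  - assert (Cin : forall s, 0 < s -> forall h, 0 <= h <= z -> continuity_pt (fun h => / (s ^ 2 + g h) ^ 2) h).
    { intros s Hs h Hh. apply continuity_pt_Rinv.
      - apply (continuity_pt_ext (fun h => (s ^ 2 + g h) * (s ^ 2 + g h))); [intros; ring|].
        apply continuity_pt_multR; auto.
      - apply pow_nonzero. destruct (Hp s h Hs Hh). lra. }
    assert (CA : forall s, 0 < s -> forall h, 0 <= h <= z ->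
      continuity_pt (fun h => (h * dg h - 2 * g h) / (s ^ 2 + g h) ^ 2) h).
    { intros s Hs h Hh. apply continuity_pt_multR; auto.
      apply continuity_pt_minusR.
      - apply continuity_pt_multR; [apply derivable_continuous_pt, derivable_pt_id|apply Hdg].
      - apply continuity_pt_multR; auto. }
    assert (L1 : lim0 (fun s => s * RInt (fun h => (h * dg h - 2 * g h) / (s ^ 2 + g h) ^ 2) 0 z) 0).
    { apply (Err (fun s h => (h * dg h - 2 * g h) / (s ^ 2 + g h) ^ 2)).
      - exact CA.
      - intros s h Hs Hh. destruct (Hp s h Hs Hh) as [P1 P2]. specialize (H2 h Hh).
        unfold Rdiv. rewrite Rabs_mult, Rabs_inv, (Rabs_pos_eq (_ ^ 2)) by apply pow2_ge_0.
        apply Rmult_le_compat; [apply Rabs_pos| |exact H2|].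
        + left. apply Rinv_0_lt_compat, pow_lt. lra.
        + apply Rinv_le_contravar; [apply pow_lt; lra|]. apply pow_incr. lra. }
    assert (Hgz : 0 < g z).
    { apply Rlt_le_trans with (b / 2 * z ^ 2); [|apply H3; lra].
      apply Rmult_lt_0_compat; [lra|now apply pow_lt]. }
    (* The boundary term of the exact derivative stays bounded because [g z > 0], so the factor [s]
       removes it. *)
    assert (L2 : lim0 (fun s => s * (z * / (s * s + g z))) (0 * (z * / (0 * 0 + g z)))).
    { apply lim0_mult; [apply lim0_id|]. apply lim0_mult; [apply lim0_const|].
      apply lim0_inv; [lra|]. apply lim0_plus; [|apply lim0_const]. apply lim0_mult; apply lim0_id. }
    rewrite Rmult_0_l in L2. rewrite <- (Rplus_0_r 0) at 1.
    refine (lim0_ext _ _ _ 1 Rlt_0_1 _ (lim0_plus _ _ _ _ L2 L1)).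
    intros s Hs. rewrite <- Rmult_plus_distr_l. f_equal.
    assert (Hs0 : 0 < s) by lra.
    assert (CB : forall h, 0 <= h <= z -> continuity_pt (fun h => (s ^ 2 - g h) / (s ^ 2 + g h) ^ 2) h).
    { intros h Hh. apply continuity_pt_multR; auto.
      apply continuity_pt_minusR; auto. }
    assert (E : RInt (fun h => (s ^ 2 - g h) / (s ^ 2 + g h) ^ 2 - (h * dg h - 2 * g h) / (s ^ 2 + g h) ^ 2) 0 z = z * / (s * s + g z)).
    { apply is_RInt_unique.
      replace (z * / (s * s + g z)) with (minus (z * / (s ^ 2 + g z)) (0 * / (s ^ 2 + g 0)))
        by (rewrite Rmult_0_l; unfold minus, plus, opp; simpl; rewrite !Rmult_1_r; ring).
      apply (is_RInt_derive (V := R_CompleteNormedModule) (fun h => h * / (s ^ 2 + g h))).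
      - rewrite Rmin_left, Rmax_right by lra. intros h Hh. destruct (Hp s h Hs0 Hh) as [P1 P2].
        apply is_derive_Reals.
        replace ((s ^ 2 - g h) / (s ^ 2 + g h) ^ 2 - (h * dg h - 2 * g h) / (s ^ 2 + g h) ^ 2) with
          (1 * / (s ^ 2 + g h) + h * (- (0 + dg h) / (s ^ 2 + g h) ^ 2)) by (field; lra).
        apply (derivable_pt_lim_mult (fun h => h) (fun h => / (s ^ 2 + g h))); [apply derivable_pt_lim_id|].
        apply is_derive_Reals. apply (is_derive_inv (fun h => s ^ 2 + g h)); [|lra].
        apply is_derive_Reals. apply derivable_pt_lim_plusR; [apply derivable_pt_lim_const|apply Hg].
      - rewrite Rmin_left, Rmax_right by lra. intros h Hh. apply continuity_pt_filterlim.
        apply continuity_pt_minusR; auto. }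
    rewrite RInt_minusR in E by (apply ex_RInt_continuity_on; auto; lra).
    lra.
Qed.

Lemma RInt_shift (f : R -> R) x z : ex_RInt f x (x + z) -> RInt (fun h => f (x + h)) 0 z = RInt f x (x + z).
Proof.
  intros H. assert (E := RInt_comp_lin (V := R_CompleteNormedModule) f 1 x 0 z).
  replace (1 * 0 + x) with x in E by ring. replace (1 * z + x) with (x + z) in E by ring.
  rewrite <- (E H). apply RInt_ext. intros h _. unfold scal. simpl. unfold mult. simpl.
  rewrite Rmult_1_l. f_equal. ring.
Qed.

Lemma RInt_reflect (f : R -> R) x z : ex_RInt f (x - z) x -> RInt (fun h => f (x - h)) 0 z = RInt f (x - z) x.
Proof.
  intros H. assert (E := RInt_comp_lin (V := R_CompleteNormedModule) f (-1) x z 0).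
  replace (-1 * 0 + x) with x in E by ring. replace (-1 * z + x) with (x - z) in E by ring.
  specialize (E H). set (F := fun y : R => -1 * f (-1 * y + x)).
  change (RInt F z 0 = RInt f (x - z) x) in E.
  assert (Hex : ex_RInt F z 0).
  { apply (ex_RInt_comp_lin (V := R_NormedModule) f (-1) x z 0).
    replace (-1 * 0 + x) with x by ring. replace (-1 * z + x) with (x - z) by ring. exact H. }
  apply ex_RInt_swap in Hex.
  assert (E2 := opp_RInt_swap (V := R_CompleteNormedModule) F 0 z Hex).
  change (- RInt F 0 z = RInt F z 0) in E2. rewrite <- E, <- E2.
  rewrite (RInt_ext (fun h => f (x - h)) (fun h => -1 * F h)).
  - assert (Eneg : forall y, -1 * y = - y) by (intros; ring).
    exact (eq_trans (RInt_scalR (-1) F 0 z Hex) (Eneg _)).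
  - intros h _. unfold F. replace (-1 * h + x) with (x - h) by ring. simpl. ring.
Qed.

Lemma continuity_pt_half h a : continuity_pt h a -> 0 < h a ->
  exists d, 0 < d /\ forall x, Rabs (x - a) < d -> h a / 2 <= h x.
Proof.
  intros Hc Hha. destruct (Hc (h a / 2)) as [d [Hd H]]; [lra|]. exists d. split; [exact Hd|].
  intros x Hx. destruct (Req_dec x a) as [->|N]; [lra|].
  assert (K : Rabs (h x - h a) < h a / 2) by (apply H; split; [split; [exact I|auto]|exact Hx]).
  apply Rabs_def2 in K. lra.
Qed.

Lemma RInt_gt_0_at h a : (forall x, 0 <= x <= 1 -> continuity_pt h x) -> 
  (forall x, 0 <= x <= 1 -> 0 <= h x) -> 0 <= a <= 1 -> 0 < h a -> 0 < RInt h 0 1.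
Proof.
  intros Hc Hp Ha Hha.
  destruct (continuity_pt_half h a (Hc a Ha) Hha) as [d [Hd Hnear]].
  set (r := Rmin (d / 2) (1 / 2)).
  assert (Hr : 0 < r /\ r < d /\ r <= 1 / 2).
  { unfold r. pose proof (Rmin_l (d/2) (1/2)). pose proof (Rmin_r (d/2) (1/2)).
    split; [apply Rmin_pos; lra|lra]. }
  assert (0 < r * (h a / 2)) by (apply Rmult_lt_0_compat; lra).
  apply Rlt_le_trans with (r * (h a / 2)); [assumption|].
  destruct (Rle_lt_dec a (1/2)).
  - replace r with (a + r - a) by ring. apply RInt_lower_bound; auto; try lra.
    intros x Hx. apply Hnear. rewrite Rabs_pos_eq; lra.
  - replace r with (a - (a - r)) by ring. apply RInt_lower_bound; auto; try lra.
    intros x Hx. apply Hnear. rewrite Rabs_left1; lra.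
Qed.

(** * The two kernels and their scaled limits on the unit interval *)

Definition kernel1 (g : R -> R) (s x : R) : R := / (s ^ 2 + g x).
(** This is [2 s^2 kernel1^2 - kernel1]. That its integral is [o(1/s)] expresses
    [s^2 I2 / I1 -> 1/2] in a form additive over intervals. *)
Definition kernel2 (g : R -> R) (s x : R) : R := (s ^ 2 - g x) / (s ^ 2 + g x) ^ 2.

Lemma kernel1_continuity g s x : continuity g -> s ^ 2 + g x <> 0 -> continuity_pt (kernel1 g s) x.
Proof.
  intros Hg Hn. apply continuity_pt_Rinv; [|exact Hn].
  apply continuity_pt_plusR; [|apply Hg]. apply continuity_pt_cst.
Qed.

Lemma kernel2_continuity g s x : continuity g -> s ^ 2 + g x <> 0 -> continuity_pt (kernel2 g s) x.
Proof.
  intros Hg Hn. assert (H := kernel1_continuity g s x Hg Hn).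
  apply (continuity_pt_ext (fun x => (s ^ 2 - g x) * (kernel1 g s x * kernel1 g s x))).
  - intros y. unfold kernel2, kernel1, Rdiv. simpl. rewrite !Rinv_mult, Rinv_1. ring.
  - apply continuity_pt_multR.
    + apply continuity_pt_minusR; [|apply Hg]. apply continuity_pt_cst.
    + now apply continuity_pt_multR.
Qed.

(** The value of [C] is left open so that the property can be glued over adjacent intervals;
    positivity of the total is obtained separately. *)
Definition has_limits (g : R -> R) (a b : R) : Prop :=
  exists C, lim0 (fun s => s * RInt (kernel1 g s) a b) C /\ lim0 (fun s => s * RInt (kernel2 g s) a b) 0.

Section SingularIntegrals.

Context (g g1 g2 g3 : R -> R).
Context (Hg1 : forall x, derivable_pt_lim g x (g1 x)) (Hg2 : forall x, derivable_pt_lim g1 x (g2 x))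
        (Hg3 : forall x, derivable_pt_lim g2 x (g3 x)) (K : R) (HK : 0 <= K)
        (HK3 : forall x, -1 <= x <= 2 -> Rabs (g3 x) <= K) (Hg0 : forall x, 0 <= x <= 1 -> 0 <= g x).

Let Cg : continuity g.
Proof. exact (continuity_of_deriv _ _ Hg1). Qed.

Let Cg1 : continuity g1.
Proof. exact (continuity_of_deriv _ _ Hg2). Qed.

Lemma denominator_pos s x : 0 < s -> 0 <= x <= 1 -> 0 < s ^ 2 + g x.
Proof. intros Hs Hx. specialize (Hg0 x Hx). assert (0 < s ^ 2) by (apply pow_lt; lra). lra. Qed.

Lemma kernels_ex_RInt s a b : 0 < s -> 0 <= a -> a <= b -> b <= 1 ->
  ex_RInt (kernel1 g s) a b /\ ex_RInt (kernel2 g s) a b.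
Proof.
  intros Hs Ha Hab Hb. split; (apply ex_RInt_continuity_on; [exact Hab|]); intros x Hx;
    [apply kernel1_continuity|apply kernel2_continuity]; try exact Cg;
    apply Rgt_not_eq, denominator_pos; lra.
Qed.

Lemma has_limits_trans a b c : 0 <= a -> a <= b -> b <= c -> c <= 1 ->
  has_limits g a b -> has_limits g b c -> has_limits g a c.
Proof.
  intros Ha Hab Hbc Hc [C1 [A1 B1]] [C2 [A2 B2]]. exists (C1 + C2).
  assert (Ch : forall s, 0 < s -> forall k, ex_RInt k a b -> ex_RInt k b c ->
     s * RInt k a b + s * RInt k b c = s * RInt k a c).
  { intros s Hs k E1 E2. rewrite <- Rmult_plus_distr_l. f_equal.
    now apply RInt_ChaslesR. }
  split; [|rewrite <- (Rplus_0_r 0)].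
  - refine (lim0_ext _ _ _ 1 Rlt_0_1 _ (lim0_plus _ _ _ _ A1 A2)).
    intros s Hs. assert (Hs0 : 0 < s) by lra. apply (Ch s Hs0 (kernel1 g s)).
    + apply (kernels_ex_RInt s a b); lra.
    + apply (kernels_ex_RInt s b c); lra.
  - refine (lim0_ext _ _ _ 1 Rlt_0_1 _ (lim0_plus _ _ _ _ B1 B2)).
    intros s Hs. assert (Hs0 : 0 < s) by lra. apply (Ch s Hs0 (kernel2 g s)).
    + apply (kernels_ex_RInt s a b); lra.
    + apply (kernels_ex_RInt s b c); lra.
Qed.

(** Away from zeros both kernels are bounded by [/ m], and the factor [s] makes both limits 0. *)
Lemma has_limits_regular m a b : 0 < m -> 0 <= a -> a <= b -> b <= 1 ->
  (forall x, a <= x <= b -> m <= g x) -> has_limits g a b.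
Proof.
  intros Hm Ha Hab Hb Hgm. exists 0.
  assert (Hk : forall k, (forall s, 0 < s -> ex_RInt (k s) a b) ->
    (forall s x, 0 < s -> a <= x <= b -> Rabs (k s x) <= / (s ^ 2 + g x)) ->
    lim0 (fun s => s * RInt (k s) a b) 0).
  { intros k Hex Hk. apply (lim0_of_bound _ 0 (fun _ => / m) 1); [lra|lra|].
    intros s lam Hs Hlam. rewrite Rmult_0_l, Rplus_0_l, Rabs_mult, (Rabs_pos_eq s), Rmult_comm by lra.
    apply Rmult_le_compat_r; [lra|].
    apply Rle_trans with ((b - a) * / m).
    - apply abs_RInt_le_const; [exact Hab|apply Hex; lra|]. intros x Hx.
      eapply Rle_trans; [apply Hk; lra|]. apply Rinv_le_contravar; [exact Hm|].
      specialize (Hgm x Hx). assert (0 <= s ^ 2) by apply pow2_ge_0. lra.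
    - assert (0 < / m) by now apply Rinv_0_lt_compat. nra. }
  split; [apply (Hk (kernel1 g))|apply (Hk (kernel2 g))].
  - intros s Hs. apply (kernels_ex_RInt s a b); lra.
  - intros s x Hs Hx. unfold kernel1. right. apply Rabs_pos_eq. left.
    apply Rinv_0_lt_compat, denominator_pos; lra.
  - intros s Hs. apply (kernels_ex_RInt s a b); lra.
  - intros s x Hs Hx. unfold kernel2. assert (Hp := denominator_pos s x Hs ltac:(lra)).
    assert (Hg0x := Hg0 x ltac:(lra)). assert (0 < s ^ 2) by (apply pow_lt; lra).
    unfold Rdiv. rewrite Rabs_mult, (Rabs_pos_eq (/ _)) by (left; apply Rinv_0_lt_compat, pow_lt, Hp).
    apply Rmult_le_reg_r with ((s ^ 2 + g x) ^ 2); [apply pow_lt, Hp|].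
    replace (Rabs (s ^ 2 - g x) * / (s ^ 2 + g x) ^ 2 * (s ^ 2 + g x) ^ 2) with (Rabs (s ^ 2 - g x)) by (field; lra).
    replace (/ (s ^ 2 + g x) * (s ^ 2 + g x) ^ 2) with (s ^ 2 + g x) by (field; lra).
    apply Rabs_le. lra.
Qed.

(** Three integrations of the bound on [g3] give [g = b h^2 + O(h^3)] together with the matching
    estimate for [g1]; each side of [x] is then a case of [quadratic_singularity] after a shift or a
    reflection. *)
Lemma has_limits_near_zero x : 0 <= x <= 1 -> g x = 0 -> g1 x = 0 -> g2 x <> 0 ->
  exists d, 0 < d /\ forall y, 0 <= y <= 1 ->
     (x <= y < x + d -> has_limits g x y) /\ (x - d < y <= x -> has_limits g y x).
Proof.
  intros Hx Ex E1 N2. set (b := g2 x / 2).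
  assert (Q2 : forall y, Rabs (y - x) <= 1 -> Rabs (g2 y - g2 x) <= K * Rabs (y - x) ^ 1).
  { apply (pow_growth (fun y => g2 y - g2 x) g3 x 0 K 1); auto; [|ring|].
    - intros y. rewrite <- (Rminus_0_r (g3 y)).
      apply derivable_pt_lim_minusR; [apply Hg3|apply derivable_pt_lim_const].
    - intros y Hy. rewrite pow_O, Rmult_1_r. apply HK3. apply Rabs_le_between in Hy. lra. }
  assert (Q1 : forall y, Rabs (y - x) <= 1 -> Rabs (g1 y - 2 * b * (y - x)) <= K * Rabs (y - x) ^ 2).
  { apply (pow_growth (fun y => g1 y - 2 * b * (y - x)) (fun y => g2 y - g2 x) x 1 K 1); auto.
    - intros y. apply derivable_pt_lim_minusR; [apply Hg2|].
      apply is_derive_Reals. auto_derive; [exact I|unfold b; field].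
    - rewrite E1. ring. }
  assert (Q0 : forall y, Rabs (y - x) <= 1 -> Rabs (g y - b * (y - x) ^ 2) <= K * Rabs (y - x) ^ 3).
  { apply (pow_growth (fun y => g y - b * (y - x) ^ 2) (fun y => g1 y - 2 * b * (y - x)) x 2 K 1); auto.
    - intros y. apply derivable_pt_lim_minusR; [apply Hg1|].
      derive_by_ring.
    - rewrite Ex. ring. }
  (* If [b] were negative, [g] would be negative at a small distance [r] from [x], on whichever side
     stays within [[0,1]]. *)
  assert (Hb : 0 < b).
  { apply Rnot_le_lt. intros Hb0. assert (Hb : b < 0) by (unfold b in *; lra).
    set (r := Rmin (1 / 2) (- b / (2 * (K + 1)))).
    assert (Hr0 : 0 < r) by (apply Rmin_pos; [lra|apply Rdiv_lt_0_compat; lra]).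
    assert (Hr1 : r <= 1 / 2) by apply Rmin_l.
    assert (Hr2 : (K + 1) * r <= - b / 2).
    { replace (- b / 2) with ((K + 1) * (- b / (2 * (K + 1)))) by (field; lra).
      apply Rmult_le_compat_l; [lra|apply Rmin_r]. }
    assert (Hy : exists y, 0 <= y <= 1 /\ Rabs (y - x) = r).
    { destruct (Rle_lt_dec x (1/2)).
      - exists (x + r). split; [lra|]. rewrite Rabs_pos_eq; lra.
      - exists (x - r). split; [lra|]. rewrite Rabs_left1; lra. }
    destruct Hy as [y [Hy Hyr]]. specialize (Hg0 y Hy). specialize (Q0 y ltac:(lra)).
    rewrite <- pow2_abs, Hyr in Q0. apply Rabs_le_between in Q0.
    assert (0 < r ^ 2) by (apply pow_lt; lra).
    assert (K * r ^ 3 <= - b / 2 * r ^ 2).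
    { replace (K * r ^ 3) with ((K * r) * r ^ 2) by ring. apply Rmult_le_compat_r; lra. }
    nra. }
  (* Small enough that the cubic error is at most half of the quadratic term, so that
     [g >= b/2 h^2]. *)
  set (d := Rmin 1 (b / (2 * (K + 1)))).
  assert (Hd : 0 < d) by (apply Rmin_pos; [lra|apply Rdiv_lt_0_compat; lra]).
  assert (Hd1 : d <= 1) by apply Rmin_l.
  assert (Hd2 : K * d <= b / 2).
  { replace (b / 2) with ((K + 1) * (b / (2 * (K + 1)))) by (field; lra).
    assert (d <= b / (2 * (K + 1))) by apply Rmin_r. nra. }
  (* The sign [sg] selects the right or the left neighbourhood of [x]. *)
  assert (Core : forall sg z, sg * sg = 1 -> Rabs sg = 1 -> 0 < z < d ->
    lim0 (fun s => s * RInt (fun h => / (s ^ 2 + g (x + sg * h))) 0 z) (PI / 2 / sqrt b) /\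
    lim0 (fun s => s * RInt (fun h => (s ^ 2 - g (x + sg * h)) / (s ^ 2 + g (x + sg * h)) ^ 2) 0 z) 0).
  { intros sg z Hsg Hsa Hz.
    assert (Hdist : forall h, 0 <= h <= z -> Rabs (x + sg * h - x) = h).
    { intros h Hh. replace (x + sg * h - x) with (sg * h) by ring.
      rewrite Rabs_mult, Hsa, Rabs_pos_eq by lra. ring. }
    assert (Hsq : forall h, (x + sg * h - x) ^ 2 = h ^ 2).
    { intros h. replace ((x + sg * h - x) ^ 2) with (sg * sg * h ^ 2) by ring. rewrite Hsg. ring. }
    assert (B0 : forall h, 0 <= h <= z -> Rabs (g (x + sg * h) - b * h ^ 2) <= K * h ^ 3).
    { intros h Hh. rewrite <- Hsq. rewrite <- (Hdist h Hh) at 3. apply Q0. rewrite Hdist; lra. }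
    (* In [h g' - 2 g] the derivative contributes an error [K h^3] and twice the function [2 K h^3],
       hence [3 K]. *)
    apply (quadratic_singularity (fun h => g (x + sg * h)) (fun h => g1 (x + sg * h) * sg) b (3 * K) z); auto; try lra.
    - intros h. apply (derivable_pt_lim_comp (fun h => x + sg * h) g); [|apply Hg1].
      derive_by_ring.
    - intros h. apply continuity_pt_multR.
      + apply (continuity_pt_comp (fun h => x + sg * h) g1); [|apply Cg1].
        apply derivable_continuous_pt. eexists. apply is_derive_Reals. auto_derive; [exact I|reflexivity].
      + apply continuity_pt_cst.
    - intros h Hh. specialize (B0 h Hh). assert (0 <= h ^ 3) by (apply pow_le; lra). nra.
    - intros h Hh. specialize (B0 h Hh).
      assert (B1 := Q1 (x + sg * h)). rewrite Hdist in B1 by exact Hh. specialize (B1 ltac:(lra)).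
      replace (x + sg * h - x) with (sg * h) in B1 by ring.
      replace (h * (g1 (x + sg * h) * sg) - 2 * g (x + sg * h)) with
        (sg * h * (g1 (x + sg * h) - 2 * b * (sg * h)) + - (2 * (g (x + sg * h) - b * h ^ 2))
         + 2 * b * h ^ 2 * (sg * sg - 1)) by ring.
      rewrite Hsg, Rminus_diag, Rmult_0_r, Rplus_0_r.
      eapply Rle_trans; [apply Rabs_triang|]. rewrite Rabs_Ropp, !Rabs_mult, Hsa, (Rabs_pos_eq h), (Rabs_pos_eq 2) by lra.
      rewrite Rmult_1_l. assert (h * Rabs (g1 (x + sg * h) - 2 * b * (sg * h)) <= h * (K * h ^ 2)) by (apply Rmult_le_compat_l; lra).
      replace (h * (K * h ^ 2)) with (K * h ^ 3) in H by ring. lra.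
    - intros h Hh. specialize (B0 h Hh). apply Rabs_le_between in B0.
      assert (0 <= h ^ 2) by apply pow2_ge_0.
      assert (K * h <= b / 2) by nra.
      assert (K * h ^ 3 <= b / 2 * h ^ 2).
      { replace (K * h ^ 3) with (K * h * h ^ 2) by ring. apply Rmult_le_compat_r; lra. }
      lra. }
  assert (Triv : has_limits g x x).
  { exists 0. split; apply (lim0_ext (fun _ => 0) _ _ 1); try lra; try apply lim0_const; intros s _;
    rewrite (RInt_point (V := R_CompleteNormedModule)); symmetry; apply Rmult_0_r. }
  exists d. split; [exact Hd|]. intros y Hy. split; intros Hyx; (destruct (Req_dec x y) as [<-|N]; [exact Triv|]).
  - destruct (Core 1 (y - x)) as [L1 L2]; [ring|apply Rabs_R1|lra|].
    assert (Sh : forall f : R -> R, ex_RInt f x y -> RInt (fun h => f (x + 1 * h)) 0 (y - x) = RInt f x y).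
    { intros f E. replace y with (x + (y - x)) in E by ring.
      replace y with (x + (y - x)) at 2 by ring. rewrite <- (RInt_shift _ _ _ E).
      apply RInt_ext. intros h _. now rewrite Rmult_1_l. }
    exists (PI / 2 / sqrt b).
    split; [refine (lim0_ext _ _ _ 1 Rlt_0_1 _ L1)|refine (lim0_ext _ _ _ 1 Rlt_0_1 _ L2)]; intros s Hs; f_equal;
      destruct (kernels_ex_RInt s x y) as [F1 F2]; try lra; [exact (Sh _ F1)|exact (Sh _ F2)].
  - destruct (Core (-1) (x - y)) as [L1 L2]; [ring|rewrite Rabs_left; lra|lra|].
    assert (Sh : forall f : R -> R, ex_RInt f y x -> RInt (fun h => f (x + -1 * h)) 0 (x - y) = RInt f y x).
    { intros f E. replace y with (x - (x - y)) in E by ring.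
      replace y with (x - (x - y)) at 2 by ring. rewrite <- (RInt_reflect _ _ _ E).
      apply RInt_ext. intros h _. now replace (x + -1 * h) with (x - h) by ring. }
    exists (PI / 2 / sqrt b).
    split; [refine (lim0_ext _ _ _ 1 Rlt_0_1 _ L1)|refine (lim0_ext _ _ _ 1 Rlt_0_1 _ L2)]; intros s Hs; f_equal;
      destruct (kernels_ex_RInt s y x) as [F1 F2]; try lra; [exact (Sh _ F1)|exact (Sh _ F2)].
Qed.

Lemma has_limits_01 : (forall x, 0 <= x <= 1 -> g x = 0 -> g1 x = 0 /\ g2 x <> 0) -> has_limits g 0 1.
Proof.
  intros Hdeg.
  enough (H : 0 <= 0 /\ 0 <= 1 /\ 1 <= 1 /\ has_limits g 0 1) by apply H.
  (* The bounds on the end points are part of the relation because gluing integrals requires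
     them. *)
  apply (creeping_lemma (fun a b => 0 <= a /\ a <= b /\ b <= 1 /\ has_limits g a b)).
  - intros a b c [H1 [H2 [H3 H4]]] [H5 [H6 [H7 H8]]].
    split; [exact H1|]. split; [lra|]. split; [exact H7|]. now apply (has_limits_trans a b c).
  - intros x Hx. destruct (Req_dec (g x) 0) as [E|N].
    + destruct (Hdeg x Hx E) as [E1 N2].
      destruct (has_limits_near_zero x Hx E E1 N2) as [d [Hd H]].
      exists d. split; [exact Hd|]. intros y Hy. destruct (H y Hy) as [HA HB].
      split; intros Hxy; (split; [lra|]); (split; [lra|]); (split; [lra|]); auto.
    + assert (Hgx : 0 < g x) by (specialize (Hg0 x Hx); lra).
      destruct (continuity_pt_half g x (Cg x) Hgx) as [d [Hd Hnear]].
      exists d. split; [exact Hd|]. intros y Hy.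
      split; intros Hxy; (split; [lra|]); (split; [lra|]); (split; [lra|]);
        (apply (has_limits_regular (g x / 2)); try lra); intros z Hz; apply Hnear; apply Rabs_def1; lra.
Qed.

End SingularIntegrals.

(** * The Lagrangian form of the velocity gradient *)

Definition mass1 (g : R -> R) (s : R) : R := RInt (kernel1 g s) 0 1.
Definition mass2 (g : R -> R) (s : R) : R := RInt (fun x => / (s ^ 2 + g x) ^ 2) 0 1.
Definition gradient_profile (g : R -> R) (s a : R) : R :=
  / mass1 g s ^ 2 * (/ (s ^ 2 + g a) - mass2 g s / mass1 g s).

Section Profile.

Context (g : R -> R) (Cg : continuity g) (Hg0 : forall x, 0 <= x <= 1 -> 0 <= g x).

Let Dp := denominator_pos g Hg0.

Lemma kernel1_continuity_01 s x : 0 < s -> 0 <= x <= 1 -> continuity_pt (kernel1 g s) x.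
Proof. intros Hs Hx. apply kernel1_continuity; [exact Cg|]. now apply Rgt_not_eq, Dp. Qed.

Lemma kernel1_ex_RInt s : 0 < s -> ex_RInt (kernel1 g s) 0 1.
Proof. intros Hs. apply ex_RInt_continuity_on; [lra|]. intros; now apply kernel1_continuity_01. Qed.

Lemma kernel1_sq_continuity s x : 0 < s -> 0 <= x <= 1 -> continuity_pt (fun x => / (s ^ 2 + g x) ^ 2) x.
Proof.
  intros Hs Hx. assert (H := kernel1_continuity_01 s x Hs Hx).
  apply (continuity_pt_ext (fun x => kernel1 g s x * kernel1 g s x)).
  - intros y. unfold kernel1. simpl. rewrite !Rinv_mult, Rinv_1. ring.
  - now apply continuity_pt_multR.
Qed.

Lemma kernel1_sq_ex_RInt s : 0 < s -> ex_RInt (fun x => / (s ^ 2 + g x) ^ 2) 0 1.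
Proof. intros Hs. apply ex_RInt_continuity_on; [lra|]. intros; now apply kernel1_sq_continuity. Qed.

Lemma mass1_pos s : 0 < s -> 0 < mass1 g s.
Proof.
  intros Hs. apply RInt_gt_0; [lra| |].
  - intros x Hx. apply Rinv_0_lt_compat, Dp; lra.
  - intros x Hx. now apply continuity_pt_filterlim, kernel1_continuity_01.
Qed.

Lemma mass2_pos s : 0 < s -> 0 < mass2 g s.
Proof.
  intros Hs. apply RInt_gt_0; [lra| |].
  - intros x Hx. apply Rinv_0_lt_compat, pow_lt, Dp; lra.
  - intros x Hx. now apply continuity_pt_filterlim, kernel1_sq_continuity.
Qed.

(** The difference of the integrands is [g / (s^2 + g)^2], nonnegative on [[0,1]] and positive at
    [a]. *)
Lemma mass2_lt s a : 0 < s -> 0 <= a <= 1 -> 0 < g a -> s ^ 2 * mass2 g s < mass1 g s.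
Proof.
  intros Hs Ha Hga.
  assert (H : 0 < RInt (fun x => kernel1 g s x - s ^ 2 * / (s ^ 2 + g x) ^ 2) 0 1).
  { assert (E : forall x, 0 <= x <= 1 -> kernel1 g s x - s ^ 2 * / (s ^ 2 + g x) ^ 2 = g x * / (s ^ 2 + g x) ^ 2).
    { intros x Hx. unfold kernel1. specialize (Dp s x Hs Hx). field. lra. }
    apply (RInt_gt_0_at _ a); [| |exact Ha|].
    - intros x Hx. apply continuity_pt_minusR.
      + now apply kernel1_continuity_01.
      + apply continuity_pt_multR.
        * apply continuity_pt_cst.
        * now apply kernel1_sq_continuity.
    - intros x Hx. rewrite E by exact Hx. apply Rmult_le_pos; [now apply Hg0|].
      left. now apply Rinv_0_lt_compat, pow_lt, Dp.
    - rewrite E by exact Ha. apply Rmult_lt_0_compat; [exact Hga|]. now apply Rinv_0_lt_compat, pow_lt, Dp. }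
  rewrite RInt_minusR, RInt_scalR in H.
  - unfold mass1, mass2. lra.
  - now apply kernel1_sq_ex_RInt.
  - now apply kernel1_ex_RInt.
  - apply ex_RInt_scalR. now apply kernel1_sq_ex_RInt.
Qed.

Lemma mass2_kernel2 s : 0 < s -> s ^ 2 * mass2 g s = mass1 g s / 2 + RInt (kernel2 g s) 0 1 / 2.
Proof.
  intros Hs.
  assert (E2 : ex_RInt (kernel2 g s) 0 1).
  { apply ex_RInt_continuity_on; [lra|]. intros x Hx. apply kernel2_continuity; [exact Cg|]. now apply Rgt_not_eq, Dp. }
  assert (E1 := kernel1_ex_RInt s Hs).
  unfold mass2. rewrite <- (RInt_scalR (s ^ 2)) by now apply kernel1_sq_ex_RInt.
  rewrite (RInt_ext_01 _ (fun x => / 2 * (kernel1 g s x + kernel2 g s x))).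
  - rewrite RInt_scalR, RInt_plusR by
      (try assumption; now apply (ex_RInt_plus (V := R_NormedModule) (kernel1 g s))).
    unfold mass1. field.
  - intros x Hx. unfold kernel1, kernel2.
    assert (H := Dp s x Hs ltac:(lra)). simpl. simpl in H. field. lra.
Qed.

(** Both terms of the bracket lie between 0 and [/ s^2], the second one by [mass2_lt], hence so does
    the absolute value of their difference. *)
Lemma gradient_profile_bound s a a0 : 0 < s -> 0 <= a <= 1 -> 0 <= a0 <= 1 -> 0 < g a0 ->
  Rabs (gradient_profile g s a) <= / (s * mass1 g s) ^ 2.
Proof.
  intros Hs Ha Ha0 Hg. unfold gradient_profile.
  assert (Hm := mass1_pos s Hs). assert (Hm2 := mass2_pos s Hs). assert (Hlt := mass2_lt s a0 Hs Ha0 Hg).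
  assert (Hs2 : 0 < s ^ 2) by now apply pow_lt.
  assert (Hgs := Hg0 a Ha).
  rewrite Rabs_mult, (Rabs_pos_eq (/ mass1 g s ^ 2)) by (left; now apply Rinv_0_lt_compat, pow_lt).
  replace (/ (s * mass1 g s) ^ 2) with (/ mass1 g s ^ 2 * / s ^ 2) by (field; lra).
  apply Rmult_le_compat_l; [left; now apply Rinv_0_lt_compat, pow_lt|].
  assert (H1 : 0 < / (s ^ 2 + g a)) by (apply Rinv_0_lt_compat; lra).
  assert (H2 : / (s ^ 2 + g a) <= / s ^ 2) by (apply Rinv_le_contravar; lra).
  assert (H3 : 0 < mass2 g s / mass1 g s) by now apply Rdiv_lt_0_compat.
  assert (H4 : mass2 g s / mass1 g s <= / s ^ 2).
  { apply Rmult_le_reg_r with (s ^ 2 * mass1 g s); [now apply Rmult_lt_0_compat|].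
    replace (mass2 g s / mass1 g s * (s ^ 2 * mass1 g s)) with (s ^ 2 * mass2 g s) by (field; lra).
    replace (/ s ^ 2 * (s ^ 2 * mass1 g s)) with (mass1 g s) by (field; lra). lra. }
  apply Rabs_le. lra.
Qed.

Lemma gradient_profile_pos s a a0 : 0 < s -> g a = 0 -> 0 <= a0 <= 1 -> 0 < g a0 ->
  0 < gradient_profile g s a.
Proof.
  intros Hs Ha Ha0 Hg. unfold gradient_profile. rewrite Ha, Rplus_0_r.
  assert (Hm := mass1_pos s Hs). assert (Hlt := mass2_lt s a0 Hs Ha0 Hg).
  assert (Hs2 : 0 < s ^ 2) by now apply pow_lt.
  apply Rmult_lt_0_compat; [now apply Rinv_0_lt_compat, pow_lt|].
  replace (/ s ^ 2 - mass2 g s / mass1 g s) with ((mass1 g s - s ^ 2 * mass2 g s) / (s ^ 2 * mass1 g s)) by (field; lra).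
  apply Rdiv_lt_0_compat; [lra|now apply Rmult_lt_0_compat].
Qed.

Lemma gradient_profile_max s a b : 0 < s -> 0 <= b <= 1 -> g a = 0 ->
  gradient_profile g s b <= gradient_profile g s a.
Proof.
  intros Hs Hb Ha. unfold gradient_profile. rewrite Ha, Rplus_0_r.
  assert (Hm := mass1_pos s Hs). assert (Hs2 : 0 < s ^ 2) by now apply pow_lt. assert (Hgb := Hg0 b Hb).
  apply Rmult_le_compat_l; [left; now apply Rinv_0_lt_compat, pow_lt|].
  assert (/ (s ^ 2 + g b) <= / s ^ 2) by (apply Rinv_le_contravar; lra). lra.
Qed.

(** Rewrite the profile as [(s I1)^(-2) (s^2 / (s^2 + g a) - s^2 I2 / I1)]. The prefactor tends to
    [/ C^2], the first term to 1 or 0 according as [g a] vanishes or not, and the second to [1/2] by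
    [mass2_kernel2]. *)
Lemma gradient_profile_limit C a : 0 < C ->
  lim0 (fun s => s * mass1 g s) C -> lim0 (fun s => s * RInt (kernel2 g s) 0 1) 0 -> 0 <= a <= 1 ->
  lim0 (fun s => gradient_profile g s a) ((if Req_dec_T (g a) 0 then 1 else -1) / (2 * C ^ 2)).
Proof.
  intros HC L1 L2 Ha.
  set (U := fun s => s * mass1 g s). set (V := fun s => s * RInt (kernel2 g s) 0 1).
  assert (Li : lim0 (fun s => / U s) (/ C)) by (apply lim0_inv; [lra|exact L1]).
  assert (Lh : lim0 (fun s => - (/ 2 + / 2 * (V s * / U s))) (- (/ 2 + / 2 * (0 * / C)))).
  { apply lim0_opp, lim0_plus; [apply lim0_const|]. apply lim0_mult; [apply lim0_const|]. now apply lim0_mult. }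
  assert (Lg : lim0 (fun s => s * s * / (s * s + g a)) (if Req_dec_T (g a) 0 then 1 else 0)).
  { destruct Req_dec_T as [E|N].
    - apply (lim0_ext (fun _ => 1) _ _ 1); [lra| |apply lim0_const].
      intros s Hs. rewrite E. field. lra.
    - replace 0 with (0 * 0 * / (0 * 0 + g a)) by ring.
      assert (Lss : lim0 (fun s => s * s) (0 * 0)) by (apply lim0_mult; apply lim0_id).
      apply lim0_mult; [exact Lss|]. apply lim0_inv; [lra|]. apply lim0_plus; [exact Lss|apply lim0_const]. }
  replace ((if Req_dec_T (g a) 0 then 1 else -1) / (2 * C ^ 2)) with
    (/ C * / C * ((if Req_dec_T (g a) 0 then 1 else 0) + - (/ 2 + / 2 * (0 * / C))))
    by (destruct Req_dec_T; field; lra).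
  refine (lim0_ext _ _ _ 1 Rlt_0_1 _ (lim0_mult _ _ _ _ (lim0_mult _ _ _ _ Li Li) (lim0_plus _ _ _ _ Lg Lh))).
  intros s Hs. assert (Hs0 : 0 < s) by lra. unfold gradient_profile, U, V.
  assert (Hm := mass1_pos s Hs0). assert (Hd := Dp s a Hs0 Ha). assert (E := mass2_kernel2 s Hs0).
  replace (mass2 g s) with ((mass1 g s / 2 + RInt (kernel2 g s) 0 1 / 2) / s ^ 2)
    by (rewrite <- E; field; lra).
  simpl in *. rewrite Rmult_1_r in *. field. repeat split; lra.
Qed.

Lemma mass1_lower_bound a K p r s : 0 <= a <= 1 -> 0 <= K -> 0 < s -> 0 < r <= 1 / 2 -> K * r ^ p <= s ^ 2 ->
  (forall x, 0 <= x <= 1 -> g x <= K * Rabs (x - a) ^ p) -> r / (2 * s ^ 2) <= mass1 g s.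
Proof.
  intros Ha HK Hs Hr Hre Hg.
  apply (RInt_inv_lower_bound (fun x => s ^ 2 + g x) a K p (s ^ 2) r); auto.
  - now apply pow_lt.
  - intros x _. apply continuity_pt_plusR; [|apply Cg]. apply continuity_pt_cst.
  - intros x Hx. specialize (Hg x Hx). lra.
Qed.

End Profile.

(** * The profile along an arbitrary global solution *)

(** Positivity of [1 - f eta] at the maximum point keeps [eta] below [/ M] for all time. That [eta]
    comes arbitrarily close to [/ M] follows since otherwise it would grow at least linearly. *)
Lemma blowup_parameter_limit phi eta f M a : 0 < M -> 0 <= a <= 1 -> f a = M ->
  (forall x, 0 <= x <= 1 -> f x <= M) -> continuity f -> eta 0 = 0 -> continuity eta ->
  (forall t, 0 < t -> derivable_pt_lim eta t (/ phi t ^ 2)) ->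
  (forall t, 0 <= t -> 0 < phi t) ->
  (forall t, 0 <= t -> forall x, 0 <= x <= 1 -> 0 < 1 - f x * eta t) ->
  (forall t, 0 <= t -> phi t = RInt (fun x => / (1 - f x * eta t)) 0 1) ->
  (forall t, 0 < t -> 0 < eta t /\ 0 < / eta t - M) /\
  forall d, 0 < d -> exists T, forall t, T <= t -> 0 < t /\ / eta t - M < d.
Proof.
  intros HM Ha Ea Hf Cf E0 Ce De Hphi Hpos Ephi.
  assert (Inc : forall s t, 0 <= s -> s < t -> eta s < eta t).
  { intros s t Hs Hst. destruct (mvt_open eta (fun t => / phi t ^ 2) s t Hst) as [c [Hc E]].
    - intros x Hx. apply De; lra.
    - intros x _. apply Ce.
    - assert (0 < / phi c ^ 2) by (apply Rinv_0_lt_compat, pow_lt, Hphi; lra). nra. }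
  assert (Hep : forall t, 0 < t -> 0 < eta t) by (intros t Ht; rewrite <- E0; apply Inc; lra).
  assert (Hlt : forall t, 0 <= t -> 0 < 1 - M * eta t) by (intros t Ht; rewrite <- Ea; now apply Hpos).
  split.
  { intros t Ht. specialize (Hep t Ht). split; [exact Hep|]. specialize (Hlt t ltac:(lra)).
    replace (/ eta t - M) with ((1 - M * eta t) / eta t) by (field; lra). now apply Rdiv_lt_0_compat. }
  (* [phi <= 1/(1 - M eta)], so [eta' >= d^2] as long as [1 - M eta >= d], which cannot last. *)
  assert (Small : forall d t, 0 < d -> 0 < t -> / (M * d ^ 2) <= t -> 1 - M * eta t < d).
  { intros d t Hd Ht HT. apply Rnot_le_lt. intros C.
    destruct (mvt_open eta (fun t => / phi t ^ 2) 0 t Ht) as [c [Hc E]].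
    - intros x Hx. apply De; lra.
    - intros x _. apply Ce.
    - assert (Hc0 : 0 <= c) by lra. assert (Hcd : d <= 1 - M * eta c).
      { assert (eta c < eta t) by (apply Inc; lra). nra. }
      assert (Hec := Hep c ltac:(lra)).
      assert (Hphic : phi c <= / d).
      { rewrite (Ephi c Hc0).
        apply Rle_trans with (RInt (fun _ => / d) 0 1); [|rewrite RInt_constR; lra].
        apply RInt_le; [lra| |apply ex_RInt_constR|].
        - apply ex_RInt_continuity_on; [lra|]. intros x Hx. apply continuity_pt_Rinv.
          + apply continuity_pt_minusR.
            * apply continuity_pt_cst.
            * apply continuity_pt_multR; [apply Cf|]. apply continuity_pt_cst.
          + specialize (Hpos c Hc0 x Hx). lra.
        - intros x Hx. apply Rinv_le_contravar; [exact Hd|]. specialize (Hf x ltac:(lra)). nra. }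
      assert (Hpc := Hphi c Hc0).
      assert (Hd2 : d ^ 2 <= / phi c ^ 2).
      { replace (d ^ 2) with (/ (/ d) ^ 2) by (field; lra).
        apply Rinv_le_contravar; [now apply pow_lt|]. apply pow_incr. lra. }
      rewrite E0, !Rminus_0_r in E. specialize (Hlt t ltac:(lra)).
      assert (d ^ 2 * t <= eta t) by (rewrite E; apply Rmult_le_compat_r; lra).
      assert (0 < M * d ^ 2) by (apply Rmult_lt_0_compat; [lra|now apply pow_lt]).
      assert (1 <= M * d ^ 2 * t).
      { replace 1 with (M * d ^ 2 * / (M * d ^ 2)) by (field; lra). apply Rmult_le_compat_l; lra. }
      nra. }
  (* Passing from [1 - M eta] to [/ eta - M] divides by [eta t], which exceeds [eta 1] from time 2
     on; the factor [eta 1] in [d'] compensates. *)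
  intros d Hd. assert (He1 := Hep 1 Rlt_0_1). set (d' := d * eta 1).
  assert (Hd' : 0 < d') by now apply Rmult_lt_0_compat.
  exists (Rmax 2 (/ (M * d' ^ 2))). intros t Ht.
  assert (Ht2 : 2 <= t) by (eapply Rle_trans; [apply Rmax_l|exact Ht]).
  assert (HtT : / (M * d' ^ 2) <= t) by (eapply Rle_trans; [apply Rmax_r|exact Ht]).
  split; [lra|]. assert (Hs := Small d' t Hd' ltac:(lra) HtT).
  assert (He : eta 1 < eta t) by (apply Inc; lra).
  apply Rmult_lt_reg_r with (eta t); [lra|].
  replace ((/ eta t - M) * eta t) with (1 - M * eta t) by (field; lra).
  unfold d' in Hs. nra.
Qed.

(** With [s^2 = / eta - M] one has [1 - u0' eta = eta (s^2 + g)] and [phi = I1 / eta]. Writing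
    [u0' = / eta - (s^2 + g)], the two occurrences of [eta / I1^2], one from [om] and one from the
    label term, cancel. *)
Lemma lagrangian_form bc u0 du0 u ux gamma M a :
  admissible bc u0 -> (forall x, derivable_pt_lim u0 x (du0 x)) -> 0 < M ->
  (forall x, 0 <= x <= 1 -> du0 x <= M) -> 0 <= a <= 1 -> du0 a = M ->
  is_global_solution bc u0 u ux -> is_flow u gamma ->
  exists s : R -> R, (forall t, 0 < t -> 0 < s t) /\
    (forall d, 0 < d -> exists T, forall t, T <= t -> 0 < t /\ s t < d) /\
    forall t x, 0 < t -> 0 <= x <= 1 ->
      ux (gamma x t) t = gradient_profile (fun y => M - du0 y) (s t) x.
Proof.
  intros Hadm Hdu0 HM Hmax Ha Ea Hsol Hfl.
  assert (Cf : continuity du0) by (apply smooth1_continuity, (smooth1_deriv u0); [apply Hadm|exact Hdu0]).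
  destruct (flow_formula bc u0 du0 u ux gamma Hadm Hdu0 Hsol Hfl) as [phi [eta [om [E0 [Ce [De Hall]]]]]].
  destruct (blowup_parameter_limit phi eta du0 M a HM Ha Ea Hmax Cf E0 Ce De) as [He Hlim];
    try (intros t Ht; now apply Hall).
  set (g := fun y => M - du0 y).
  assert (Cg : continuity g).
  { apply continuity_minusR; [|exact Cf]. apply continuity_cst. }
  assert (Hg0 : forall x, 0 <= x <= 1 -> 0 <= g x) by (intros x Hx; unfold g; specialize (Hmax x Hx); lra).
  exists (fun t => sqrt (/ eta t - M)). split; [|split].
  - intros t Ht. apply sqrt_lt_R0, He, Ht.
  - intros d Hd. destruct (Hlim (d ^ 2)) as [T HT]; [now apply pow_lt|]. exists T. intros t Ht.
    destruct (HT t Ht) as [Ht0 Hlt]. split; [exact Ht0|].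
    rewrite <- (sqrt_pow2 d) by lra. apply sqrt_lt_1_alt. destruct (He t Ht0). lra.
  - intros t x Ht Hx. destruct (Hall t) as [Hphi [Hpos [Ephi [Eux Eom]]]]; [lra|].
    destruct (He t Ht) as [Het Hent]. set (s := sqrt (/ eta t - M)).
    assert (Hs : 0 < s) by now apply sqrt_lt_R0.
    assert (Es : s ^ 2 = / eta t - M) by (apply pow2_sqrt; lra).
    assert (Eden : forall y, 1 - du0 y * eta t = eta t * (s ^ 2 + g y))
      by (intros y; rewrite Es; unfold g; field; lra).
    assert (Hm := mass1_pos g Cg Hg0 s Hs).
    assert (Ephi' : phi t = mass1 g s / eta t).
    { rewrite Ephi, (RInt_ext _ (fun y => / eta t * kernel1 g s y)).
      - rewrite RInt_scalR by now apply kernel1_ex_RInt.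
        unfold Rdiv. now rewrite Rmult_comm.
      - intros y _. unfold kernel1. rewrite Eden. apply Rinv_mult. }
    assert (Eom' : om t = eta t / mass1 g s ^ 2 - mass2 g s / mass1 g s ^ 3).
    { rewrite Eom, (RInt_ext_01 _ (fun y => / (phi t ^ 3 * eta t ^ 2) * (/ eta t * / (s ^ 2 + g y) ^ 2 - kernel1 g s y))).
      - rewrite RInt_scalR, RInt_minusR,
          (RInt_scalR (/ eta t) (fun y => / (s ^ 2 + g y) ^ 2)).
        + fold (mass1 g s). fold (mass2 g s). rewrite Ephi'. field. lra.
        + now apply kernel1_sq_ex_RInt.
        + apply ex_RInt_scalR. now apply kernel1_sq_ex_RInt.
        + now apply kernel1_ex_RInt.
        + apply (ex_RInt_minus (V := R_NormedModule) (fun y => / eta t * / (s ^ 2 + g y) ^ 2)); [|now apply kernel1_ex_RInt].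
          apply ex_RInt_scalR. now apply kernel1_sq_ex_RInt.
      - intros y Hy. unfold kernel1. rewrite Eden.
        assert (Hd := denominator_pos g Hg0 s y Hs ltac:(lra)).
        assert (Edu : du0 y = / eta t - (s ^ 2 + g y)) by (rewrite Es; unfold g; ring).
        rewrite Edu. remember (s ^ 2 + g y) as D eqn:ED. clear ED. simpl. field. lra. }
    rewrite Eux by exact Hx. rewrite Eden, Eom', Ephi'. unfold gradient_profile.
    assert (Hd := denominator_pos g Hg0 s x Hs Hx).
    assert (Edu : du0 x = / eta t - (s ^ 2 + g x)) by (rewrite Es; unfold g; ring).
    rewrite Edu. remember (s ^ 2 + g x) as D eqn:ED. clear ED. field. lra.
Qed.

(** * Orders of vanishing and the resulting limits *)

Lemma deriv_n_at_2 u0 f f1 a v : (forall x, derivable_pt_lim u0 x (f x)) ->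
  (forall x, derivable_pt_lim f x (f1 x)) -> deriv_n_at u0 2 a v -> f1 a = v.
Proof.
  intros H0 H1 [h [Hh <-]]. apply (nth_deriv_peel 1 u0 f) in Hh; [|exact H0].
  apply (nth_deriv_peel 0 f f1) in Hh; [|exact H1]. symmetry. apply Hh.
Qed.

Lemma deriv_n_at_3 u0 f f1 f2 a v : (forall x, derivable_pt_lim u0 x (f x)) ->
  (forall x, derivable_pt_lim f x (f1 x)) -> (forall x, derivable_pt_lim f1 x (f2 x)) ->
  deriv_n_at u0 3 a v -> f2 a = v.
Proof.
  intros H0 H1 H2 [h [Hh <-]]. apply (nth_deriv_peel 2 u0 f) in Hh; [|exact H0].
  apply (deriv_n_at_2 f f1 f2 a (h a) H1 H2). now exists h.
Qed.

Lemma lim_infty_of_lim0 F l s : lim0 F l ->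
  (forall t, 0 < t -> 0 < s t) -> (forall d, 0 < d -> exists T, forall t, T <= t -> 0 < t /\ s t < d) ->
  forall f, (forall t, 0 < t -> f t = F (s t)) -> lim_infty f l.
Proof.
  intros HF Hs Hlim f Hf eps He. destruct (HF eps He) as [d [Hd H]].
  destruct (Hlim d Hd) as [T HT]. exists T. intros t Ht. destruct (HT t Ht) as [Ht0 Hst].
  rewrite Hf by exact Ht0. apply H. split; [now apply Hs|exact Hst].
Qed.

Section Degenerate.

Context (g g1 g2 g3 : R -> R).
Context (Hg1 : forall x, derivable_pt_lim g x (g1 x)) (Hg2 : forall x, derivable_pt_lim g1 x (g2 x))
        (Hg3 : forall x, derivable_pt_lim g2 x (g3 x)) (K : R) (HK : 0 <= K)
        (HK3 : forall x, -1 <= x <= 2 -> Rabs (g3 x) <= K) (Hg0 : forall x, 0 <= x <= 1 -> 0 <= g x)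
        (a a0 : R) (Ha : 0 <= a <= 1) (Ega : g a = 0) (Ha0 : 0 <= a0 <= 1) (Hga0 : 0 < g a0).

Let Cg : continuity g.
Proof. exact (continuity_of_deriv _ _ Hg1). Qed.

Lemma nondegenerate_profile_limit :
  (forall x, 0 <= x <= 1 -> g x = 0 -> g1 x = 0 /\ g2 x <> 0) ->
  exists C, 0 < C /\ forall x, 0 <= x <= 1 ->
    lim0 (fun s => gradient_profile g s x) ((if Req_dec_T (g x) 0 then 1 else -1) / (2 * C ^ 2)).
Proof.
  intros Hdeg. destruct (has_limits_01 g g1 g2 g3 Hg1 Hg2 Hg3 K HK HK3 Hg0 Hdeg) as [C [L1 L2]].
  (* Positivity needs the reverse inequality: [g] is at most quadratic near its zero [a], which
     bounds [s I1] away from 0. *)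
  assert (HC : 0 < C).
  { destruct (Hdeg a Ha Ega) as [E1 _].
    assert (HB : exists B, 0 <= B /\ forall x, -1 <= x <= 2 -> Rabs (g2 x) <= B).
    { destruct (rectangle_bound (fun x _ => g2 x) (-1) 2 0 0) as [B [HB0 HB]].
      - apply continuity2_iff. intros. apply continuity_1d_2d_pt_comp; [|apply continuity_2d_pt_id1].
        apply (continuity_of_deriv _ _ Hg3).
      - exists B. split; [exact HB0|]. intros x Hx. apply (HB x 0); lra. }
    destruct HB as [B [HB0 HB]].
    assert (Q1 : forall x, Rabs (x - a) <= 1 -> Rabs (g1 x) <= B * Rabs (x - a) ^ 1).
    { apply (pow_growth g1 g2 a 0 B 1); auto. intros x Hx. rewrite pow_O, Rmult_1_r. apply HB.
      apply Rabs_le_between in Hx. lra. }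
    assert (Q0 := pow_growth g g1 a 1 B 1 Hg1 Ega HB0 Q1).
    (* On the width [s / k], at most [1/2], the quadratic bound stays below [s^2]; this yields
       [s I1 >= / (2 k)]. *)
    set (k := 2 * (B + 1)).
    assert (Hk : 2 <= k) by (unfold k; lra).
    assert (HU : forall s, 0 < s < 1 -> / (2 * k) <= s * mass1 g s).
    { intros s Hs.
      assert (Hm : s / k / (2 * s ^ 2) <= mass1 g s).
      { apply (mass1_lower_bound g Cg Hg0 a B 2 (s / k) s); auto; [lra| | |].
        - split; [apply Rdiv_lt_0_compat; lra|]. apply Rmult_le_reg_r with k; [lra|].
          replace (s / k * k) with s by (field; lra). lra.
        - replace (B * (s / k) ^ 2) with (B / (k * k) * s ^ 2) by (field; lra).
          assert (B / (k * k) <= 1).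
          { apply Rmult_le_reg_r with (k * k); [nra|].
            replace (B / (k * k) * (k * k)) with B by (field; lra). unfold k. nra. }
          assert (0 <= s ^ 2) by apply pow2_ge_0. nra.
        - intros x Hx. specialize (Q0 x). pose proof (Rle_abs (g x)).
          assert (Rabs (x - a) <= 1) by (apply Rabs_le; lra). specialize (Q0 H0). lra. }
      replace (/ (2 * k)) with (s * (s / k / (2 * s ^ 2))) by (field; lra).
      apply Rmult_le_compat_l; lra. }
    assert (0 < / (2 * k)) by (apply Rinv_0_lt_compat; lra).
    apply Rlt_le_trans with (/ (2 * k)); [assumption|]. apply Rnot_lt_le. intros Hlt.
    destruct (L1 (/ (2 * k) - C)) as [d [Hd Hs]]; [lra|].
    assert (Hmin : 0 < Rmin (d / 2) (1 / 2)) by (apply Rmin_pos; lra).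
    pose proof (Rmin_l (d/2) (1/2)). pose proof (Rmin_r (d/2) (1/2)).
    specialize (Hs (Rmin (d / 2) (1 / 2)) ltac:(lra)). specialize (HU (Rmin (d / 2) (1 / 2)) ltac:(lra)).
    unfold mass1 in HU. apply Rabs_def2 in Hs. lra. }
  exists C. split; [exact HC|]. intros x Hx. now apply gradient_profile_limit.
Qed.

Lemma flat_profile_limit : g1 a = 0 -> g2 a = 0 -> forall x, 0 <= x <= 1 ->
  lim0 (fun s => gradient_profile g s x) 0.
Proof.
  intros E1 E2 x Hx.
  assert (Q2 : forall y, Rabs (y - a) <= 1 -> Rabs (g2 y) <= K * Rabs (y - a) ^ 1).
  { apply (pow_growth g2 g3 a 0 K 1); auto. intros y Hy. rewrite pow_O, Rmult_1_r. apply HK3.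
    apply Rabs_le_between in Hy. lra. }
  assert (Q1 := pow_growth g1 g2 a 1 K 1 Hg2 E1 HK Q2).
  assert (Q0 := pow_growth g g1 a 2 K 1 Hg1 Ega HK Q1).
  intros nu Hnu.
  (* A cubic zero keeps [g <= s^2] on the width [lam s] for every fixed [lam] once [s] is small. *)
  set (lam := 4 / nu + 4).
  assert (Hlam : 4 <= lam) by (unfold lam; assert (0 < 4 / nu) by (apply Rdiv_lt_0_compat; lra); lra).
  (* The final estimate is [/ (lam / 2)^2]; it is below [nu] because [lam nu > 4] and [lam >= 4]. *)
  assert (Hlam2 : 4 / lam ^ 2 < nu).
  { assert (4 / nu * nu = 4) by (field; lra).
    apply Rmult_lt_reg_r with (lam ^ 2); [apply pow_lt; lra|].
    replace (4 / lam ^ 2 * lam ^ 2) with 4 by (field; lra).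
    assert (4 < lam * nu) by (unfold lam; nra). nra. }
  assert (Hl3 : 0 < lam ^ 3) by (apply pow_lt; lra).
  (* The first entry keeps the width [lam s] below [1/2], the second gives [K (lam s)^3 <= s^2]. *)
  set (d := Rmin (/ (2 * lam)) (/ (K * lam ^ 3 + 1))).
  assert (HKl : 0 <= K * lam ^ 3) by (apply Rmult_le_pos; lra).
  exists d. split.
  { apply Rmin_pos; apply Rinv_0_lt_compat; lra. }
  intros s Hs. assert (Hs1 : s < / (2 * lam)) by (eapply Rlt_le_trans; [apply Hs|apply Rmin_l]).
  assert (Hs2 : s < / (K * lam ^ 3 + 1)) by (eapply Rlt_le_trans; [apply Hs|apply Rmin_r]).
  assert (Hs0 : 0 < s) by lra.
  rewrite Rminus_0_r. eapply Rle_lt_trans; [apply (gradient_profile_bound g Cg Hg0 s x a0); auto|].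
  apply Rle_lt_trans with (4 / lam ^ 2); [|exact Hlam2].
  assert (Hm : lam * s / (2 * s ^ 2) <= mass1 g s).
  { apply (mass1_lower_bound g Cg Hg0 a K 3 (lam * s) s); auto.
    - split; [nra|]. apply Rmult_lt_compat_l with (r := lam) in Hs1; [|lra].
      replace (lam * / (2 * lam)) with (1 / 2) in Hs1 by (field; lra). lra.
    - apply Rmult_lt_compat_l with (r := K * lam ^ 3 + 1) in Hs2; [|lra].
      rewrite Rinv_r in Hs2 by lra.
      replace (K * (lam * s) ^ 3) with ((K * lam ^ 3 * s) * s ^ 2) by ring.
      assert (0 <= s ^ 2) by apply pow2_ge_0. nra.
    - intros y Hy. pose proof (Rle_abs (g y)).
      assert (Rabs (y - a) <= 1) by (apply Rabs_le; lra). specialize (Q0 y H0). lra. }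
  assert (HU : lam / 2 <= s * mass1 g s).
  { replace (lam / 2) with (s * (lam * s / (2 * s ^ 2))) by (field; lra). apply Rmult_le_compat_l; lra. }
  replace (4 / lam ^ 2) with (/ (lam / 2) ^ 2) by (field; lra).
  apply Rinv_le_contravar; [apply pow_lt; lra|]. apply pow_incr. lra.
Qed.

End Degenerate.

Theorem theorem3p2 (bc : BC) (u0 du0 : R -> R) (alphas : list R) (M0 : R) :
  admissible bc u0 ->
  (forall x, derivable_pt_lim u0 x (du0 x)) ->
  0 < M0 ->
  (forall x, 0 <= x <= 1 -> du0 x <= M0) ->
  NoDup alphas -> alphas <> nil ->
  (forall a, (0 <= a <= 1 /\ du0 a = M0) <-> In a alphas) ->
  ((exists a, In a alphas /\ deriv_n_at u0 2 a 0) ->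
     exists u ux, is_global_solution bc u0 u ux) /\
  (forall k : nat, (1 <= k)%nat ->
     (forall a, In a alphas -> deriv_zero_of_order u0 2 k a) ->
     (exists u ux, is_global_solution bc u0 u ux) /\
     (forall u ux gamma, is_global_solution bc u0 u ux -> is_flow u gamma ->
        (k = 1%nat ->
           forall a, 0 <= a <= 1 -> exists L,
             lim_infty (fun t => ux (gamma a t) t) L /\
             (In a alphas -> 0 < L) /\ (~ In a alphas -> L < 0)) /\
        ((1 < k)%nat ->
           (forall a, 0 <= a <= 1 -> lim_infty (fun t => ux (gamma a t) t) 0) /\
           exists M : R -> R,
             (forall t, 0 <= t ->
                is_lub (fun y => exists a, 0 <= a <= 1 /\ y = ux (gamma a t) t) (M t)
                /\ 0 < M t) /\
             lim_infty M 0))).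
Proof.
  intros Hadm Hdu0 HM Hmax _ Hne Halpha.
  assert (Sf : smooth1 du0) by (apply (smooth1_deriv u0); [apply Hadm|exact Hdu0]).
  destruct (smooth1_ex_deriv du0 Sf) as [f1 [Hf1 Sf1]].
  destruct (smooth1_ex_deriv f1 Sf1) as [f2 [Hf2 Sf2]].
  destruct (smooth1_ex_deriv f2 Sf2) as [f3 [Hf3 Sf3]].
  assert (Part1 : (exists a, In a alphas /\ deriv_n_at u0 2 a 0) -> exists u ux, is_global_solution bc u0 u ux).
  { intros [a [Hin Hz]]. apply Halpha in Hin. destruct Hin as [Ha Ea].
    apply (deriv_n_at_2 u0 du0 f1) in Hz; auto.
    apply (global_existence bc u0 du0 M0 a); auto. rewrite <- Hz. apply Hf1. }
  split; [exact Part1|]. intros k Hk Hord.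
  assert (Hal : exists al, In al alphas).
  { destruct alphas as [|al l]; [now elim Hne|]. exists al. now left. }
  destruct Hal as [al Hal]. destruct (proj2 (Halpha al) Hal) as [Hal1 Hal2].
  (* A zero of order [k] of [u0''] is one of order [k + 1] of [g = M0 - u0']: index 0 is admissible
     since [k >= 1], and [k = 1] is the case of quadratic zeros. *)
  assert (Hord2 : forall a, In a alphas -> f1 a = 0).
  { intros a Hin. destruct (Hord a Hin) as [Hz _]. specialize (Hz 0%nat ltac:(lia)).
    rewrite Nat.add_0_r in Hz. now apply (deriv_n_at_2 u0 du0 f1). }
  split.
  { apply Part1. exists al. split; [exact Hal|].
    destruct (Hord al Hal) as [Hz _]. specialize (Hz 0%nat ltac:(lia)). now rewrite Nat.add_0_r in Hz. }
  intros u ux gamma Hsol Hfl.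
  destruct (lagrangian_form bc u0 du0 u ux gamma M0 al Hadm Hdu0 HM Hmax Hal1 Hal2 Hsol Hfl)
    as [s [Hs [Hslim Hform]]].
  set (g := fun y => M0 - du0 y) in *.
  assert (Hneg : forall (h dh : R -> R) c, (forall x, derivable_pt_lim h x (dh x)) ->
     forall x, derivable_pt_lim (fun y => c - h y) x (- dh x)).
  { intros h dh c Hh x. replace (- dh x) with (0 - dh x) by ring.
    apply derivable_pt_lim_minusR; [apply derivable_pt_lim_const|apply Hh]. }
  assert (Hopp : forall h dh : R -> R, (forall x, derivable_pt_lim h x (dh x)) ->
     forall x, derivable_pt_lim (fun y => - h y) x (- dh x)).
  { intros h dh Hh x. now apply derivable_pt_lim_oppR. }
  assert (Hg1 := Hneg du0 f1 M0 Hf1). fold g in Hg1.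
  assert (Hg2 := Hopp f1 f2 Hf2). assert (Hg3 := Hopp f2 f3 Hf3).
  destruct (smooth1_bounded f3 (-1) 2 Sf3) as [K [HK HK3]].
  assert (HK3' : forall x, -1 <= x <= 2 -> Rabs (- f3 x) <= K) by (intros; rewrite Rabs_Ropp; auto).
  assert (Hg0 : forall x, 0 <= x <= 1 -> 0 <= g x) by (intros x Hx; unfold g; specialize (Hmax x Hx); lra).
  assert (Hgal : g al = 0) by (unfold g; lra).
  destruct (zero_slope_point bc u0 du0 Hadm Hdu0) as [a0 [Ha0 Ea0]].
  assert (Hga0 : 0 < g a0) by (unfold g; lra).
  assert (Cg : continuity g) by exact (continuity_of_deriv _ _ Hg1).
  split.
  - intros -> a Ha.
    destruct (nondegenerate_profile_limit g _ _ _ Hg1 Hg2 Hg3 K HK HK3' Hg0 al Hal1 Hgal) as [C [HC HL]].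
    { intros x Hx Ex. assert (Hin : In x alphas) by (apply Halpha; split; [exact Hx|unfold g in Ex; lra]).
      split; [rewrite Hord2 by exact Hin; ring|].
      destruct (Hord x Hin) as [_ [v [Hv Hv0]]]. apply (deriv_n_at_3 u0 du0 f1 f2) in Hv; auto. lra. }
    exists ((if Req_dec_T (g a) 0 then 1 else -1) / (2 * C ^ 2)). split; [|split].
    + apply (lim_infty_of_lim0 _ _ s (HL a Ha) Hs Hslim). intros t Ht. now apply Hform.
    + intros Hin. apply Halpha in Hin. destruct Req_dec_T as [E|N]; [|unfold g in N; lra].
      apply Rdiv_lt_0_compat; [lra|]. assert (0 < C ^ 2) by now apply pow_lt. lra.
    + intros Hnin. destruct Req_dec_T as [E|N].
      * exfalso. apply Hnin, Halpha. split; [exact Ha|unfold g in E; lra].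
      * assert (0 < / (2 * C ^ 2)) by (apply Rinv_0_lt_compat; assert (0 < C ^ 2) by (now apply pow_lt); lra).
        unfold Rdiv. lra.
  - intros Hk1.
    (* For [k > 1] index 1 is admissible as well, so [g] vanishes at [al] at least to third
       order. *)
    assert (Hf2al : f2 al = 0).
    { destruct (Hord al Hal) as [Hz _]. specialize (Hz 1%nat Hk1). now apply (deriv_n_at_3 u0 du0 f1 f2). }
    assert (Z1 : - f1 al = 0) by (rewrite Hord2 by exact Hal; ring).
    assert (Z2 : - f2 al = 0) by (rewrite Hf2al; ring).
    assert (HL : forall a, 0 <= a <= 1 -> lim_infty (fun t => ux (gamma a t) t) 0).
    { intros a Ha.
      assert (L := flat_profile_limit g _ _ _ Hg1 Hg2 Hg3 K HK HK3' Hg0 al a0 Hal1 Hgal Ha0 Hga0 Z1 Z2 a Ha).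
      apply (lim_infty_of_lim0 _ _ s L Hs Hslim). intros t Ht. now apply Hform. }
    (* At every time the supremum is attained at [al]: for positive times the profile is largest
       where [g = 0]. Time 0 is treated apart, because the parameter [s] describes positive times
       only, and there the gradient is [du0] with maximum [M0]. *)
    split; [exact HL|]. exists (fun t => ux (gamma al t) t). split; [|now apply HL].
    assert (Init : forall a, 0 <= a <= 1 -> ux (gamma a 0) 0 = du0 a).
    { intros a Ha. destruct (Hfl a Ha) as [-> _]. destruct Hsol as [_ [Hux [_ [Hinit _]]]].
      apply (deriv_eq_on_01 (fun x => u x 0) u0 _ _ a Ha Hinit); [apply Hux|apply Hdu0]. }
    intros t [Ht| <-].
    + split; [split|].
      * intros y [a [Ha ->]]. rewrite !Hform by assumption. now apply gradient_profile_max; auto.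
      * intros b Hb. apply Hb. now exists al.
      * rewrite Hform by assumption. now apply (gradient_profile_pos g Cg Hg0 (s t) al a0); auto.
    + rewrite Init, Hal2 by exact Hal1. split; [split|exact HM].
      * intros y [a [Ha ->]]. rewrite Init by exact Ha. now apply Hmax.
      * intros b Hb. apply Hb. exists al. split; [exact Hal1|]. now rewrite Init.
Qed.
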